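(* Let $T>0$, $L>0$, $\sigma>0$ and $r$ be given constants and let $u_T,m_0:[0,L]\to\mathbb{R}$ satisfy the standing assumptions on the data (listed in the context). Then there exists $\epsilon_0>0$ sufficiently small such that for any $\epsilon$ with $0\le\epsilon\le\epsilon_0$ the system $$ \left\{ \begin{array}{ll} u_t + \frac{1}{2}\sigma^2 u_{xx} - ru + H(t,u_x,[mu_x]) = 0, & 0 < t < T, \ 0 < x < L,\\ m_t - \frac{1}{2}\sigma^2 m_{xx} - \left(G(t,u_x,[mu_x])m\right)_x = 0, & 0 < t < T, \ 0 < x < L,\\ m(0,x) = m_0(x),\quad u(T,x) = u_T(x), & 0 \leq x \leq L,\\ u(t,0) = m(t,0) = 0, \quad u_x(t,L) = 0, & 0 \leq t \leq T, \\ \frac{1}{2}\sigma^2 m_x(t,L) + G(t,u_x(t,L),[mu_x])m(t,L) = 0, & 0 \leq t \leq T, \end{array}\right. $$ where $H$ and $G$ are the nonlocal functions (depending on $\epsilon$) defined in the context, has at most one classical solution $(u,m)$.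
   Context: Constants: $T>0$, $L>0$, $\sigma>0$ and a real constant $r$ (discount rate) are given; $\epsilon\ge 0$ is the competition parameter. Nonlocal coefficients: for functions $u,m$ on $[0,T]\times[0,L]$ put $\eta(t)=\int_0^L m(t,x)\,dx$, $a(\eta)=\frac{1}{1+\epsilon\eta}$, $c(\eta)=1-a(\eta)=\frac{\epsilon\eta}{1+\epsilon\eta}$, and $$\bar p(t)=\frac{1}{2-c(\eta(t))}\left(a(\eta(t))+\frac{1}{\eta(t)}\int_0^L u_x(t,x)m(t,x)\,dx\right).$$ Then $$H(t,u_x,[mu_x])=\tfrac14\big(a(\eta(t))+c(\eta(t))\bar p(t)-u_x\big)^2,\qquad G(t,u_x,[mu_x])=\tfrac12\big(a(\eta(t))+c(\eta(t))\bar p(t)-u_x\big).$$ Equivalently, $a(\eta(t))+c(\eta(t))\bar p(t)=\frac{2}{2+\epsilon\eta(t)}+\frac{\epsilon}{2+\epsilon\eta(t)}\int_0^L u_x(t,x)m(t,x)\,dx$. Standing assumptions on the data: (1) $u_T,m_0\in C^{2+\gamma}([0,L])$ for some $\gamma>0$ (second derivatives Hölder continuous with exponent $\gamma$); (2) $u_T(0)=u_T'(L)=0$ and $m_0(0)=m_0(L)=m_0'(L)=0$; (3) $m_0\ge 0$ and $\int_0^L m_0(x)\,dx=1$; (4) $u_T\ge 0$ and $u_T'\ge 0$. ''Classical solution'' means that all the equations of the system hold pointwise. *)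

(* Defs.v *)
From Stdlib Require Import Reals.
From Coquelicot Require Import Coquelicot.

Local Open Scope R_scope.

(* Functions on [0,T] x [0,L] are total functions [f t x]; only their values on
   the closed rectangle matter. *)

Definition space (L : R) (x : R) : Prop := 0 <= x <= L.

Definition rect (T L : R) (p : R * R) : Prop :=
  0 <= fst p <= T /\ 0 <= snd p <= L.

Definition rect_interior (T L : R) (p : R * R) : Prop :=
  0 < fst p < T /\ 0 < snd p < L.

(* [D_in f f' (space L) x] is the derivative relative to [0,L]: one-sided at
   0 and L, two-sided in between. *)
Definition derivative_on (L : R) (f f' : R -> R) : Prop :=
  forall x, space L x -> D_in f f' (space L) x.

(* [Rpower 0 gamma] is not 0 in the library, hence [x <> y]. *)
Definition holder_on (L gamma : R) (f : R -> R) : Prop :=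
  exists K, forall x y, space L x -> space L y -> x <> y ->
    Rabs (f x - f y) <= K * Rpower (Rabs (x - y)) gamma.

(* f is in C^{2+gamma}([0,L]), with first derivative f'. *)
Definition C2_holder (L gamma : R) (f f' : R -> R) : Prop :=
  exists f'', derivative_on L f f' /\ derivative_on L f' f'' /\
    holder_on L gamma f''.

Definition standing_data (L : R) (uT m0 : R -> R) : Prop :=
  exists (gamma : R) (uT' m0' : R -> R),
    0 < gamma /\
    C2_holder L gamma uT uT' /\ C2_holder L gamma m0 m0' /\
    (uT 0 = 0 /\ uT' L = 0) /\
    (m0 0 = 0 /\ m0 L = 0 /\ m0' L = 0) /\
    ((forall x, space L x -> 0 <= m0 x) /\ RInt m0 0 L = 1) /\
    (forall x, space L x -> 0 <= uT x /\ 0 <= uT' x).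

Definition eta (L : R) (m : R -> R -> R) (t : R) : R :=
  RInt (fun x => m t x) 0 L.

Definition a (eps h : R) : R := 1 / (1 + eps * h).

Definition c (eps h : R) : R := 1 - a eps h.

(* When eta(t) = 0 the factor 1 / eta(t) has no meaning (it is 0 in the
   library); then c(eta(t)) = 0 and [pbar] does not affect [H] and [G]. *)
Definition pbar (eps L : R) (u_x m : R -> R -> R) (t : R) : R :=
  1 / (2 - c eps (eta L m t)) *
    (a eps (eta L m t)
     + 1 / eta L m t * RInt (fun x => u_x t x * m t x) 0 L).

Definition H (eps L : R) (u_x m : R -> R -> R) (t x : R) : R :=
  1 / 4 * (a eps (eta L m t) + c eps (eta L m t) * pbar eps L u_x m t
           - u_x t x) ^ 2.

Definition G (eps L : R) (u_x m : R -> R -> R) (t x : R) : R :=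
  1 / 2 * (a eps (eta L m t) + c eps (eta L m t) * pbar eps L u_x m t
           - u_x t x).

(* f_t, f_x, f_xx are the derivatives of f: f and f_x exist and are continuous
   up to the boundary (f_x occurs in the boundary conditions and in the
   integral over [0,L]), f_t and f_xx exist and are continuous where the
   equations are posed. *)
Definition parabolic_C12 (T L : R) (f f_t f_x f_xx : R -> R -> R) : Prop :=
  continuous_on (rect T L) (fun p : R * R => f (fst p) (snd p)) /\
  continuous_on (rect T L) (fun p : R * R => f_x (fst p) (snd p)) /\
  continuous_on (rect_interior T L) (fun p : R * R => f_t (fst p) (snd p)) /\
  continuous_on (rect_interior T L) (fun p : R * R => f_xx (fst p) (snd p)) /\
  (forall t, 0 <= t <= T -> derivative_on L (f t) (f_x t)) /\
  (forall t x, 0 < t < T -> 0 < x < L ->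
     is_derive (fun s => f s x) t (f_t t x) /\
     is_derive (fun y => f_x t y) x (f_xx t x)).

(* In the second equation the derivative of G m in x exists, since u_x and m
   are differentiable in x there. *)
Definition classical_solution (T L sigma r eps : R) (uT m0 : R -> R)
    (u m : R -> R -> R) : Prop :=
  exists u_t u_x u_xx m_t m_x m_xx : R -> R -> R,
    parabolic_C12 T L u u_t u_x u_xx /\
    parabolic_C12 T L m m_t m_x m_xx /\
    (forall t x, 0 < t < T -> 0 < x < L ->
       u_t t x + 1 / 2 * sigma ^ 2 * u_xx t x - r * u t x
       + H eps L u_x m t x = 0) /\
    (forall t x, 0 < t < T -> 0 < x < L ->
       m_t t x - 1 / 2 * sigma ^ 2 * m_xx t x
       - Derive (fun y => G eps L u_x m t y * m t y) x = 0) /\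
    (forall x, 0 <= x <= L -> m 0 x = m0 x /\ u T x = uT x) /\
    (forall t, 0 <= t <= T -> u t 0 = 0 /\ m t 0 = 0 /\ u_x t L = 0) /\
    (forall t, 0 <= t <= T ->
       1 / 2 * sigma ^ 2 * m_x t L + G eps L u_x m t L * m t L = 0).

(* Main.v *)
Require Import Defs.
From Stdlib Require Import Reals Lra Classical ClassicalEpsilon.
From Coquelicot Require Import Coquelicot.

(** Two solutions interact only through the price
    A(t) = a(eta) + c(eta) pbar, and the equations see its difference with a
    factor eps. So an energy estimate closes for small eps, provided that its
    constants do not depend on the solutions or on eps. Those uniform constants
    are the hard part, because the threshold is fixed before the solutions.

    Uniform bounds.
    - The density is nonnegative ([density_nonneg]): the energy of its negative
      part stays zero as long as the price is bounded, and the price can only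
      blow up if the mass becomes negative. Hence the mass lies in [0, 1]
      ([eta_le_1]) and A = (2 + eps I) / (2 + eps eta) with I the integral of
      u_x m ([price_formula]).
    - Suppose that |A| <= 2 on [t0, T]. A logarithmic barrier bounds u by a multiple
      of x ([value_below_barrier]), and a doubling of variables carries this boundary
      bound to all of [0, L] ([doubling_lipschitz]): at a maximum of
      u(x) - u(y) - M (x - y) both slopes equal M, so the nonlocal Hamiltonian
      cancels. Thus |u_x| <= M with M depending on the data alone. Conversely
      |u_x| <= M + 1 gives |A| <= 2 when eps (M + 1) <= 2. Going backward from T
      in short time steps closes this circle ([slope_bounded]).
    - With the drift bounded, the L2 norm of the density is bounded
      ([density_L2_bound]).

    Energy. Let w = u1 - u2, mu = m1 - m2 and N(t, x) = int_x^L mu. Measuring mu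
    through N costs one derivative less: the term (G1 - G2) m2 in the flux
    then needs m2 in L2 and not in L^infinity. For large kappa and a suitable K,
    exp(-kappa t) |N|^2 - K exp(kappa t) |w|^2 is nonincreasing in time
    ([coupled_energy_nonincreasing]): diffusion in the first term controls
    |mu|^2, diffusion in the second, which runs backward, controls |w_x|^2, and the
    square of the price difference is at most a multiple of eps^2 times their sum.
    At t = 0 the quantity is nonpositive since N = 0, at t = T it is nonnegative
    since w = 0, so it vanishes identically; comparing two values of kappa gives
    N = 0 and w = 0 ([solutions_agree]).

    Time derivatives and second space derivatives exist only in the open
    rectangle, with no bound near its boundary. Therefore every integral identity
    comes from one balance law on shrinking intervals ([flux_balance_le]), where
    only the flux has to be continuous up to the boundary. *)

Local Open Scope R_scope.

(** * Continuity, derivatives and integrals on the line *)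

Definition cont2 (f : R -> R -> R) : Prop :=
  forall t x, continuous (fun p : R * R => f (fst p) (snd p)) (t, x).

(** The next lemmas are the rules used by the tactic [cont]: real operations in
    place of the module operations, so that they apply by unification. *)
Lemma cont_plus {U : UniformSpace} (f g : U -> R) p :
  continuous f p -> continuous g p -> continuous (fun q => f q + g q) p.
Proof. intros; now apply (continuous_plus f g). Qed.

Lemma cont_opp {U : UniformSpace} (f : U -> R) p :
  continuous f p -> continuous (fun q => - f q) p.
Proof. intros; now apply (continuous_opp f). Qed.

Lemma cont_minus {U : UniformSpace} (f g : U -> R) p :
  continuous f p -> continuous g p -> continuous (fun q => f q - g q) p.
Proof. intros; now apply (continuous_minus f g). Qed.

Lemma cont_mult {U : UniformSpace} (f g : U -> R) p :
  continuous f p -> continuous g p -> continuous (fun q => f q * g q) p.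
Proof. intros; now apply (continuous_mult f g). Qed.

Lemma cont_pow {U : UniformSpace} (f : U -> R) n p :
  continuous f p -> continuous (fun q => f q ^ n) p.
Proof.
  intros hf; induction n as [|n IH]; simpl.
  - apply continuous_const.
  - now apply cont_mult.
Qed.

Lemma cont_comp {U : UniformSpace} (g : R -> R) (f : U -> R) p :
  continuous f p -> (forall y, continuous g y) -> continuous (fun q => g (f q)) p.
Proof. intros hf hg; now apply (continuous_comp f g). Qed.

Lemma cont_inv {U : UniformSpace} (f : U -> R) p :
  continuous f p -> f p <> 0 -> continuous (fun q => / f q) p.
Proof. intros hf h0; apply (continuous_comp f Rinv); [easy|]. now apply continuous_Rinv. Qed.

Lemma cont2_comp {U : UniformSpace} (f : R -> R -> R) (a b : U -> R) p :
  cont2 f -> continuous a p -> continuous b p ->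
  continuous (fun q => f (a q) (b q)) p.
Proof.
  intros hf ha hb; apply (continuous_comp_2 a b f p ha hb (hf (a p) (b p))).
Qed.

Lemma cont_fst (p : R * R) : continuous (fun q : R * R => fst q) p.
Proof. destruct p; apply continuous_fst. Qed.

Lemma cont_snd (p : R * R) : continuous (fun q : R * R => snd q) p.
Proof. destruct p; apply continuous_snd. Qed.

Lemma cont_id {U : UniformSpace} (p : U) : continuous (fun q => q) p.
Proof. apply continuous_id. Qed.

Lemma cont_exp y : continuous exp y.
Proof. apply continuous_exp. Qed.

Lemma cont_Rabs y : continuous Rabs y.
Proof. apply continuous_Rabs. Qed.

Lemma cont_Rmin {U : UniformSpace} (f g : U -> R) p :
  continuous f p -> continuous g p -> continuous (fun q => Rmin (f q) (g q)) p.
Proof.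
  intros hf hg.
  apply (continuous_ext (fun q => / 2 * (f q + g q - Rabs (f q - g q)))).
  - intros q; unfold Rmin, Rabs; destruct (Rle_dec _ _), (Rcase_abs _); lra.
  - apply cont_mult; [apply continuous_const|].
    apply cont_minus; [now apply cont_plus|].
    apply cont_comp; [now apply cont_minus | apply cont_Rabs].
Qed.

Lemma cont_Rmax {U : UniformSpace} (f g : U -> R) p :
  continuous f p -> continuous g p -> continuous (fun q => Rmax (f q) (g q)) p.
Proof.
  intros hf hg.
  apply (continuous_ext (fun q => - Rmin (- f q) (- g q))).
  - intros q; unfold Rmin, Rmax; destruct (Rle_dec _ _), (Rle_dec _ _); lra.
  - apply cont_opp, cont_Rmin; now apply cont_opp.
Qed.

(** Eta-reduced operators such as [Rmult b] appear after unification, hence the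
    patterns with a partial application. *)
Ltac cont :=
  lazymatch goal with
  | |- cont2 _ => let t := fresh "t" in let x := fresh "x" in intros t x; cont
  | |- continuous (fun q => q) _ => apply cont_id
  | |- continuous fst _ => apply cont_fst
  | |- continuous snd _ => apply cont_snd
  | |- continuous (Rplus ?b) ?p => change (continuous (fun q => Rplus b q) p); cont
  | |- continuous (Rminus ?b) ?p => change (continuous (fun q => Rminus b q) p); cont
  | |- continuous (Rmult ?b) ?p => change (continuous (fun q => Rmult b q) p); cont
  | |- continuous (Rdiv ?b) ?p => change (continuous (fun q => Rdiv b q) p); cont
  | |- continuous (Rmin ?b) ?p => change (continuous (fun q => Rmin b q) p); cont
  | |- continuous (Rmax ?b) ?p => change (continuous (fun q => Rmax b q) p); cont
  | |- continuous Ropp _ => apply cont_opp; cont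
  | |- continuous exp _ => apply cont_exp
  | |- continuous Rabs _ => apply cont_Rabs
  | |- continuous (fun q => _ + _) _ => apply cont_plus; cont
  | |- continuous (fun q => _ - _) _ => apply cont_minus; cont
  | |- continuous (fun q => _ * _) _ => apply cont_mult; cont
  | |- continuous (fun q => _ / _) _ => apply cont_mult; cont
  | |- continuous (fun q => - _) _ => apply cont_opp; cont
  | |- continuous (fun q => _ ^ _) _ => apply cont_pow; cont
  | |- continuous (fun q => exp _) _ => apply cont_comp; [cont | exact cont_exp]
  | |- continuous (fun q => Rabs _) _ => apply cont_comp; [cont | exact cont_Rabs]
  | |- continuous (fun q => Rmin _ _) _ => apply cont_Rmin; cont
  | |- continuous (fun q => Rmax _ _) _ => apply cont_Rmax; cont
  | h : cont2 ?f |- continuous (fun q => ?f _ _) _ => apply (cont2_comp f); [exact h | cont | cont]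
  | h : cont2 ?f |- continuous (?f ?t) _ => apply (cont2_comp f (fun _ => t) (fun y => y)); [exact h | cont | cont]
  | h : forall y, continuous ?f y |- continuous (fun q => ?f _) _ => apply (cont_comp f); [cont | exact h]
  | _ => first [apply continuous_const | easy | idtac]
  end.

(** [ring] and [field] do not see through the carrier of a normed module. *)
Ltac eqR := match goal with |- ?x = ?y => change (@eq R x y) end.

Lemma continuity_pt_cont f x : continuous f x -> continuity_pt f x.
Proof. intros h; now apply continuity_pt_filterlim. Qed.

(** The intermediate point is interior, which matters for functions that are
    differentiable only in the open interval. *)
Lemma MVT_open (f df : R -> R) a b :
  a < b -> (forall x, a < x < b -> is_derive f x (df x)) ->
  (forall x, a <= x <= b -> continuous f x) ->
  exists c, a < c < b /\ f b - f a = df c * (b - a).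
Proof.
  intros hab hd hc.
  assert (pr1 : forall c, a < c < b -> derivable_pt f c).
  { intros c hc'. exists (df c). apply is_derive_Reals, hd, hc'. }
  assert (pr2 : forall c, a < c < b -> derivable_pt id c).
  { intros c _. apply derivable_pt_id. }
  destruct (MVT f id a b pr1 pr2 hab) as (c & P & e).
  - intros; now apply continuity_pt_cont, hc.
  - intros; apply derivable_continuous_pt, derivable_pt_id.
  - exists c; split; [exact P|].
    assert (e1 : derive_pt f c (pr1 c P) = df c).
    { apply derive_pt_eq_0. apply is_derive_Reals, hd, P. }
    assert (e2 : derive_pt id c (pr2 c P) = 1).
    { apply derive_pt_eq_0, derivable_pt_lim_id. }
    rewrite e1, e2 in e. unfold id in e. lra.
Qed.

Lemma ex_RInt_cont (f : R -> R) a b : (forall x, continuous f x) -> ex_RInt f a b.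
Proof. intros h. apply (ex_RInt_continuous f). intros; apply h. Qed.

Lemma RInt_split (f : R -> R) a b c :
  (forall x, continuous f x) -> RInt f a c = RInt f a b + RInt f b c.
Proof. intros h. symmetry. apply (RInt_Chasles f); now apply ex_RInt_cont. Qed.

Lemma is_derive_primitive (f : R -> R) a x :
  (forall y, continuous f y) -> is_derive (fun y => RInt f a y) x (f x).
Proof.
  intros h. apply (is_derive_RInt f _ a); [|apply h].
  apply filter_forall. intros y. apply (RInt_correct f). now apply ex_RInt_cont.
Qed.

Lemma RInt_abs_le_const (f : R -> R) a b M :
  a <= b -> (forall x, continuous f x) ->
  (forall x, a <= x <= b -> Rabs (f x) <= M) -> Rabs (RInt f a b) <= (b - a) * M.
Proof. intros hab hc hM. apply abs_RInt_le_const; auto. now apply ex_RInt_cont. Qed.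

Lemma RInt_le_cont (f g : R -> R) a b :
  a <= b -> (forall x, continuous f x) -> (forall x, continuous g x) ->
  (forall x, a < x < b -> f x <= g x) -> RInt f a b <= RInt g a b.
Proof. intros; apply RInt_le; auto; now apply ex_RInt_cont. Qed.

Lemma RInt_plus_cont (f g : R -> R) a b :
  (forall x, continuous f x) -> (forall x, continuous g x) ->
  RInt (fun x => f x + g x) a b = RInt f a b + RInt g a b.
Proof. intros; apply (RInt_plus f g); now apply ex_RInt_cont. Qed.

Lemma RInt_minus_cont (f g : R -> R) a b :
  (forall x, continuous f x) -> (forall x, continuous g x) ->
  RInt (fun x => f x - g x) a b = RInt f a b - RInt g a b.
Proof. intros; apply (RInt_minus f g); now apply ex_RInt_cont. Qed.

Lemma RInt_scal_cont (f : R -> R) k a b :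
  (forall x, continuous f x) ->
  RInt (fun x => k * f x) a b = k * RInt f a b.
Proof. intros; apply (RInt_scal f a b k); now apply ex_RInt_cont. Qed.

Lemma RInt_ge_0_cont (f : R -> R) a b :
  a <= b -> (forall x, continuous f x) -> (forall x, a < x < b -> 0 <= f x) ->
  0 <= RInt f a b.
Proof. intros; apply RInt_ge_0; auto; now apply ex_RInt_cont. Qed.

Lemma RInt_constant (k a b : R) : RInt (fun _ => k) a b = (b - a) * k.
Proof. exact (RInt_const a b k). Qed.

Lemma RInt_eq_0 (f : R -> R) a b :
  a <= b -> (forall x, a < x < b -> f x = 0) -> RInt f a b = 0.
Proof.
  intros hab hf. rewrite (RInt_ext f (fun _ => 0)).
  - rewrite RInt_constant. eqR; ring.
  - intros x hx. rewrite Rmin_left, Rmax_right in hx by lra. now apply hf.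
Qed.

Lemma zero_of_RInt_le_0 (f : R -> R) a b :
  a < b -> (forall x, continuous f x) -> (forall x, a <= x <= b -> 0 <= f x) ->
  RInt f a b <= 0 -> forall x, a <= x <= b -> f x = 0.
Proof.
  intros hab hc hp hI x hx.
  (* the primitive is squeezed between 0 and 0 *)
  assert (P0 : forall y, a <= y <= b -> RInt f a y = 0).
  { intros y hy. assert (h1 : 0 <= RInt f a y)
      by (apply RInt_ge_0_cont; try lra; auto; intros; apply hp; lra).
    assert (h2 : 0 <= RInt f y b)
      by (apply RInt_ge_0_cont; try lra; auto; intros; apply hp; lra).
    rewrite (RInt_split f a y b hc) in hI. lra. }
  destruct (Rle_lt_dec (f x) 0) as [h|h]; [specialize (hp x hx); lra|exfalso].
  destruct (proj1 (filterlim_locally (F := locally x) f (f x)) (hc x) (mkposreal _ h))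
    as [d hd].
  assert (hpos : forall y, Rabs (y - x) < d -> 0 < f y).
  { intros y hy. specialize (hd y hy).
    unfold ball in hd; simpl in hd; unfold AbsRing_ball, abs, minus, plus, opp in hd;
      simpl in hd. apply Rabs_def2 in hd. lra. }
  pose proof (cond_pos d) as hdp.
  set (y := Rmax a (x - d / 2)). set (z := Rmin b (x + d / 2)).
  assert (hyz : a <= y <= x /\ x <= z <= b /\ y < z /\ x - d/2 <= y /\ z <= x + d/2).
  { unfold y, z, Rmax, Rmin. destruct (Rle_dec _ _), (Rle_dec _ _); repeat split; lra. }
  assert (h1 : 0 < RInt f y z).
  { apply RInt_gt_0; [lra| |intros; apply hc].
    intros w hw. apply hpos, Rabs_def1; lra. }
  rewrite <- (P0 z) in h1 by lra.
  rewrite (RInt_split f a y z hc), (P0 y) in h1 by lra.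
  lra.
Qed.

Lemma is_derive_linear k (s : R) : is_derive (fun t => k * t) s k.
Proof.
  assert (h : is_derive (fun t => k * t) s (k * 1)).
  { apply (is_derive_scal (fun t => t)), (is_derive_id (K := R_AbsRing)). }
  now rewrite Rmult_1_r in h.
Qed.

Lemma is_derive_affine c k (s : R) : is_derive (fun t => c + k * t) s k.
Proof.
  assert (h : is_derive (fun t => c + k * t) s (0 + k)).
  { apply (is_derive_plus (fun _ => c) (fun t => k * t));
      [apply @is_derive_const | apply is_derive_linear]. }
  now rewrite Rplus_0_l in h.
Qed.

Lemma is_derive_exp_linear k s :
  is_derive (fun t => exp (k * t)) s (k * exp (k * s)).
Proof.
  apply (is_derive_comp exp (fun t => k * t)); [apply is_derive_exp | apply is_derive_linear].
Qed.

Lemma exp_monotone x y : x <= y -> exp x <= exp y.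
Proof. intros [h| ->]; [apply Rlt_le, exp_increasing, h | lra]. Qed.

Lemma is_derive_exp_backward k T (t : R) :
  is_derive (fun t => exp (k * (T - t))) t (- k * exp (k * (T - t))).
Proof.
  apply (is_derive_ext (fun q => exp (k * T) * exp (- k * q))).
  - intros q. eqR. rewrite <- exp_plus. f_equal. ring.
  - replace (- k * exp (k * (T - t))) with (exp (k * T) * (- k * exp (- k * t))).
    + apply (is_derive_scal (fun q => exp (- k * q))), is_derive_exp_linear.
    + replace (k * (T - t)) with (k * T + - k * t) by ring.
      rewrite exp_plus. ring.
Qed.

(** * Functions of a parameter: maxima, uniform continuity, integrals *)

Lemma near_of_continuous {U : UniformSpace} (f : U -> R) p e :
  continuous f p -> 0 < e ->
  exists d : posreal, forall q, ball p d q -> Rabs (f q - f p) < e.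
Proof.
  intros hf he.
  destruct (proj1 (filterlim_locally (F := locally p) f (f p)) hf (mkposreal e he))
    as [d hd].
  exists d. intros q hq. exact (hd q hq).
Qed.

Lemma continuous_of_near {U : UniformSpace} (f : U -> R) p :
  (forall e, 0 < e -> exists d : posreal, forall q, ball p d q -> Rabs (f q - f p) < e) ->
  continuous f p.
Proof.
  intros h. apply (filterlim_locally (F := locally p)). intros e.
  destruct (h e (cond_pos e)) as [d hd]. exists d. intros q hq. exact (hd q hq).
Qed.

(** Compactness of [[a, b]] makes the continuity in the parameter uniform in the
    second variable. *)
Lemma tube {U : UniformSpace} (F : U -> R -> R) a b p e :
  (forall p y, continuous (fun q : U * R => F (fst q) (snd q)) (p, y)) -> 0 < e ->
  exists d : posreal, forall q y, ball p d q -> a <= y <= b ->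
    Rabs (F q y - F p y) < e.
Proof.
  intros hF he.
  assert (he2 : 0 < e / 2) by lra.
  pose (P := fun y (d : posreal) => forall q, ball (p, y) d q ->
               Rabs (F (fst q) (snd q) - F p y) < e / 2).
  assert (hP : forall y, exists d, P y d)
    by (intros y; exact (near_of_continuous _ _ _ (hF p y) he2)).
  pose (delta := fun y => proj1_sig (constructive_indefinite_description _ (hP y))).
  assert (hd : forall y, P y (delta y))
    by (intros y; exact (proj2_sig (constructive_indefinite_description _ (hP y)))).
  destruct (compactness_value_1d a b delta) as [d H].
  exists d. intros q y hq hy.
  destruct (NNPP _ (H y hy)) as (t & ht & hyt & hdt).
  assert (h1 : Rabs (F q y - F p t) < e / 2).
  { apply (hd t (q, y)). split; simpl.
    - now apply ball_le with d.
    - exact hyt. }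
  assert (h2 : Rabs (F p y - F p t) < e / 2).
  { apply (hd t (p, y)). split; simpl; [apply ball_center | exact hyt]. }
  apply Rabs_def2 in h1; apply Rabs_def2 in h2. apply Rabs_def1; lra.
Qed.

(** The maximum over one variable stays continuous in the others, so that maxima
    over boxes follow one variable at a time. *)
Lemma max_param {U : UniformSpace} (F : U -> R -> R) a b :
  a <= b ->
  (forall p y, continuous (fun q : U * R => F (fst q) (snd q)) (p, y)) ->
  exists g : U -> R,
    (forall p, a <= g p <= b /\ forall y, a <= y <= b -> F p y <= F p (g p)) /\
    forall p, continuous (fun q => F q (g q)) p.
Proof.
  intros hab hF.
  assert (hmax : forall p, exists y0, a <= y0 <= b /\
                   forall y, a <= y <= b -> F p y <= F p y0).
  { intros p. destruct (continuity_ab_maj (F p) a b hab) as (M & h1 & h2).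
    - intros y _. apply continuity_pt_cont.
      apply (continuous_comp_2 (fun _ => p) (fun y => y) F); [| |apply hF]; cont.
    - exists M; split; [exact h2 | exact h1]. }
  pose (g := fun p => proj1_sig (constructive_indefinite_description _ (hmax p))).
  assert (hg : forall p, a <= g p <= b /\ forall y, a <= y <= b -> F p y <= F p (g p))
    by (intros p; exact (proj2_sig (constructive_indefinite_description _ (hmax p)))).
  exists g; split; [exact hg|].
  intros p. apply continuous_of_near. intros e he.
  destruct (tube F a b p e hF he) as [d hd]. exists d. intros q hq.
  destruct (hg p) as [gp mp], (hg q) as [gq mq].
  generalize (hd q (g p) hq gp) (hd q (g q) hq gq) (mp (g q) gq) (mq (g p) gp).
  intros h1 h2 h3 h4. apply Rabs_def2 in h1; apply Rabs_def2 in h2.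
  apply Rabs_def1; lra.
Qed.

Lemma max_2d (F : R -> R -> R) a b c d :
  a <= b -> c <= d -> cont2 F ->
  exists t x, a <= t <= b /\ c <= x <= d /\
    forall s y, a <= s <= b -> c <= y <= d -> F s y <= F t x.
Proof.
  intros hab hcd hF.
  destruct (max_param F c d hcd hF) as (g & hg & cg).
  destruct (continuity_ab_maj (fun t => F t (g t)) a b hab) as (t & h1 & h2).
  { intros t _. apply continuity_pt_cont, cg. }
  exists t, (g t). split; [exact h2|]. split; [apply hg|].
  intros s y hs hy. apply Rle_trans with (F s (g s)); [now apply hg | now apply h1].
Qed.

Lemma max_3d (F : R -> R -> R -> R) a b c d :
  a <= b -> c <= d ->
  (forall p, continuous (fun p : R * R * R => F (fst (fst p)) (snd (fst p)) (snd p)) p) ->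
  exists t x y, a <= t <= b /\ c <= x <= d /\ c <= y <= d /\
    forall t' x' y', a <= t' <= b -> c <= x' <= d -> c <= y' <= d ->
      F t' x' y' <= F t x y.
Proof.
  intros hab hcd hF.
  destruct (max_param (fun p : R * R => F (fst p) (snd p)) c d hcd) as (g & hg & cg).
  { intros p y. apply (hF (p, y)). }
  destruct (max_2d (fun t x => F t x (g (t, x))) a b c d hab hcd) as (t & x & ht & hx & hm).
  { intros t x. apply (continuous_ext (fun q : R * R => F (fst q) (snd q) (g q))).
    - intros [? ?]; reflexivity.
    - apply cg. }
  exists t, x, (g (t, x)). repeat split; try tauto; try apply hg.
  intros t' x' y' ht' hx' hy'.
  apply Rle_trans with (F t' x' (g (t', x'))); [now apply (hg (t', x')) | now apply hm].
Qed.

Lemma bounded_2d (f : R -> R -> R) a b c d :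
  a <= b -> c <= d -> cont2 f ->
  exists M, 0 <= M /\ forall t x, a <= t <= b -> c <= x <= d -> Rabs (f t x) <= M.
Proof.
  intros hab hcd hf.
  destruct (max_2d (fun t x => Rabs (f t x)) a b c d hab hcd) as (t & x & _ & _ & hm).
  { cont. }
  exists (Rabs (f t x)). split; [apply Rabs_pos | exact hm].
Qed.

Lemma uniform_2d (f : R -> R -> R) a b c d e :
  cont2 f -> 0 < e ->
  exists del, 0 < del /\ forall t x s y,
    a <= t <= b -> c <= x <= d -> a <= s <= b -> c <= y <= d ->
    Rabs (s - t) < del -> Rabs (y - x) < del -> Rabs (f s y - f t x) < e.
Proof.
  intros hf he.
  destruct (uniform_continuity_2d f a b c d) with (eps := mkposreal e he) as [del h].
  - intros x y _ _. apply continuity_2d_pt_filterlim, hf.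
  - exists del; split; [apply cond_pos | intros; now apply h].
Qed.

Lemma cont_RInt_param (f : R -> R -> R) a :
  cont2 f -> cont2 (fun t x => RInt (f t) a x).
Proof.
  intros hf t x. apply continuous_of_near. intros e he. simpl.
  assert (cf : forall t y, continuous (f t) y) by (intros; cont).
  set (l := Rabs (x - a) + 1).
  assert (hl : 0 < l) by (unfold l; generalize (Rabs_pos (x - a)); lra).
  destruct (tube f (Rmin a x) (Rmax a x) t (e / 2 / l) hf) as [d1 h1].
  { apply Rdiv_lt_0_compat; lra. }
  destruct (bounded_2d f (t - 1) (t + 1) (x - 1) (x + 1)) as (M & hM0 & hM);
    [lra | lra | exact hf |].
  assert (hd : 0 < Rmin d1 (Rmin 1 (e / 2 / (M + 1)))).
  { generalize (cond_pos d1); intros. apply Rmin_glb_lt; [lra|].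
    apply Rmin_glb_lt; [lra|]. apply Rdiv_lt_0_compat; lra. }
  exists (mkposreal _ hd). intros [s y] [hs hy]; simpl in hs, hy |- *.
  assert (hs1 := Rlt_le_trans _ _ _ hs (Rmin_l _ _)).
  assert (hs2 := Rlt_le_trans _ _ _ hs (Rmin_r _ _)).
  assert (hs3 := Rlt_le_trans _ _ _ hs2 (Rmin_l _ _)).
  assert (hy2 := Rlt_le_trans _ _ _ hy (Rmin_r _ _)).
  assert (hy3 := Rlt_le_trans _ _ _ hy2 (Rmin_l _ _)).
  assert (hy4 := Rlt_le_trans _ _ _ hy2 (Rmin_r _ _)).
  unfold abs, minus, plus, opp in hs1, hs3, hy3, hy4; simpl in hs1, hs3, hy3, hy4.
  apply Rabs_def2 in hs3. apply Rabs_def2 in hy3.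
  rewrite (RInt_split (f s) a x y) by auto.
  replace (RInt (f s) a x + RInt (f s) x y - RInt (f t) a x)
    with (RInt (fun z => f s z - f t z) a x + RInt (f s) x y)
    by (rewrite RInt_minus_cont by auto; ring).
  assert (b1 : Rabs (RInt (fun z => f s z - f t z) a x) <= Rabs (x - a) * (e / 2 / l)).
  { apply (norm_RInt_le_const_abs (V := R_NormedModule) (fun z => f s z - f t z) a x
       (RInt (fun z => f s z - f t z) a x)).
    - intros z hz. apply Rlt_le. now apply h1.
    - apply (RInt_correct (fun z => f s z - f t z)). apply ex_RInt_cont.
      intros z; apply cont_minus; auto. }
  assert (b2 : Rabs (RInt (f s) x y) <= Rabs (y - x) * M).
  { apply (norm_RInt_le_const_abs (V := R_NormedModule) (f s) x y (RInt (f s) x y)).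
    - intros z hz. apply hM; [lra|]. revert hz. unfold Rmin, Rmax.
      destruct (Rle_dec x y); lra.
    - apply (RInt_correct (f s)). now apply ex_RInt_cont. }
  assert (b3 : Rabs (x - a) * (e / 2 / l) < e / 2).
  { apply Rlt_le_trans with (l * (e / 2 / l)).
    - apply Rmult_lt_compat_r; [apply Rdiv_lt_0_compat; lra | unfold l; lra].
    - apply Req_le; field; lra. }
  assert (b4 : Rabs (y - x) * M <= e / 2).
  { apply Rle_trans with (e / 2 / (M + 1) * (M + 1)).
    - apply Rmult_le_compat; [apply Rabs_pos | lra | unfold Rminus; lra | lra].
    - apply Req_le; field; lra. }
  eapply Rle_lt_trans; [apply Rabs_triang|]. lra.
Qed.

(** * Integral balance laws with one-sided control at the boundary *)

(** Suppose f_t = b_x + g, where f_t is known in the interior only. Integrating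
    over [[a + k, d - k]] avoids the boundary; the flux b is continuous at the end
    points uniformly in time, so letting k tend to 0 leaves the sign of
    b(d) - b(a) + int g, and the integral of f cannot increase. *)
Lemma flux_balance_le (f ft b g : R -> R -> R) (S a d Cg : R) :
  0 < S -> a < d -> cont2 f ->
  (forall t x, 0 < t < S -> a < x < d -> is_derive (fun s => f s x) t (ft t x)) ->
  (forall t x, 0 < t < S -> a < x < d ->
     continuous (fun p : R * R => ft (fst p) (snd p)) (t, x)) ->
  (forall t x, 0 < t < S -> a < x < d -> is_derive (b t) x (ft t x - g t x)) ->
  (forall t x, 0 < t < S -> continuous (g t) x) ->
  (forall t x, 0 < t < S -> a <= x <= d -> Rabs (g t x) <= Cg) ->
  (forall e, 0 < e -> exists del, 0 < del /\ forall t x, 0 < t < S -> a <= x <= d ->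
     (x - a < del -> Rabs (b t x - b t a) <= e) /\
     (d - x < del -> Rabs (b t d - b t x) <= e)) ->
  (forall t, 0 < t < S -> b t d - b t a + RInt (g t) a d <= 0) ->
  forall s t, 0 <= s <= t -> t <= S -> RInt (f t) a d <= RInt (f s) a d.
Proof.
  intros hS had cf hft cft hb cg hg eb hle s t hst htS.
  destruct (Req_dec s t) as [<-|hne]; [lra|].
  assert (hlt : s < t) by lra.
  assert (hCg : 0 <= Cg).
  { apply Rle_trans with (2 := hg (S / 2) a ltac:(lra) ltac:(lra)). apply Rabs_pos. }
  destruct (bounded_2d f 0 S a d) as (M & hM0 & hM); [lra | lra | exact cf |].
  assert (cfs : forall t y, continuous (f t) y) by (intros; cont).
  assert (cI : forall α β y, continuous (fun t => RInt (f t) α β) y).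
  { intros α β y. apply (cont2_comp (fun t x => RInt (f t) α x) (fun t => t) (fun _ => β)).
    - now apply cont_RInt_param.
    - cont.
    - cont. }
  apply Rnot_lt_le. intros hcon.
  set (D := RInt (f t) a d - RInt (f s) a d) in *.
  assert (hD : 0 < D) by (unfold D; lra).
  (* the errors below add up to at most 4 e S + 4 e, less than e (4 S + 5) = D *)
  set (e := D / (4 * S + 5)).
  assert (he : 0 < e) by (unfold e; apply Rdiv_lt_0_compat; lra).
  destruct (eb e he) as (del & hdel & heb).
  set (k := Rmin (del / 2) (Rmin ((d - a) / 4) (Rmin (e / (Cg + 1)) (e / (M + 1))))).
  assert (hk : 0 < k).
  { unfold k. repeat apply Rmin_glb_lt; try lra; apply Rdiv_lt_0_compat; lra. }
  assert (k1 : k <= del / 2) by apply Rmin_l.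
  assert (k2 : k <= (d - a) / 4) by (unfold k; rewrite Rmin_r; apply Rmin_l).
  assert (k3 : k * (Cg + 1) <= e).
  { apply Rle_trans with (e / (Cg + 1) * (Cg + 1)); [|apply Req_le; field; lra].
    apply Rmult_le_compat_r; [lra|]. unfold k. rewrite Rmin_r, Rmin_r; apply Rmin_l. }
  assert (k4 : k * (M + 1) <= e).
  { apply Rle_trans with (e / (M + 1) * (M + 1)); [|apply Req_le; field; lra].
    apply Rmult_le_compat_r; [lra|]. unfold k. rewrite Rmin_r, Rmin_r; apply Rmin_r. }
  set (α := a + k). set (β := d - k).
  assert (hαβ : a < α < d /\ a < β < d /\ α < β) by (unfold α, β; lra).
  assert (split : forall h, (forall y, continuous h y) -> forall C,
     (forall x, a <= x <= d -> Rabs (h x) <= C) ->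
     Rabs (RInt h a d - RInt h α β) <= 2 * k * C).
  { intros h ch C hC.
    rewrite (RInt_split h a α d ch), (RInt_split h α β d ch).
    assert (q1 : Rabs (RInt h a α) <= (α - a) * C)
      by (apply RInt_abs_le_const; [lra | auto | intros; apply hC; lra]).
    assert (q2 : Rabs (RInt h β d) <= (d - β) * C)
      by (apply RInt_abs_le_const; [lra | auto | intros; apply hC; lra]).
    replace (α - a) with k in q1 by (unfold α; ring).
    replace (d - β) with k in q2 by (unfold β; ring).
    replace (RInt h a α + (RInt h α β + RInt h β d) - RInt h α β)
      with (RInt h a α + RInt h β d) by ring.
    eapply Rle_trans; [apply Rabs_triang|]. lra. }
  destruct (MVT_open (fun r => RInt (f r) α β) (fun r => RInt (ft r) α β) s t hlt)
    as (r & hr & hmvt).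
  - intros r hr.
    assert (hDer : forall q x, 0 < q < S -> a < x < d ->
                     Derive (fun z => f z x) q = ft q x).
    { intros q x hq hx. apply is_derive_unique, hft; auto. }
    replace (RInt (ft r) α β) with (RInt (fun x => Derive (fun z => f z x) r) α β).
    2:{ apply RInt_ext. intros x hx. rewrite Rmin_left, Rmax_right in hx by lra.
        apply hDer; lra. }
    assert (Lr : locally r (fun q => 0 < q < S)).
    { apply (locally_interval _ r 0 S); simpl; try lra. intros; lra. }
    apply (is_derive_RInt_param f α β r).
    + revert Lr. apply filter_imp. intros q hq x hx.
      rewrite Rmin_left, Rmax_right in hx by lra.
      exists (ft q x). apply hft; lra.
    + intros x hx. rewrite Rmin_left, Rmax_right in hx by lra.
      apply continuity_2d_pt_ext_loc with ft.
      * assert (hp : 0 < Rmin (Rmin r (S - r)) (Rmin (x - a) (d - x)))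
          by (repeat apply Rmin_glb_lt; lra).
        exists (mkposreal _ hp). simpl. intros u v hu hv.
        assert (u1 := Rlt_le_trans _ _ _ hu (Rmin_l _ _)).
        assert (u2 := Rlt_le_trans _ _ _ u1 (Rmin_l _ _)).
        assert (u3 := Rlt_le_trans _ _ _ u1 (Rmin_r _ _)).
        assert (v1 := Rlt_le_trans _ _ _ hv (Rmin_r _ _)).
        assert (v2 := Rlt_le_trans _ _ _ v1 (Rmin_l _ _)).
        assert (v3 := Rlt_le_trans _ _ _ v1 (Rmin_r _ _)).
        apply Rabs_def2 in u2; apply Rabs_def2 in u3.
        apply Rabs_def2 in v2; apply Rabs_def2 in v3.
        symmetry; apply hDer; lra.
      * apply continuity_2d_pt_filterlim. apply cft; lra.
    + apply filter_forall. intros q. apply ex_RInt_cont. auto.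
  - intros x _. apply cI.
  - assert (hr' : 0 < r < S) by lra.
    assert (cft1 : forall x, a < x < d -> continuous (ft r) x).
    { intros x hx. apply (continuous_comp_2 (fun _ => r) (fun y => y) ft x);
        [cont | cont | apply cft; auto]. }
    assert (Ib : RInt (fun x => ft r x - g r x) α β = b r β - b r α).
    { apply is_RInt_unique. apply (is_RInt_derive (b r)).
      - intros x hx. rewrite Rmin_left, Rmax_right in hx by lra. apply hb; lra.
      - intros x hx. rewrite Rmin_left, Rmax_right in hx by lra.
        apply cont_minus; [apply cft1; lra | now apply cg]. }
    assert (e1 : ex_RInt (ft r) α β).
    { apply (ex_RInt_continuous (ft r)). intros x hx.
      rewrite Rmin_left, Rmax_right in hx by lra. apply cft1; lra. }
    assert (e2 : ex_RInt (g r) α β) by (apply ex_RInt_cont; intros; now apply cg).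
    assert (Im := RInt_minus (ft r) (g r) α β e1 e2).
    unfold minus, plus, opp in Im; simpl in Im. unfold Rminus in Ib.
    rewrite Im in Ib. clear Im.
    assert (sg := split (g r) (fun y => cg r y hr') Cg (fun x hx => hg r x hr' hx)).
    assert (st := split (f t) (cfs t) M (fun x hx => hM t x ltac:(lra) hx)).
    assert (ss := split (f s) (cfs s) M (fun x hx => hM s x ltac:(lra) hx)).
    assert (b1 := proj1 (heb r α hr' ltac:(lra)) ltac:(unfold α; lra)).
    assert (b2 := proj2 (heb r β hr' ltac:(lra)) ltac:(unfold β; lra)).
    specialize (hle r hr').
    apply Rabs_le_between in sg, st, ss, b1, b2.
    assert (hft4 : RInt (ft r) α β <= 4 * e) by lra.
    assert (hm2 : RInt (ft r) α β * (t - s) <= 4 * e * S).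
    { apply Rle_trans with (4 * e * (t - s)).
      - apply Rmult_le_compat_r; lra.
      - apply Rmult_le_compat_l; lra. }
    assert (hDe : D = e * (4 * S + 5)) by (unfold e; field; lra).
    assert (D <= 4 * e * S + 4 * e) by (unfold D; lra).
    lra.
Qed.

(** In all applications the flux and the source are affine in a coefficient p(t)
    that is bounded. It may jump in time: so may the price, as long as the
    positivity of the density is not known. *)
Lemma flux_balance_bounded_price (f ft b0 b1 g0 g1 : R -> R -> R) (p : R -> R)
    (S a d P : R) :
  0 < S -> a < d -> cont2 f -> cont2 b0 -> cont2 b1 -> cont2 g0 -> cont2 g1 ->
  (forall t, 0 < t < S -> Rabs (p t) <= P) ->
  (forall t x, 0 < t < S -> a < x < d -> is_derive (fun s => f s x) t (ft t x)) ->
  (forall t x, 0 < t < S -> a < x < d ->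
     continuous (fun p : R * R => ft (fst p) (snd p)) (t, x)) ->
  (forall t x, 0 < t < S -> a < x < d ->
     is_derive (fun y => b0 t y + p t * b1 t y) x
       (ft t x - (g0 t x + p t * g1 t x))) ->
  (forall t, 0 < t < S ->
     b0 t d + p t * b1 t d - (b0 t a + p t * b1 t a)
     + RInt (fun x => g0 t x + p t * g1 t x) a d <= 0) ->
  forall s t, 0 <= s <= t -> t <= S -> RInt (f t) a d <= RInt (f s) a d.
Proof.
  intros hS had cf cb0 cb1 cg0 cg1 hp hft cft hb hle.
  assert (hP : 0 <= P).
  { apply Rle_trans with (2 := hp (S / 2) ltac:(lra)). apply Rabs_pos. }
  destruct (bounded_2d g0 0 S a d) as (M0 & hM0 & h0); [lra | lra | exact cg0 |].
  destruct (bounded_2d g1 0 S a d) as (M1 & hM1 & h1); [lra | lra | exact cg1 |].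
  apply (flux_balance_le f ft (fun t y => b0 t y + p t * b1 t y)
           (fun t y => g0 t y + p t * g1 t y) S a d (M0 + P * M1)); auto.
  - intros t x ht. cont.
  - intros t x ht hx. eapply Rle_trans; [apply Rabs_triang|].
    rewrite Rabs_mult. apply Rplus_le_compat; [apply h0; lra|].
    apply Rmult_le_compat; try apply Rabs_pos; [now apply hp | apply h1; lra].
  - intros e he.
    destruct (uniform_2d b0 0 S a d (e / 2) cb0 ltac:(lra)) as (d0 & hd0 & u0).
    destruct (uniform_2d b1 0 S a d (e / 2 / (P + 1)) cb1) as (d1 & hd1 & u1).
    { apply Rdiv_lt_0_compat; lra. }
    assert (key : forall t x y, 0 < t < S -> a <= x <= d -> a <= y <= d ->
       Rabs (y - x) < Rmin d0 d1 ->
       Rabs (b0 t y + p t * b1 t y - (b0 t x + p t * b1 t x)) <= e).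
    { intros t x y ht hx hy hxy.
      assert (z : forall q, 0 < q -> Rabs (t - t) < q)
        by (intros; unfold Rminus; rewrite Rplus_opp_r, Rabs_R0; auto).
      assert (i0 := u0 t x t y ltac:(lra) hx ltac:(lra) hy (z _ hd0)
                 (Rlt_le_trans _ _ _ hxy (Rmin_l _ _))).
      assert (i1 := u1 t x t y ltac:(lra) hx ltac:(lra) hy (z _ hd1)
                 (Rlt_le_trans _ _ _ hxy (Rmin_r _ _))).
      replace (b0 t y + p t * b1 t y - (b0 t x + p t * b1 t x))
        with ((b0 t y - b0 t x) + p t * (b1 t y - b1 t x)) by ring.
      eapply Rle_trans; [apply Rabs_triang|]. rewrite Rabs_mult.
      assert (i2 : Rabs (p t) * Rabs (b1 t y - b1 t x) <= (P + 1) * (e / 2 / (P + 1))).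
      { apply Rmult_le_compat; try apply Rabs_pos; [|lra].
        specialize (hp t ht); lra. }
      replace ((P + 1) * (e / 2 / (P + 1))) with (e / 2) in i2 by (field; lra).
      lra. }
    exists (Rmin d0 d1). split; [now apply Rmin_glb_lt|].
    intros t x ht hx. split; intros hxd; apply key; try lra; auto.
    + rewrite Rabs_pos_eq; lra.
    + rewrite Rabs_pos_eq; lra.
Qed.

(** * Pointwise maximum principles and the logarithmic barrier *)

Lemma ball_R (x d y : R) : ball x d y <-> Rabs (y - x) < d.
Proof. reflexivity. Qed.

Lemma derivative_at_right_max (f : R -> R) x l d :
  0 < d -> is_derive f x l -> (forall y, x < y < x + d -> f y <= f x) -> l <= 0.
Proof.
  intros hd hf hm. apply Rnot_lt_le. intros hl.
  apply is_derive_Reals in hf. destruct (hf l hl) as [e he].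
  assert (hep := cond_pos e).
  set (h := Rmin (e / 2) (d / 2)).
  assert (hh : 0 < h /\ h <= e / 2 /\ h <= d / 2).
  { unfold h. split; [apply Rmin_glb_lt; lra | split; [apply Rmin_l | apply Rmin_r]]. }
  specialize (he h ltac:(lra) ltac:(rewrite Rabs_pos_eq; lra)).
  specialize (hm (x + h) ltac:(lra)).
  apply Rabs_def2 in he.
  assert (q : (f (x + h) - f x) / h * h <= 0)
    by (unfold Rdiv; rewrite Rmult_assoc, Rinv_l by lra; lra).
  nra.
Qed.

Lemma derivative_at_left_max (f : R -> R) x l d :
  0 < d -> is_derive f x l -> (forall y, x - d < y < x -> f y <= f x) -> 0 <= l.
Proof.
  intros hd hf hm.
  assert (h : - l <= 0); [|lra].
  apply (derivative_at_right_max (fun y => f (- y)) (- x) (- l) d hd).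
  - replace (- l) with (-1 * l) by ring.
    apply (is_derive_comp f (fun y => - y)).
    + now rewrite Ropp_involutive.
    + apply (is_derive_ext (fun y => -1 * y)); [intros; eqR; ring | apply is_derive_linear].
  - intros y hy. rewrite Ropp_involutive. apply hm. lra.
Qed.

Lemma second_derivative_at_max (f f' : R -> R) x l d :
  0 < d -> (forall y, x <= y < x + d -> is_derive f y (f' y)) -> f' x = 0 ->
  is_derive f' x l -> (forall y, x < y < x + d -> f y <= f x) -> l <= 0.
Proof.
  intros hd hf h0 hf' hm. apply Rnot_lt_le. intros hl.
  apply is_derive_Reals in hf'. destruct (hf' l hl) as [e he].
  assert (hep := cond_pos e).
  set (h := Rmin (e / 2) (d / 2)).
  assert (hh : 0 < h /\ h <= e / 2 /\ h <= d / 2).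
  { unfold h. split; [apply Rmin_glb_lt; lra | split; [apply Rmin_l | apply Rmin_r]]. }
  destruct (MVT_open f f' x (x + h)) as (q & hq & hmv); [lra | | |].
  - intros y hy. apply hf; lra.
  - intros y hy. apply (ex_derive_continuous f). exists (f' y). apply hf; lra.
  - specialize (he (q - x) ltac:(lra) ltac:(rewrite Rabs_pos_eq; lra)).
    replace (x + (q - x)) with q in he by ring. rewrite h0 in he.
    apply Rabs_def2 in he.
    assert (hq2 : 0 < f' q).
    { replace (f' q) with ((f' q - 0) / (q - x) * (q - x)) by (field; lra).
      apply Rmult_lt_0_compat; lra. }
    specialize (hm (x + h) ltac:(lra)).
    assert (0 < f' q * (x + h - x)) by (apply Rmult_lt_0_compat; lra). lra.
Qed.

(** Otherwise f' would be negative just left of b, by continuity, and f would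
    decrease towards b by the mean value theorem. *)
Lemma slope_at_right_end_max (f f' : R -> R) a b :
  a < b -> (forall y, a < y < b -> is_derive f y (f' y)) ->
  (forall y, continuous f y) -> (forall y, continuous f' y) ->
  (forall y, a < y < b -> f y <= f b) -> 0 <= f' b.
Proof.
  intros hab hf cf cf' hm. apply Rnot_lt_le. intros hneg.
  destruct (near_of_continuous f' b (- f' b) (cf' b) ltac:(lra)) as [d hd].
  assert (hdp := cond_pos d).
  set (z := Rmax (b - d / 2) ((a + b) / 2)).
  assert (hz : z < b /\ b - d / 2 <= z /\ a < z).
  { unfold z, Rmax. destruct (Rle_dec _ _); lra. }
  destruct (MVT_open f f' z b) as (q & hq & e); [lra | | intros; apply cf |].
  { intros y hy. apply hf; lra. }
  assert (hq2 : Rabs (f' q - f' b) < - f' b) by (apply hd, ball_R, Rabs_def1; lra).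
  apply Rabs_def2 in hq2. specialize (hm z ltac:(lra)).
  assert (0 < - f' q * (b - z)) by (apply Rmult_lt_0_compat; lra). lra.
Qed.

Lemma exp_weighted_derivative (f : R -> R) k t l :
  is_derive f t l -> is_derive (fun s => exp (k * s) * f s) t (exp (k * t) * (k * f t + l)).
Proof.
  intros hf.
  replace (exp (k * t) * (k * f t + l)) with (k * exp (k * t) * f t + exp (k * t) * l) by ring.
  apply (Derive.is_derive_mult (fun s => exp (k * s)) f); [apply is_derive_exp_linear | exact hf].
Qed.

(** For a parabolic equation solved backward from T, with Dirichlet condition at 0
    and Neumann condition at L. A positive maximum of exp(lam t) d with
    lam + r > 0 contradicts the inequality, which is needed only where the
    gradient vanishes. *)
Lemma backward_max_principle (d dt dx dxx : R -> R -> R) (s r t0 T L : R) :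
  0 <= s -> t0 < T -> 0 < L -> cont2 d -> cont2 dx ->
  (forall t x, t0 <= t < T -> 0 < x < L -> is_derive (fun q => d q x) t (dt t x)) ->
  (forall t x, t0 <= t < T -> 0 < x < L -> is_derive (d t) x (dx t x)) ->
  (forall t x, t0 <= t < T -> 0 < x < L -> is_derive (dx t) x (dxx t x)) ->
  (forall x, 0 <= x <= L -> d T x <= 0) ->
  (forall t, t0 <= t <= T -> d t 0 <= 0) ->
  (forall t, t0 <= t <= T -> dx t L < 0) ->
  (forall t x, t0 <= t < T -> 0 < x < L -> dx t x = 0 ->
     0 <= dt t x + s * dxx t x - r * d t x) ->
  forall t x, t0 <= t <= T -> 0 <= x <= L -> d t x <= 0.
Proof.
  intros hs ht0 hL cd cdx hdt hdx hdxx hT h0 hLx heq.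
  set (lam := Rabs r + 1).
  assert (hlam : 0 < lam + r).
  { unfold lam. generalize (Rle_abs (- r)). rewrite Rabs_Ropp. lra. }
  destruct (max_2d (fun t x => exp (lam * t) * d t x) t0 T 0 L) as (t & x & ht & hx & hm);
    [lra | lra | cont |].
  assert (hmax : d t x <= 0).
  { apply Rnot_lt_le. intros hpos.
    assert (htT : t < T).
    { destruct (Req_dec t T) as [->|]; [|lra]. specialize (hT x hx). lra. }
    assert (hx0 : 0 < x).
    { destruct (Req_dec x 0) as [->|]; [|lra]. specialize (h0 t ht). lra. }
    assert (hsp : forall y, 0 <= y <= L -> d t y <= d t x).
    { intros y hy. apply Rmult_le_reg_l with (exp (lam * t)); [apply exp_pos|].
      now apply hm. }
    destruct (Req_dec x L) as [->|hxL].
    - assert (hh := slope_at_right_end_max (d t) (dx t) 0 L hL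
        (fun y hy => hdx t y (conj (proj1 ht) htT) hy) ltac:(intros; cont) ltac:(intros; cont)
        (fun y hy => hsp y (conj (Rlt_le _ _ (proj1 hy)) (Rlt_le _ _ (proj2 hy))))).
      specialize (hLx t ht). lra.
    - assert (htt : t0 <= t < T) by lra. assert (hxx : 0 < x < L) by lra.
      assert (e1 : dx t x <= 0).
      { apply (derivative_at_right_max (d t) x _ (L - x)); [lra | now apply hdx |].
        intros y hy. apply hsp. lra. }
      assert (e2 : 0 <= dx t x).
      { apply (derivative_at_left_max (d t) x _ x); [lra | now apply hdx |].
        intros y hy. apply hsp. lra. }
      assert (e3 : dx t x = 0) by lra.
      assert (e4 : dxx t x <= 0).
      { apply (second_derivative_at_max (d t) (dx t) x _ (L - x)); auto; try lra.
        - intros y hy. apply hdx; lra.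
        - intros y hy. apply hsp. lra. }
      assert (e5 : exp (lam * t) * (lam * d t x + dt t x) <= 0).
      { apply (derivative_at_right_max (fun q => exp (lam * q) * d q x) t _ (T - t)); [lra | |].
        - apply (exp_weighted_derivative (fun q => d q x)). now apply hdt.
        - intros q hq. apply hm; lra. }
      assert (e6 : lam * d t x + dt t x <= 0).
      { apply Rnot_lt_le. intros hh. generalize (Rmult_lt_0_compat _ _ (exp_pos (lam * t)) hh). lra. }
      specialize (heq t x htt hxx e3).
      assert (0 < (lam + r) * d t x) by now apply Rmult_lt_0_compat.
      assert (0 <= s * - dxx t x) by (apply Rmult_le_pos; lra).
      lra. }
  intros t' x' ht' hx'.
  assert (h1 := hm t' x' ht' hx').
  assert (h2 : exp (lam * t) * d t x <= 0).
  { generalize (Rmult_le_pos _ (- d t x) (Rlt_le _ _ (exp_pos (lam * t)))). lra. }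
  apply Rnot_lt_le. intros hh.
  generalize (Rmult_lt_0_compat _ _ (exp_pos (lam * t')) hh). lra.
Qed.

(** At an interior maximum of u(x) - u(y) - M exp(k (T - t)) (x - y) the slopes at x
    and at y coincide. The terms h cancel, so the Lipschitz constant does
    not depend on h: it comes from the terminal data and from the behaviour at
    x = 0. The weight exp(k (T - t)) compensates the zero-order term. *)
Lemma doubling_lipschitz (u ut v vx : R -> R -> R) (h : R -> R -> R) (s r k M t0 T L : R) :
  0 <= s -> t0 < T -> 0 < L -> 0 < M -> 0 <= k + r -> cont2 u -> cont2 v ->
  (forall t x, t0 <= t < T -> 0 < x < L -> is_derive (fun q => u q x) t (ut t x)) ->
  (forall t x, t0 <= t < T -> 0 < x < L -> is_derive (u t) x (v t x)) ->
  (forall t x, t0 <= t < T -> 0 < x < L -> is_derive (v t) x (vx t x)) ->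
  (forall t x, t0 <= t < T -> 0 < x < L ->
     ut t x + s * vx t x - r * u t x + h t (v t x) = 0) ->
  (forall x y, 0 <= y <= x -> x <= L -> u T x - u T y <= M * (x - y)) ->
  (forall t x, t0 <= t <= T -> 0 <= x <= L ->
     u t x - u t 0 <= M * exp (k * (T - t)) * x) ->
  (forall t, t0 <= t <= T -> v t L <= 0) ->
  forall t x y, t0 <= t <= T -> 0 <= y <= x -> x <= L ->
    u t x - u t y <= M * exp (k * (T - t)) * (x - y).
Proof.
  intros hs ht0 hL hM hk cu cv hut hv hvx heq hT h0 hvL.
  set (E := fun t => exp (k * (T - t))).
  assert (cE : forall t, continuous E t) by (intros t; unfold E; cont).
  assert (hE : forall t, 0 < E t) by (intros; apply exp_pos).
  assert (dE : forall t, is_derive E t (- k * E t)) by (intros; apply is_derive_exp_backward).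
  set (lam := Rabs r + 1).
  assert (hlam : 0 < lam + r).
  { unfold lam. generalize (Rle_abs (- r)). rewrite Rabs_Ropp. lra. }
  set (d := fun t x y => u t x - u t y - M * E t * (x - y)).
  destruct (max_3d (fun t x y => exp (lam * t) * d t x (Rmin x y)) t0 T 0 L)
    as (t & x & y' & ht & hx & hy' & hm); [lra | lra | |].
  { intros p. unfold d.
    assert (c1 : continuous (fun p : R * R * R => fst (fst p)) p).
    { apply (continuous_comp fst fst); [destruct p; apply continuous_fst
       | destruct (fst p); apply continuous_fst]. }
    assert (c2 : continuous (fun p : R * R * R => snd (fst p)) p).
    { apply (continuous_comp fst snd); [destruct p; apply continuous_fst
       | destruct (fst p); apply continuous_snd]. }
    assert (c3 : continuous (fun p : R * R * R => snd p) p) by (destruct p; apply continuous_snd).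
    assert (c4 : continuous (fun p : R * R * R => Rmin (snd (fst p)) (snd p)) p)
      by now apply cont_Rmin.
    apply cont_mult; [apply cont_comp; [cont | exact cont_exp]|].
    apply cont_minus.
    - apply cont_minus; apply cont2_comp; auto.
    - apply cont_mult; [|now apply cont_minus].
      apply cont_mult; [cont|]. now apply (cont_comp E). }
  set (y := Rmin x y') in *.
  assert (hy : 0 <= y <= x).
  { unfold y, Rmin. destruct (Rle_dec x y'); lra. }
  assert (hm' : forall q z w, t0 <= q <= T -> 0 <= w <= z -> z <= L ->
     exp (lam * q) * d q z w <= exp (lam * t) * d t x y).
  { intros q z w hq hw hz. rewrite <- (Rmin_right z w) by lra. apply hm; lra. }
  clearbody y. clear hm hy' y'.
  assert (hmax : d t x y <= 0).
  { apply Rnot_lt_le. intros hpos.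
    assert (htT : t < T).
    { destruct (Req_dec t T) as [->|]; [|lra]. exfalso.
      assert (i := hT x y hy ltac:(lra)). unfold d, E in hpos.
      rewrite Rminus_diag, Rmult_0_r, exp_0 in hpos. lra. }
    assert (hy0 : 0 < y).
    { destruct (Req_dec y 0) as [->|]; [|lra]. exfalso.
      assert (i := h0 t x ht hx). fold (E t) in i. unfold d in hpos. lra. }
    assert (hyx : y < x).
    { destruct (Req_dec y x) as [->|]; [|lra]. exfalso. unfold d in hpos. lra. }
    assert (hsp : forall z w, 0 <= w <= z -> z <= L -> d t z w <= d t x y).
    { intros z w hw hz. apply Rmult_le_reg_l with (exp (lam * t)); [apply exp_pos|].
      now apply hm'. }
    assert (htt : t0 <= t < T) by lra.
    assert (dlin : forall q : R, is_derive (fun z => M * E t * z) q (M * E t))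
      by (intros; apply is_derive_linear).
    assert (hME : 0 < M * E t) by (apply Rmult_lt_0_compat; auto).
    assert (dX : forall z, 0 < z < L -> is_derive (fun z => u t z - M * E t * z) z (v t z - M * E t)).
    { intros z hz. apply (is_derive_minus (u t) (fun z => M * E t * z)); auto. }
    destruct (Req_dec x L) as [->|hxL].
    { assert (hh := slope_at_right_end_max (fun z => u t z - M * E t * z)
        (fun z => v t z - M * E t) y L hyx).
      specialize (hvL t ht).
      assert (0 <= v t L - M * E t); [|lra].
      apply hh; [|intros; cont|intros; cont|].
      - intros z hz. apply dX; lra.
      - intros z hz. assert (i := hsp z y ltac:(lra) ltac:(lra)). unfold d in i. lra. }
    assert (hxx : 0 < x < L) by lra. assert (hyy : 0 < y < L) by lra.
    assert (mx : forall z, y < z < L -> u t z - M * E t * z <= u t x - M * E t * x).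
    { intros z hz. assert (i := hsp z y ltac:(lra) ltac:(lra)). unfold d in i. lra. }
    assert (my : forall w, 0 < w < x -> M * E t * w - u t w <= M * E t * y - u t y).
    { intros w hw. assert (i := hsp x w ltac:(lra) ltac:(lra)). unfold d in i. lra. }
    assert (dY : forall z, 0 < z < L -> is_derive (fun z => M * E t * z - u t z) z (M * E t - v t z)).
    { intros z hz. apply (is_derive_minus (fun z => M * E t * z) (u t)); auto. }
    assert (a1 : v t x - M * E t <= 0).
    { apply (derivative_at_right_max (fun z => u t z - M * E t * z) x _ (L - x)); auto; try lra.
      intros z hz; apply mx; lra. }
    assert (a2 : 0 <= v t x - M * E t).
    { apply (derivative_at_left_max (fun z => u t z - M * E t * z) x _ (x - y)); auto; try lra.
      intros z hz; apply mx; lra. }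
    assert (a3 : vx t x <= 0).
    { apply (second_derivative_at_max (fun z => u t z - M * E t * z) (fun z => v t z - M * E t)
               x _ (L - x)); try lra.
      - intros z hz; apply dX; lra.
      - replace (vx t x) with (vx t x - 0) by ring.
        apply (is_derive_minus (v t) (fun _ => M * E t)); [now apply hvx | apply @is_derive_const].
      - intros z hz; apply mx; lra. }
    assert (b1 : M * E t - v t y <= 0).
    { apply (derivative_at_right_max (fun z => M * E t * z - u t z) y _ (x - y)); auto; try lra.
      intros z hz; apply my; lra. }
    assert (b2 : 0 <= M * E t - v t y).
    { apply (derivative_at_left_max (fun z => M * E t * z - u t z) y _ y); auto; try lra.
      intros z hz; apply my; lra. }
    assert (b3 : - vx t y <= 0).
    { apply (second_derivative_at_max (fun z => M * E t * z - u t z) (fun z => M * E t - v t z)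
               y _ (x - y)); try lra.
      - intros z hz; apply dY; lra.
      - replace (- vx t y) with (0 - vx t y) by ring.
        apply (is_derive_minus (fun _ => M * E t) (v t)); [apply @is_derive_const | now apply hvx].
      - intros z hz; apply my; lra. }
    assert (e5 : exp (lam * t) * (lam * d t x y + (ut t x - ut t y - M * (- k * E t) * (x - y))) <= 0).
    { apply (derivative_at_right_max (fun q => exp (lam * q) * d q x y) t _ (T - t)); [lra | |].
      - apply (exp_weighted_derivative (fun q => d q x y)). unfold d.
        apply (is_derive_minus (fun q => u q x - u q y) (fun q => M * E q * (x - y))).
        + apply (is_derive_minus (fun q => u q x) (fun q => u q y)); auto.
        + apply (is_derive_ext (fun q => (M * (x - y)) * E q)).
          * intros q. eqR. ring.
          * replace (M * (- k * E t) * (x - y)) with ((M * (x - y)) * (- k * E t)) by ring.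
            apply (is_derive_scal E), dE.
      - intros q hq. apply hm'; lra. }
    assert (e6 : lam * d t x y + (ut t x - ut t y - M * (- k * E t) * (x - y)) <= 0).
    { apply Rnot_lt_le. intros hh. generalize (Rmult_lt_0_compat _ _ (exp_pos (lam * t)) hh). lra. }
    assert (q1 := heq t x htt hxx). assert (q2 := heq t y htt hyy).
    (* equal slopes: the Hamiltonian drops out of the difference of the equations *)
    replace (v t y) with (v t x) in q2 by lra.
    assert (0 < (lam + r) * d t x y) by now apply Rmult_lt_0_compat.
    assert (0 <= s * (vx t y - vx t x)) by (apply Rmult_le_pos; lra).
    assert (0 <= (k + r) * (M * E t * (x - y))).
    { apply Rmult_le_pos; auto. apply Rmult_le_pos; lra. }
    unfold d in *. lra. }
  intros q z w hq hw hz. fold (E q).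
  assert (h1 := hm' q z w hq hw hz).
  assert (h2 : exp (lam * t) * d t x y <= 0).
  { generalize (Rmult_le_pos _ (- d t x y) (Rlt_le _ _ (exp_pos (lam * t)))). lra. }
  assert (d q z w <= 0); [|unfold d in *; lra].
  apply Rnot_lt_le. intros hh.
  generalize (Rmult_lt_0_compat _ _ (exp_pos (lam * q)) hh). lra.
Qed.

Lemma ln_ge_1_minus_inv y : 0 < y -> 1 - / y <= ln y.
Proof.
  intros hy. assert (h := exp_ineq1_le (- ln y)).
  rewrite exp_Ropp, exp_ln in h by auto. lra.
Qed.

Lemma ln_le_minus_1 y : 0 < y -> ln y <= y - 1.
Proof.
  intros hy. assert (h := exp_ineq1_le (ln y)). rewrite exp_ln in h by auto. lra.
Qed.

(** phi = k ln (1 + B x) has phi' = k B / (1 + B x). Where phi is below 2, x is so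
    small that phi' is at least 2; so phi (through the zero-order term) or phi'
    (through the concavity) absorbs a bounded source everywhere. *)
Lemma log_barrier_elliptic k B x :
  0 < k -> 0 <= x -> 2 * exp (2 / k) <= k * B ->
  2 <= k * ln (1 + B * x) + (k * B / (1 + B * x)) ^ 2 / 2.
Proof.
  intros hk hx hB.
  assert (hB0 : 0 < B).
  { apply Rmult_lt_reg_l with k; auto. generalize (exp_pos (2 / k)). lra. }
  assert (hy : 1 <= 1 + B * x) by (generalize (Rmult_le_pos B x); lra).
  destruct (Rle_lt_dec (2 / k) (ln (1 + B * x))) as [h|h].
  - assert (h1 : 2 <= k * ln (1 + B * x)).
    { replace 2 with (k * (2 / k)) by (field; lra). apply Rmult_le_compat_l; lra. }
    generalize (pow2_ge_0 (k * B / (1 + B * x))). lra.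
  - assert (h1 : 1 + B * x < exp (2 / k)).
    { rewrite <- (exp_ln (1 + B * x)) by lra. now apply exp_increasing. }
    assert (h2 : 2 <= k * B / (1 + B * x)).
    { apply Rmult_le_reg_r with (1 + B * x); [lra|]. unfold Rdiv.
      rewrite Rmult_assoc, Rinv_l by lra. lra. }
    assert (h3 : 0 <= ln (1 + B * x)) by (rewrite <- ln_1; apply ln_le; lra).
    assert (h4 : 0 <= k * ln (1 + B * x)) by (apply Rmult_le_pos; lra).
    nra.
Qed.

(** As above: either the logarithm already exceeds its target at L, or x is so
    small that ln y >= 1 - 1 / y gives slope M0. *)
Lemma log_barrier_above_line k B M0 L x :
  0 < k -> 0 <= M0 -> 0 < B -> 0 <= x <= L -> M0 * exp (M0 * L / k) <= k * B ->
  M0 * x <= k * ln (1 + B * x).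
Proof.
  intros hk hM hB0 hx hB.
  assert (hy : 1 <= 1 + B * x) by (generalize (Rmult_le_pos B x); lra).
  destruct (Rle_lt_dec (M0 * L / k) (ln (1 + B * x))) as [h|h].
  - apply Rle_trans with (M0 * L); [apply Rmult_le_compat_l; lra|].
    replace (M0 * L) with (k * (M0 * L / k)) by (field; lra). apply Rmult_le_compat_l; lra.
  - assert (h1 : 1 + B * x < exp (M0 * L / k)).
    { rewrite <- (exp_ln (1 + B * x)) by lra. now apply exp_increasing. }
    assert (h2 := ln_ge_1_minus_inv (1 + B * x) ltac:(lra)).
    apply Rle_trans with (k * (1 - / (1 + B * x))); [|apply Rmult_le_compat_l; lra].
    replace (k * (1 - / (1 + B * x))) with (k * B / (1 + B * x) * x) by (field; lra).
    apply Rmult_le_compat_r; [lra|].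
    apply Rmult_le_reg_r with (1 + B * x); [lra|]. unfold Rdiv.
    rewrite Rmult_assoc, Rinv_l by lra.
    apply Rle_trans with (M0 * exp (M0 * L / k)); [apply Rmult_le_compat_l; lra | lra].
Qed.

Lemma slope_le_lipschitz_constant (f f' : R -> R) N L :
  0 < L -> (forall y, 0 < y < L -> is_derive f y (f' y)) ->
  (forall y, continuous f' y) ->
  (forall z y, 0 <= y <= z -> z <= L -> Rabs (f z - f y) <= N * (z - y)) ->
  forall x, 0 <= x <= L -> Rabs (f' x) <= N.
Proof.
  intros hL hf cf hN x hx.
  assert (inner : forall y, 0 < y < L -> Rabs (f' y) <= N).
  { intros y hy.
    assert (dlin : is_derive (fun z => N * z) y N) by apply is_derive_linear.
    assert (i1 : f' y - N <= 0).
    { apply (derivative_at_right_max (fun z => f z - N * z) y _ (L - y)); [lra | |].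
      - apply (is_derive_minus f (fun z => N * z)); [now apply hf | exact dlin].
      - intros z hz. assert (i := hN z y ltac:(lra) ltac:(lra)).
        apply Rabs_le_between in i. lra. }
    assert (i2 : - f' y - N <= 0).
    { apply (derivative_at_right_max (fun z => - f z - N * z) y _ (L - y)); [lra | |].
      - apply (is_derive_minus (fun z => - f z) (fun z => N * z)); [|exact dlin].
        now apply (is_derive_opp f), hf.
      - intros z hz. assert (i := hN z y ltac:(lra) ltac:(lra)).
        apply Rabs_le_between in i. lra. }
    apply Rabs_le; lra. }
  apply Rnot_lt_le. intros hbig.
  destruct (near_of_continuous (fun y => Rabs (f' y)) x (Rabs (f' x) - N) ltac:(cont) ltac:(lra))
    as [d hd].
  assert (hdp := cond_pos d).
  assert (hy : exists y, 0 < y < L /\ Rabs (y - x) < d).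
  { destruct (Rle_lt_dec x (L / 2)).
    - exists (Rmin (x + d / 2) (3 * L / 4)). unfold Rmin. destruct (Rle_dec _ _).
      + split; [lra | rewrite Rabs_pos_eq; lra].
      + split; [lra | rewrite Rabs_pos_eq; lra].
    - exists (Rmax (x - d / 2) (L / 4)). unfold Rmax. destruct (Rle_dec _ _).
      + split; [lra | apply Rabs_def1; lra].
      + split; [lra | apply Rabs_def1; lra]. }
  destruct hy as (y & hy & hyx).
  assert (i := hd y (proj2 (ball_R x d y) hyx)). simpl in i. apply Rabs_def2 in i.
  specialize (inner y hy). lra.
Qed.

(** k is chosen so that sigma^2 phi'' / 2 = - E phi'^2 for the barrier
    phi = k ln (1 + B x), which dominates the quadratic Hamiltonian at all times;
    the sum in parentheses is k B, the slope of phi at 0, large enough for the two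
    lemmas on the barrier; the last factor E accounts for the growth backward in time. *)
Definition slope_bound (T L sigma r M0 : R) : R :=
  let E := exp ((Rabs r + 1) * T) in
  let k := 1 / 2 * sigma ^ 2 / E in
  (2 * exp (2 / k) + M0 * exp (M0 * L / k)) * E.

Lemma slope_bound_ge T L sigma r M0 :
  0 < T -> 0 < L -> 0 < sigma -> 0 <= M0 -> M0 <= slope_bound T L sigma r M0.
Proof.
  intros hT hL hsigma hM0. unfold slope_bound.
  set (κ := Rabs r + 1). set (k := 1 / 2 * sigma ^ 2 / exp (κ * T)).
  assert (hs2 : 0 < sigma ^ 2) by (apply pow_lt; auto).
  assert (hk0 : 0 < k) by (unfold k; apply Rdiv_lt_0_compat; [lra | apply exp_pos]).
  assert (h1 : 1 <= exp (M0 * L / k)).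
  { rewrite <- exp_0. apply exp_monotone. apply Rmult_le_pos; [apply Rmult_le_pos; lra|].
    apply Rlt_le, Rinv_0_lt_compat; auto. }
  assert (h2 : 1 <= exp (κ * T)).
  { rewrite <- exp_0. apply exp_monotone. apply Rmult_le_pos; [|lra].
    unfold κ. generalize (Rabs_pos r). lra. }
  assert (M0 * 1 <= M0 * exp (M0 * L / k)) by (apply Rmult_le_compat_l; lra).
  generalize (exp_pos (2 / k)); intros.
  apply Rle_trans with (M0 * 1); [lra|].
  apply Rmult_le_compat; lra.
Qed.

(** * Regular form of a solution and the aggregate price *)

(** The common part a(eta) + c(eta) pbar of H and G. *)
Definition price (eps L : R) (v m : R -> R -> R) (t : R) : R :=
  a eps (eta L m t) + c eps (eta L m t) * pbar eps L v m t.

Definition flux (sigma p v m mx : R) : R :=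
  1 / 2 * sigma ^ 2 * mx + 1 / 2 * (p - v) * m.

(** A classical solution whose functions are extended continuously to the whole
    plane (so that integrals and maxima need no side conditions), with v = u_x
    and mx = m_x. The second equation is kept as the statement that the flux is
    differentiable in x with derivative m_t; m_xx then never occurs alone. *)
Record regular_solution (T L sigma r eps : R) (uT m0 : R -> R)
    (u ut v vx m mt mx : R -> R -> R) : Prop := {
  rs_u : cont2 u; rs_v : cont2 v; rs_m : cont2 m; rs_mx : cont2 mx;
  rs_ut : forall t x, 0 < t < T -> 0 < x < L ->
    continuous (fun p : R * R => ut (fst p) (snd p)) (t, x);
  rs_mt : forall t x, 0 < t < T -> 0 < x < L ->
    continuous (fun p : R * R => mt (fst p) (snd p)) (t, x);
  rs_u_x : forall t x, 0 <= t <= T -> 0 < x < L -> is_derive (u t) x (v t x);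
  rs_m_x : forall t x, 0 <= t <= T -> 0 < x < L -> is_derive (m t) x (mx t x);
  rs_v_x : forall t x, 0 < t < T -> 0 < x < L -> is_derive (v t) x (vx t x);
  rs_u_t : forall t x, 0 < t < T -> 0 < x < L ->
    is_derive (fun s => u s x) t (ut t x);
  rs_m_t : forall t x, 0 < t < T -> 0 < x < L ->
    is_derive (fun s => m s x) t (mt t x);
  rs_hjb : forall t x, 0 < t < T -> 0 < x < L ->
    ut t x + 1 / 2 * sigma ^ 2 * vx t x - r * u t x
    + 1 / 4 * (price eps L v m t - v t x) ^ 2 = 0;
  rs_fp : forall t x, 0 < t < T -> 0 < x < L ->
    is_derive (fun y => flux sigma (price eps L v m t) (v t y) (m t y) (mx t y)) x
      (mt t x);
  rs_m0 : forall x, 0 <= x <= L -> m 0 x = m0 x;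
  rs_uT : forall x, 0 <= x <= L -> u T x = uT x;
  rs_u0 : forall t, 0 <= t <= T -> u t 0 = 0;
  rs_ml : forall t, 0 <= t <= T -> m t 0 = 0;
  rs_vL : forall t, 0 <= t <= T -> v t L = 0;
  rs_fL : forall t, 0 <= t <= T ->
    flux sigma (price eps L v m t) (v t L) (m t L) (mx t L) = 0 }.

Arguments rs_u {T L sigma r eps uT m0 u ut v vx m mt mx} _.
Arguments rs_v {T L sigma r eps uT m0 u ut v vx m mt mx} _.
Arguments rs_m {T L sigma r eps uT m0 u ut v vx m mt mx} _.
Arguments rs_mx {T L sigma r eps uT m0 u ut v vx m mt mx} _.
Arguments rs_ut {T L sigma r eps uT m0 u ut v vx m mt mx} _.
Arguments rs_mt {T L sigma r eps uT m0 u ut v vx m mt mx} _.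
Arguments rs_u_x {T L sigma r eps uT m0 u ut v vx m mt mx} _.
Arguments rs_m_x {T L sigma r eps uT m0 u ut v vx m mt mx} _.
Arguments rs_v_x {T L sigma r eps uT m0 u ut v vx m mt mx} _.
Arguments rs_u_t {T L sigma r eps uT m0 u ut v vx m mt mx} _.
Arguments rs_m_t {T L sigma r eps uT m0 u ut v vx m mt mx} _.
Arguments rs_hjb {T L sigma r eps uT m0 u ut v vx m mt mx} _.
Arguments rs_fp {T L sigma r eps uT m0 u ut v vx m mt mx} _.
Arguments rs_m0 {T L sigma r eps uT m0 u ut v vx m mt mx} _.
Arguments rs_uT {T L sigma r eps uT m0 u ut v vx m mt mx} _.
Arguments rs_u0 {T L sigma r eps uT m0 u ut v vx m mt mx} _.
Arguments rs_ml {T L sigma r eps uT m0 u ut v vx m mt mx} _.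
Arguments rs_vL {T L sigma r eps uT m0 u ut v vx m mt mx} _.
Arguments rs_fL {T L sigma r eps uT m0 u ut v vx m mt mx} _.

Definition clamp (b t : R) : R := Rmax 0 (Rmin b t).

Lemma clamp_id b t : 0 <= t <= b -> clamp b t = t.
Proof. intros h; unfold clamp. rewrite Rmin_right, Rmax_right; lra. Qed.

Lemma clamp_range b t : 0 <= b -> 0 <= clamp b t <= b.
Proof.
  intros h; unfold clamp, Rmax, Rmin.
  destruct (Rle_dec b t), (Rle_dec _ _); lra.
Qed.

Lemma cont_clamp b t : continuous (clamp b) t.
Proof. unfold clamp; cont. Qed.

(** Composition with the projection onto the rectangle. *)
Definition extend (T L : R) (f : R -> R -> R) (t x : R) : R :=
  f (clamp T t) (clamp L x).

Lemma extend_id T L f t x :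
  0 <= t <= T -> 0 <= x <= L -> extend T L f t x = f t x.
Proof. intros; unfold extend; now rewrite !clamp_id. Qed.

Lemma cont2_extend T L (f : R -> R -> R) :
  0 <= T -> 0 <= L ->
  continuous_on (rect T L) (fun p : R * R => f (fst p) (snd p)) ->
  cont2 (extend T L f).
Proof.
  intros hT hL hf t x.
  unfold continuous. simpl.
  apply (filterlim_comp _ _ _ (fun p : R * R => (clamp T (fst p), clamp L (snd p)))
    (fun p : R * R => f (fst p) (snd p)) _
    (within (rect T L) (locally (clamp T t, clamp L x)))).
  2:{ apply (hf (clamp T t, clamp L x)). split; simpl; now apply clamp_range. }
  intros P [e hP].
  destruct (proj1 (filterlim_locally (F := locally t) (clamp T) (clamp T t))
              (cont_clamp T t) e) as [d1 h1].
  destruct (proj1 (filterlim_locally (F := locally x) (clamp L) (clamp L x))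
              (cont_clamp L x) e) as [d2 h2].
  exists (mkposreal _ (Rmin_stable_in_posreal d1 d2)).
  intros [s y] [hs hy]; simpl in hs, hy |- *. apply hP.
  - split; simpl; [apply h1 | apply h2].
    + apply ball_le with (2 := hs); apply Rmin_l.
    + apply ball_le with (2 := hy); apply Rmin_r.
  - split; simpl; now apply clamp_range.
Qed.

Lemma is_derive_on_interior L (f f' : R -> R) x :
  derivative_on L f f' -> 0 < x < L -> is_derive f x (f' x).
Proof.
  intros h hx. apply is_derive_Reals.
  intros e he. destruct (h x (conj (Rlt_le _ _ (proj1 hx)) (Rlt_le _ _ (proj2 hx))) e he)
    as (al & hal & H).
  assert (hd : 0 < Rmin al (Rmin x (L - x))) by (repeat apply Rmin_glb_lt; lra).
  exists (mkposreal _ hd). simpl. intros k hk hkd.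
  assert (k1 := Rlt_le_trans _ _ _ hkd (Rmin_l _ _)).
  assert (k2 := Rlt_le_trans _ _ _ hkd (Rmin_r _ _)).
  assert (k3 := Rlt_le_trans _ _ _ k2 (Rmin_l _ _)).
  assert (k4 := Rlt_le_trans _ _ _ k2 (Rmin_r _ _)).
  apply Rabs_def2 in k3; apply Rabs_def2 in k4.
  specialize (H (x + k)). simpl in H. unfold Rdist in H.
  replace (x + k - x) with k in H by ring. apply H.
  split; [split; [unfold space; lra | lra] | exact k1].
Qed.

Lemma locally_interior a b x : a < x < b -> locally x (fun y => a < y < b).
Proof.
  intros h. apply (locally_interval _ x a b); simpl; try lra. intros; lra.
Qed.

Lemma continuous_on_interior T L (f : R -> R -> R) t x :
  continuous_on (rect_interior T L) (fun p : R * R => f (fst p) (snd p)) ->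
  0 < t < T -> 0 < x < L ->
  continuous (fun p : R * R => f (fst p) (snd p)) (t, x).
Proof.
  intros h ht hx P hP.
  specialize (h (t, x) (conj ht hx) P hP).
  destruct h as [e he].
  destruct (locally_interior 0 T t ht) as [d1 h1].
  destruct (locally_interior 0 L x hx) as [d2 h2].
  exists (mkposreal _ (Rmin_stable_in_posreal e (mkposreal _ (Rmin_stable_in_posreal d1 d2)))).
  intros [s y] [hs hy]; simpl in hs, hy. apply he.
  - split; simpl; [apply ball_le with (2 := hs) | apply ball_le with (2 := hy)]; apply Rmin_l.
  - split; simpl.
    + apply h1. apply ball_le with (2 := hs). simpl.
      eapply Rle_trans; [apply Rmin_r | apply Rmin_l].
    + apply h2. apply ball_le with (2 := hy).
      eapply Rle_trans; [apply Rmin_r | apply Rmin_r].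
Qed.

Lemma price_extend eps T L v m t :
  0 <= L -> 0 <= t <= T ->
  price eps L (extend T L v) (extend T L m) t = price eps L v m t.
Proof.
  intros hL ht. unfold price, pbar, eta.
  assert (e1 : RInt (fun x => extend T L m t x) 0 L = RInt (fun x => m t x) 0 L).
  { apply RInt_ext. intros x hx. rewrite Rmin_left, Rmax_right in hx by lra.
    apply extend_id; lra. }
  assert (e2 : RInt (fun x => extend T L v t x * extend T L m t x) 0 L
             = RInt (fun x => v t x * m t x) 0 L).
  { apply RInt_ext. intros x hx. rewrite Rmin_left, Rmax_right in hx by lra.
    rewrite !extend_id; lra. }
  now rewrite e1, e2.
Qed.

Lemma is_derive_extend_x T L (f : R -> R -> R) t x l :
  0 <= t <= T -> 0 < x < L -> is_derive (f t) x l -> is_derive (extend T L f t) x l.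
Proof.
  intros ht hx. apply is_derive_ext_loc.
  generalize (locally_interior 0 L x hx). apply filter_imp.
  intros y hy. symmetry; apply extend_id; lra.
Qed.

Lemma is_derive_extend_t T L (f : R -> R -> R) t x l :
  0 < t < T -> 0 < x < L -> is_derive (fun s => f s x) t l ->
  is_derive (fun s => extend T L f s x) t l.
Proof.
  intros ht hx. apply is_derive_ext_loc.
  generalize (locally_interior 0 T t ht). apply filter_imp.
  intros y hy. symmetry; apply extend_id; lra.
Qed.

Lemma classical_solution_regular T L sigma r eps uT m0 u m :
  0 < T -> 0 < L ->
  classical_solution T L sigma r eps uT m0 u m ->
  exists U ut v vx M mt mx,
    regular_solution T L sigma r eps uT m0 U ut v vx M mt mx /\
    forall t x, 0 <= t <= T -> 0 <= x <= L -> u t x = U t x /\ m t x = M t x.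
Proof.
  intros hT hL (u_t & u_x & u_xx & m_t & m_x & m_xx & Pu & Pm & E1 & E2 & E3 & E4 & E5).
  destruct Pu as (cu & cux & cut & cuxx & du & ddu).
  destruct Pm as (cm & cmx & cmt & cmxx & dm & ddm).
  exists (extend T L u), u_t, (extend T L u_x), u_xx,
    (extend T L m), m_t, (extend T L m_x).
  split.
  2:{ intros t x ht hx. rewrite !extend_id; auto. }
  assert (eP : forall t, 0 <= t <= T ->
     price eps L (extend T L u_x) (extend T L m) t = price eps L u_x m t)
    by (intros; apply price_extend; lra).
  constructor.
  - apply cont2_extend; auto; lra.
  - apply cont2_extend; auto; lra.
  - apply cont2_extend; auto; lra.
  - apply cont2_extend; auto; lra.
  - intros; now apply continuous_on_interior with T L.
  - intros; now apply continuous_on_interior with T L.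
  - intros t x ht hx. rewrite extend_id by lra. apply is_derive_extend_x; auto.
    now apply is_derive_on_interior with L; [apply du|].
  - intros t x ht hx. rewrite extend_id by lra. apply is_derive_extend_x; auto.
    now apply is_derive_on_interior with L; [apply dm|].
  - intros t x ht hx. apply is_derive_extend_x; [lra | auto |]. now apply ddu.
  - intros t x ht hx. apply is_derive_extend_t; auto. now apply ddu.
  - intros t x ht hx. apply is_derive_extend_t; auto. now apply ddm.
  - intros t x ht hx. rewrite eP, !extend_id by lra. rewrite <- (E1 t x ht hx).
    unfold H, price. ring.
  - intros t x ht hx. rewrite eP by lra.
    set (p := price eps L u_x m t).
    apply is_derive_ext_loc with
      (fun y => flux sigma p (u_x t y) (m t y) (m_x t y)).
    { generalize (locally_interior 0 L x hx). apply filter_imp.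
      intros y hy. rewrite !extend_id; lra. }
    assert (d1 := proj2 (ddu t x ht hx)). assert (d2 := proj2 (ddm t x ht hx)).
    assert (d3 := is_derive_on_interior L (m t) (m_x t) x (dm t ltac:(lra)) hx).
    set (G' := 1 / 2 * (0 - u_xx t x) * m t x + 1 / 2 * (p - u_x t x) * m_x t x).
    assert (dG : is_derive (fun y => G eps L u_x m t y * m t y) x G').
    { apply (is_derive_ext (fun y => 1 / 2 * (p - u_x t y) * m t y)).
      - intros y. reflexivity.
      - apply (Derive.is_derive_mult (fun y => 1 / 2 * (p - u_x t y)) (m t)); [|exact d3].
        apply (is_derive_scal (fun y => p - u_x t y)).
        apply (is_derive_minus (fun _ => p) (u_x t)); [apply @is_derive_const | exact d1]. }
    assert (eD : Derive (fun y => G eps L u_x m t y * m t y) x = G')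
      by exact (is_derive_unique _ _ _ dG).
    assert (E := E2 t x ht hx). rewrite eD in E.
    replace (m_t t x) with (1 / 2 * sigma ^ 2 * m_xx t x + G') by lra.
    apply (is_derive_plus (fun y => 1 / 2 * sigma ^ 2 * m_x t y)
             (fun y => 1 / 2 * (p - u_x t y) * m t y)).
    + now apply (is_derive_scal (m_x t)).
    + exact dG.
  - intros x hx. rewrite extend_id by lra. now apply E3.
  - intros x hx. rewrite extend_id by lra. now apply E3.
  - intros t ht. rewrite extend_id by lra. now apply E4.
  - intros t ht. rewrite extend_id by lra. now apply E4.
  - intros t ht. rewrite extend_id by lra. now apply E4.
  - intros t ht. rewrite eP, !extend_id by lra. apply (E5 t ht).
Qed.

Definition cross (L : R) (v m : R -> R -> R) (t : R) : R :=
  RInt (fun x => v t x * m t x) 0 L.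

Lemma price_eq eps L v m t :
  1 + eps * eta L m t <> 0 -> 2 + eps * eta L m t <> 0 -> eta L m t <> 0 ->
  price eps L v m t = (2 + eps * cross L v m t) / (2 + eps * eta L m t).
Proof.
  intros h1 h2 h3. unfold price, pbar, cross, c, a.
  set (I := RInt _ 0 L). set (h := eta L m t) in *.
  assert (e : 2 - (1 - 1 / (1 + eps * h)) = (2 + eps * h) / (1 + eps * h)) by (field; auto).
  rewrite e. field. repeat split; auto.
Qed.

Lemma price_eq_0 eps L v m t : eta L m t = 0 -> price eps L v m t = 1.
Proof. intros h. unfold price, c, a. rewrite h, Rmult_0_r, Rplus_0_r. field. Qed.

(** 2 eps eta >= -1 keeps 1 + eps eta and 2 + eps eta away from 0; where eta = 0,
    pbar drops out and the price is 1. *)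
Lemma price_bound eps L v m t :
  0 <= eps -> -1 <= 2 * (eps * eta L m t) ->
  Rabs (price eps L v m t) <= 2 + eps * Rabs (cross L v m t).
Proof.
  intros he h.
  assert (hI : 0 <= eps * Rabs (cross L v m t))
    by (apply Rmult_le_pos; [auto | apply Rabs_pos]).
  destruct (Req_dec (eta L m t) 0) as [h0|h0].
  - rewrite price_eq_0 by auto. rewrite Rabs_R1. lra.
  - rewrite price_eq by lra. set (q := 2 + eps * eta L m t) in *.
    assert (hq : 1 <= q) by (unfold q; lra).
    unfold Rdiv. rewrite Rabs_mult, (Rabs_inv q), (Rabs_pos_eq q) by lra.
    assert (h1 : Rabs (2 + eps * cross L v m t) <= 2 + eps * Rabs (cross L v m t)).
    { eapply Rle_trans; [apply Rabs_triang|].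
      rewrite Rabs_mult, (Rabs_pos_eq eps), (Rabs_pos_eq 2) by lra. lra. }
    assert (h2 : / q <= 1) by (rewrite <- Rinv_1; apply Rinv_le_contravar; lra).
    assert (h3 : 0 < / q) by (apply Rinv_0_lt_compat; lra).
    apply Rle_trans with ((2 + eps * Rabs (cross L v m t)) * 1); [|lra].
    apply Rmult_le_compat; [apply Rabs_pos | lra | auto | auto].
Qed.

(** * The density: positivity, mass and mean-square bound *)

(** Powers of the negative part are smooth enough as test functions from the cube
    on, where the second derivative is still continuous. *)
Lemma is_derive_neg_part_pow n s :
  is_derive (fun y => Rmin y 0 ^ S (S n)) s (INR (S (S n)) * Rmin s 0 ^ S n).
Proof.
  destruct (Rtotal_order s 0) as [h|[->|h]].
  - apply is_derive_ext_loc with (fun y => y ^ S (S n)).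
    { generalize (locally_interior (s - 1) 0 s ltac:(lra)). apply filter_imp.
      intros y hy. rewrite Rmin_left by lra. reflexivity. }
    rewrite Rmin_left by lra.
    replace (INR (S (S n)) * s ^ S n) with (INR (S (S n)) * 1 * s ^ pred (S (S n)))
      by (simpl pred; ring).
    apply is_derive_pow, (is_derive_id (K := R_AbsRing)).
  - rewrite Rmin_left by lra. replace (INR (S (S n)) * 0 ^ S n) with 0 by (simpl; ring).
    apply is_derive_Reals. intros e he.
    exists (mkposreal _ (Rmin_stable_in_posreal (mkposreal e he) (mkposreal 1 Rlt_0_1))).
    intros k hk hke. simpl pos in hke.
    assert (k1 := Rlt_le_trans _ _ _ hke (Rmin_l _ _)).
    assert (k2 := Rlt_le_trans _ _ _ hke (Rmin_r _ _)). simpl in k1, k2.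
    rewrite Rplus_0_l, (Rmin_left 0 0) by lra.
    replace ((Rmin k 0 ^ S (S n) - 0 ^ S (S n)) / k - 0) with (Rmin k 0 ^ S (S n) / k)
      by (simpl; field; auto).
    unfold Rmin; destruct (Rle_dec k 0).
    + replace (k ^ S (S n) / k) with (k ^ n * k) by (simpl; field; auto).
      rewrite Rabs_mult, <- RPow_abs.
      apply Rle_lt_trans with (1 * Rabs k); [|lra].
      apply Rmult_le_compat_r; [apply Rabs_pos|].
      rewrite <- (pow1 n). apply pow_incr. split; [apply Rabs_pos | lra].
    + replace (0 ^ S (S n) / k) with 0 by (simpl; field; auto). now rewrite Rabs_R0.
  - apply is_derive_ext_loc with (fun _ : R => 0).
    { generalize (locally_interior 0 (s + 1) s ltac:(lra)). apply filter_imp.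
      intros y hy. rewrite Rmin_right by lra. simpl; eqR; ring. }
    rewrite Rmin_right by lra. replace (INR (S (S n)) * 0 ^ S n) with 0 by (simpl; ring).
    apply @is_derive_const.
Qed.

Section solution.
Context {T L sigma r eps : R} {uT m0 : R -> R} {u ut v vx m mt mx : R -> R -> R}.
Context (hT : 0 < T) (hL : 0 < L) (hsigma : 0 < sigma).
Context (sol : regular_solution T L sigma r eps uT m0 u ut v vx m mt mx).

(** Testing the density equation with Phi'(m): the no-flux condition at L and
    Phi'(0) = 0 at 0 remove the boundary terms, and completing the square bounds
    the drift by Phi''(m) m^2 g^2 / (8 sigma^2), hence by a multiple of Phi(m).
    Used with the cube of the negative part and with the square. *)
Lemma drift_energy (Phi Phi' Phi'' : R -> R) (k g S : R) :
  (forall s, is_derive Phi s (Phi' s)) -> (forall s, is_derive Phi' s (Phi'' s)) ->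
  (forall s, continuous Phi'' s) -> Phi' 0 = 0 ->
  (forall s, 0 <= Phi'' s) -> (forall s, Phi'' s * s ^ 2 <= k * Phi s) ->
  0 < S <= T ->
  (forall t x, 0 < t < S -> 0 <= x <= L -> Rabs (price eps L v m t - v t x) <= g) ->
  forall t, 0 <= t <= S ->
    exp (- (k * g ^ 2 / (8 * sigma ^ 2)) * t) * RInt (fun x => Phi (m t x)) 0 L
    <= RInt (fun x => Phi (m 0 x)) 0 L.
Proof.
  intros d1 d2 c2 z1 p2 hk hS hg t ht.
  destruct sol as [cu cv cm cmx cut cmt hux hmx hvx hut hmt hjb fp im iu bu bm bv bf].
  set (lam := k * g ^ 2 / (8 * sigma ^ 2)).
  set (p := price eps L v m) in *.
  assert (c0 : forall s, continuous Phi s)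
    by (intros s; apply (ex_derive_continuous Phi); eexists; apply d1).
  assert (c1 : forall s, continuous Phi' s)
    by (intros s; apply (ex_derive_continuous Phi'); eexists; apply d2).
  destruct (bounded_2d v 0 T 0 L) as (V & hV0 & hV); [lra | lra | exact cv |].
  set (E := fun t => exp (- lam * t)).
  assert (cE : forall t, continuous E t) by (intros s; unfold E; cont).
  assert (hE : forall t, 0 < E t) by (intros; apply exp_pos).
  assert (dE : forall t, is_derive E t (- lam * E t)).
  { intros s. apply is_derive_exp_linear. }
  assert (H := flux_balance_bounded_price
    (fun t x => E t * Phi (m t x))
    (fun t x => - lam * E t * Phi (m t x) + E t * (mt t x * Phi' (m t x)))
    (fun t x => E t * (Phi' (m t x) * (1 / 2 * sigma ^ 2 * mx t x - 1 / 2 * v t x * m t x)))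
    (fun t x => E t * (Phi' (m t x) * (1 / 2 * m t x)))
    (fun t x => - lam * E t * Phi (m t x)
       - E t * (Phi'' (m t x) * mx t x * (1 / 2 * sigma ^ 2 * mx t x - 1 / 2 * v t x * m t x)))
    (fun t x => - (E t * (Phi'' (m t x) * mx t x * (1 / 2 * m t x))))
    p S 0 L (g + V)).
  specialize (H (proj1 hS) hL).
  assert (goal : RInt (fun x => E t * Phi (m t x)) 0 L <= RInt (fun x => E 0 * Phi (m 0 x)) 0 L).
  { apply H; try lra; clear H; try cont.
    - intros s hs. specialize (hg s 0 hs ltac:(lra)).
      specialize (hV s 0 ltac:(lra) ltac:(lra)).
      apply Rabs_le_between in hg, hV. apply Rabs_le; lra.
    - intros s x hs hx.
      apply (Derive.is_derive_mult E (fun s => Phi (m s x))); [apply dE|].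
      apply (is_derive_comp Phi (fun s => m s x)); [apply d1 | apply hmt; lra].
    - intros s x hs hx.
      apply cont_plus.
      + apply (cont2_comp (fun t x => - lam * E t * Phi (m t x)) fst snd); cont.
      + apply cont_mult; [cont|]. apply cont_mult; [apply cmt; lra | cont].
    - intros s x hs hx.
      apply (is_derive_ext (fun y => E s *
        (Phi' (m s y) * flux sigma (p s) (v s y) (m s y) (mx s y)))).
      { intros y. eqR. unfold flux, p. ring. }
      replace (- lam * E s * Phi (m s x) + E s * (mt s x * Phi' (m s x)) - _)
        with (E s * ((mx s x * Phi'' (m s x)) * flux sigma (p s) (v s x) (m s x) (mx s x)
                     + Phi' (m s x) * mt s x)) by (unfold flux, p; ring).
      apply (is_derive_scal (fun y => Phi' (m s y) * flux sigma (p s) (v s y) (m s y) (mx s y))).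
      apply (Derive.is_derive_mult (fun y => Phi' (m s y))
               (fun y => flux sigma (p s) (v s y) (m s y) (mx s y))).
      + apply (is_derive_comp Phi' (m s)); [apply d2 | apply hmx; lra].
      + apply fp; lra.
    - intros s hs.
      assert (bf' := bf s ltac:(lra)). unfold flux in bf'. fold p in bf'.
      rewrite (bm s) by lra. rewrite z1.
      assert (hint : RInt (fun x => - lam * E s * Phi (m s x)
         - E s * (Phi'' (m s x) * mx s x * (1 / 2 * sigma ^ 2 * mx s x - 1 / 2 * v s x * m s x))
         + p s * - (E s * (Phi'' (m s x) * mx s x * (1 / 2 * m s x)))) 0 L
         <= RInt (fun _ => 0) 0 L).
      { apply RInt_le_cont; [lra | intros y; cont | intros y; cont |].
        intros x hx.
        specialize (hg s x hs ltac:(lra)). specialize (p2 (m s x)). specialize (hk (m s x)).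
        fold p in hg. set (q := p s - v s x) in *.
        set (F2 := Phi'' (m s x)) in *. set (F0 := Phi (m s x)) in *.
        set (M := m s x) in *. set (Mx := mx s x) in *.
        assert (hq : q ^ 2 <= g ^ 2)
          by (rewrite <- (pow2_abs q); apply pow_incr; split;
              [apply Rabs_pos | exact hg]).
        assert (hs2 : 0 < sigma ^ 2) by (apply pow_lt; auto).
        assert (h1 : Mx * (1 / 2 * sigma ^ 2 * Mx + 1 / 2 * q * M) >= - (q ^ 2 * M ^ 2 / (8 * sigma ^ 2))).
        { apply Rle_ge.
          replace (Mx * (1 / 2 * sigma ^ 2 * Mx + 1 / 2 * q * M)) with
            (1 / 2 * (sigma * Mx + q * M / (2 * sigma)) ^ 2 - q ^ 2 * M ^ 2 / (8 * sigma ^ 2))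
            by (field; lra).
          generalize (pow2_ge_0 (sigma * Mx + q * M / (2 * sigma))). lra. }
        assert (h2 : q ^ 2 * M ^ 2 / (8 * sigma ^ 2) <= g ^ 2 * M ^ 2 / (8 * sigma ^ 2)).
        { apply Rmult_le_compat_r.
          - apply Rlt_le, Rinv_0_lt_compat; lra.
          - apply Rmult_le_compat_r; [apply pow2_ge_0 | auto]. }
        assert (h3 : F2 * (Mx * (1 / 2 * sigma ^ 2 * Mx + 1 / 2 * q * M))
                     >= - (lam * F0)).
        { apply Rle_ge. apply Rle_trans with (F2 * - (g ^ 2 * M ^ 2 / (8 * sigma ^ 2))).
          - replace (lam * F0) with (g ^ 2 / (8 * sigma ^ 2) * (k * F0))
              by (unfold lam; field; lra).
            replace (F2 * - (g ^ 2 * M ^ 2 / (8 * sigma ^ 2)))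
              with (- (g ^ 2 / (8 * sigma ^ 2) * (F2 * M ^ 2))) by (field; lra).
            apply Ropp_le_contravar, Rmult_le_compat_l; auto.
            apply Rmult_le_pos; [apply pow2_ge_0 | apply Rlt_le, Rinv_0_lt_compat; lra].
          - apply Rmult_le_compat_l; lra. }
        replace (- lam * E s * F0 - E s * (F2 * Mx * (1 / 2 * sigma ^ 2 * Mx - 1 / 2 * v s x * M))
                 + p s * - (E s * (F2 * Mx * (1 / 2 * M))))
          with (- (E s * (lam * F0 + F2 * (Mx * (1 / 2 * sigma ^ 2 * Mx + 1 / 2 * q * M)))))
          by (unfold q; ring).
        assert (h4 : 0 <= E s * (lam * F0 + F2 * (Mx * (1 / 2 * sigma ^ 2 * Mx + 1 / 2 * q * M))))
          by (apply Rmult_le_pos; [apply Rlt_le, hE | lra]).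
        lra. }
      rewrite RInt_constant in hint.
      set (J := RInt _ 0 L) in *.
      replace (E s * (Phi' (m s L) * (1 / 2 * sigma ^ 2 * mx s L - 1 / 2 * v s L * m s L)) +
        p s * (E s * (Phi' (m s L) * (1 / 2 * m s L))))
        with (E s * Phi' (m s L) * (1 / 2 * sigma ^ 2 * mx s L + 1 / 2 * (p s - v s L) * m s L))
        by ring.
      rewrite bf'. lra. }
  rewrite !RInt_scal_cont in goal by (intros; cont).
  unfold E at 2 in goal. rewrite Rmult_0_r, exp_0 in goal. fold (E t). lra.
Qed.

Lemma cont_eta t : continuous (eta L m) t.
Proof.
  pose proof (rs_m sol) as cm.
  apply (cont2_comp (fun t x => RInt (m t) 0 x) (fun t => t) (fun _ => L)).
  - now apply cont_RInt_param.
  - cont.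
  - cont.
Qed.

Lemma cont_cross t : continuous (cross L v m) t.
Proof.
  pose proof (rs_m sol) as cm.
  pose proof (rs_v sol) as cv.
  apply (cont2_comp (fun t x => RInt (fun y => v t y * m t y) 0 x) (fun t => t) (fun _ => L)).
  - apply (cont_RInt_param (fun t y => v t y * m t y)). cont.
  - cont.
  - cont.
Qed.

Lemma price_bounded_while S :
  0 <= eps -> 0 <= S <= T ->
  (forall t, 0 <= t <= S -> -1 <= 2 * (eps * eta L m t)) ->
  exists P, 0 <= P /\ forall t, 0 <= t <= S -> Rabs (price eps L v m t) <= P.
Proof.
  intros he hS hq.
  destruct (bounded_2d (fun t _ => cross L v m t) 0 T 0 L) as (J & hJ0 & hJ); [lra|lra| |].
  { pose proof cont_cross. cont. }
  exists (2 + eps * J). split.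
  { apply Rplus_le_le_0_compat; [lra | now apply Rmult_le_pos]. }
  intros t ht. eapply Rle_trans; [apply price_bound; auto|].
  apply Rplus_le_compat_l, Rmult_le_compat_l; auto. apply (hJ t 0); lra.
Qed.

(** The price is bounded while 2 eps eta >= -1, so the energy of the negative part
    applies; that part is zero initially. *)
Lemma density_nonneg_while S :
  0 <= eps -> 0 <= S <= T -> (forall x, 0 <= x <= L -> 0 <= m0 x) ->
  (forall t, 0 <= t <= S -> -1 <= 2 * (eps * eta L m t)) ->
  forall t x, 0 <= t <= S -> 0 <= x <= L -> 0 <= m t x.
Proof.
  intros he hS hm0 hq t x ht hx.
  pose proof (rs_m sol) as cm.
  pose proof (rs_v sol) as cv.
  assert (hinit : forall y, 0 <= y <= L -> 0 <= m 0 y).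
  { intros y hy. rewrite (rs_m0 sol) by auto. auto. }
  destruct (Req_dec S 0) as [h0|h0].
  { replace t with 0 by lra. auto. }
  destruct (price_bounded_while S he hS hq) as (P & hP0 & hP).
  destruct (bounded_2d v 0 T 0 L) as (V & hV0 & hV); [lra | lra | exact cv |].
  set (Phi := fun y => - 1 * Rmin y 0 ^ 3).
  assert (hPhi : forall y, 0 <= Phi y).
  { intros y. unfold Phi. assert (h : 0 <= (- Rmin y 0) ^ 3).
    { apply pow_le. generalize (Rmin_r y 0). lra. }
    simpl in h |- *. lra. }
  assert (H := drift_energy Phi (fun y => -1 * (3 * Rmin y 0 ^ 2))
            (fun y => -1 * (3 * (2 * Rmin y 0 ^ 1))) 6 (P + V) S).
  specialize (H ltac:(intros y; apply (is_derive_scal (fun y => Rmin y 0 ^ 3));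
       replace 3 with (INR 3) by (simpl; lra); apply is_derive_neg_part_pow)).
  specialize (H ltac:(intros y; apply (is_derive_scal (fun y => 3 * Rmin y 0 ^ 2));
       apply (is_derive_scal (fun y => Rmin y 0 ^ 2));
       replace 2 with (INR 2) by (simpl; lra); apply is_derive_neg_part_pow)).
  assert (E : exp (- (6 * (P + V) ^ 2 / (8 * sigma ^ 2)) * t)
              * RInt (fun y => Phi (m t y)) 0 L <= RInt (fun y => Phi (m 0 y)) 0 L).
  { apply H; clear H.
    - intros y; cont.
    - rewrite Rmin_left by lra. ring.
    - intros y. generalize (Rmin_r y 0). simpl. lra.
    - intros y. unfold Phi, Rmin. destruct (Rle_dec y 0); simpl; lra.
    - lra.
    - intros s y hs hy. assert (i1 := hP s ltac:(lra)). assert (i2 := hV s y ltac:(lra) hy).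
      unfold Rminus. eapply Rle_trans; [apply Rabs_triang|]. rewrite Rabs_Ropp. lra.
    - exact ht. }
  assert (E0 : RInt (fun y => Phi (m 0 y)) 0 L = 0).
  { apply RInt_eq_0; [lra|]. intros y hy. unfold Phi.
    rewrite Rmin_right by (apply hinit; lra). ring. }
  rewrite E0 in E.
  assert (E1 : RInt (fun y => Phi (m t y)) 0 L <= 0).
  { apply Rnot_lt_le. intros hpos.
    generalize (Rmult_lt_0_compat _ _
       (exp_pos (- (6 * (P + V) ^ 2 / (8 * sigma ^ 2)) * t)) hpos). lra. }
  assert (cPhi : forall y, continuous Phi y) by (intros y; unfold Phi; cont).
  assert (E2 := zero_of_RInt_le_0 (fun y => Phi (m t y)) 0 L hL ltac:(intros y; cont)
           ltac:(intros; apply hPhi) E1 x hx).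
  unfold Phi in E2. apply Rnot_lt_le. intros hneg.
  rewrite Rmin_left in E2 by lra.
  assert (h : 0 < (- m t x) ^ 3) by (apply pow_lt; lra).
  simpl in h, E2. lra.
Qed.

(** Positivity up to some time gives eta >= 0 there, and by uniform continuity
    2 eps eta >= -1 for one more step of fixed length; iterate. *)
Lemma density_nonneg :
  0 <= eps -> (forall x, 0 <= x <= L -> 0 <= m0 x) ->
  forall t x, 0 <= t <= T -> 0 <= x <= L -> 0 <= m t x.
Proof.
  intros he hm0.
  pose proof (rs_m sol) as cm.
  assert (hinit : forall y, 0 <= y <= L -> 0 <= m 0 y).
  { intros y hy. rewrite (rs_m0 sol) by auto. auto. }
  assert (hi : 0 < / (2 * (eps + 1))) by (apply Rinv_0_lt_compat; lra).
  destruct (uniform_2d (fun t _ => eta L m t) 0 T 0 L (/ (2 * (eps + 1)))) as (d & hd & hu);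
    [|exact hi|].
  { pose proof cont_eta. cont. }
  assert (step : forall n t x, 0 <= t <= T -> t <= INR n * (d / 2) -> 0 <= x <= L -> 0 <= m t x).
  { induction n as [|n IH].
    - intros t x ht htn hx. simpl in htn. replace t with 0 by lra. auto.
    - intros t x ht htn hx. rewrite S_INR in htn.
      apply (density_nonneg_while t); [auto | lra | auto | | lra | auto].
      intros s hs.
      assert (pos : forall q, 0 <= q <= T -> q <= INR n * (d / 2) -> 0 <= eta L m q).
      { intros q hq hqn. apply RInt_ge_0_cont; [lra | intros y; cont |].
        intros y hy. apply IH; lra. }
      destruct (Rle_lt_dec s (INR n * (d / 2))) as [hsn|hsn].
      + assert (0 <= eps * eta L m s) by (apply Rmult_le_pos; auto; apply pos; lra). lra.
      + set (q := INR n * (d / 2)) in *.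
        assert (eq : q = INR n * (d / 2)) by reflexivity.
        assert (hq0 : 0 <= q) by (apply Rmult_le_pos; [apply pos_INR | lra]).
        assert (p1 : Rabs (s - q) < d) by (rewrite Rabs_pos_eq; lra).
        assert (hsT : 0 <= s <= T) by lra.
        assert (hqT : 0 <= q <= T) by lra.
        assert (h0L : 0 <= 0 <= L) by lra.
        assert (hq := hu q 0 s 0 hqT h0L hsT h0L).
        assert (p2 : Rabs (0 - 0) < d) by (rewrite Rminus_0_r, Rabs_R0; lra).
        specialize (hq p1 p2). apply Rabs_def2 in hq.
        assert (hp := pos q hqT ltac:(unfold q; lra)).
        assert (hb : - / (2 * (eps + 1)) <= eta L m s) by lra.
        assert (eps * - / (2 * (eps + 1)) <= eps * eta L m s)
          by (apply Rmult_le_compat_l; lra).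
        assert (eps * - / (2 * (eps + 1)) = - / 2 + / (2 * (eps + 1))) by (field; lra).
        lra. }
  intros t x ht hx.
  destruct (archimed_cor1 (d / 2 / (T + 1))) as (n & hn & hn0).
  { apply Rdiv_lt_0_compat; lra. }
  apply (step n); auto.
  assert (hnp : 0 < INR n) by (apply lt_0_INR; auto).
  apply Rle_trans with T; [lra|].
  apply Rle_trans with (T + 1); [lra|].
  apply Rmult_le_reg_r with (/ INR n * / (T + 1)).
  { apply Rmult_lt_0_compat; apply Rinv_0_lt_compat; lra. }
  replace ((T + 1) * (/ INR n * / (T + 1))) with (/ INR n) by (field; lra).
  replace (INR n * (d / 2) * (/ INR n * / (T + 1))) with (d / 2 / (T + 1)) by (field; lra).
  lra.
Qed.

Lemma eta_nonneg :
  0 <= eps -> (forall x, 0 <= x <= L -> 0 <= m0 x) ->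
  forall t, 0 <= t <= T -> 0 <= eta L m t.
Proof.
  intros he hm0 t ht.
  pose proof (rs_m sol) as cm.
  apply RInt_ge_0_cont; [lra | intros y; cont |].
  intros y hy. apply density_nonneg; auto; lra.
Qed.

(** Mass is lost through x = 0 only: there m = 0 <= m nearby, so m_x >= 0 and the flux
    points outward. *)
Lemma eta_le_1 :
  0 <= eps -> (forall x, 0 <= x <= L -> 0 <= m0 x) -> RInt m0 0 L = 1 ->
  forall t, 0 <= t <= T -> eta L m t <= 1.
Proof.
  intros he hm0 hI t ht.
  pose proof (density_nonneg he hm0) as pos.
  pose proof (eta_nonneg he hm0) as epos.
  destruct (price_bounded_while T he ltac:(lra)) as (P & hP0 & hP).
  { intros s hs. assert (0 <= eps * eta L m s) by (apply Rmult_le_pos; auto). lra. }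
  destruct sol as [cu cv cm cmx cut cmt hux hmx hvx hut hmt hjb fp im iu bu bm bv bf].
  replace 1 with (eta L m 0).
  2:{ rewrite <- hI. apply RInt_ext. intros x hx.
      rewrite Rmin_left, Rmax_right in hx by lra. apply im; lra. }
  apply (flux_balance_bounded_price m mt
    (fun t x => 1 / 2 * sigma ^ 2 * mx t x - 1 / 2 * v t x * m t x)
    (fun t x => 1 / 2 * m t x) (fun _ _ => 0) (fun _ _ => 0)
    (price eps L v m) T 0 L P); auto; try cont; try lra.
  - intros s hs. apply hP. lra.
  - intros s x hs hx.
    replace (mt s x - _) with (mt s x) by ring.
    apply (is_derive_ext (fun y => flux sigma (price eps L v m s) (v s y) (m s y) (mx s y))).
    { intros y. eqR. unfold flux. ring. }
    now apply fp.
  - intros s hs.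
    rewrite RInt_eq_0 by (lra || intros; ring).
    assert (b1 := bf s ltac:(lra)). unfold flux in b1.
    assert (b0 := bm s ltac:(lra)).
    assert (hmx0 : 0 <= mx s 0).
    { apply Rnot_lt_le. intros hneg.
      destruct (near_of_continuous (mx s) 0 (- mx s 0) ltac:(cont) ltac:(lra)) as [d hd].
      assert (hdp := cond_pos d).
      set (z := Rmin (d / 2) (L / 2)).
      assert (hz : 0 < z /\ z <= d / 2 /\ z <= L / 2).
      { unfold z. split; [apply Rmin_glb_lt; lra | split; [apply Rmin_l | apply Rmin_r]]. }
      destruct (MVT_open (m s) (mx s) 0 z) as (q & hq & e); [lra | | intros; cont |].
      { intros x hx. apply hmx; lra. }
      assert (hz0 := pos s z ltac:(lra) ltac:(lra)).
      assert (hq2 : Rabs (mx s q - mx s 0) < - mx s 0).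
      { apply hd. unfold ball; simpl; unfold AbsRing_ball, abs, minus, plus, opp; simpl.
        apply Rabs_def1; lra. }
      apply Rabs_def2 in hq2.
      assert (mx s q * (z - 0) < 0) by nra. lra. }
    rewrite b0. assert (0 <= sigma ^ 2) by apply pow2_ge_0.
    assert (0 <= sigma ^ 2 * mx s 0) by (apply Rmult_le_pos; auto). lra.
Qed.

(** The case eta = 0 is consistent with the formula since then m = 0. This makes
    the price continuous in time. *)
Lemma price_formula :
  0 <= eps -> (forall x, 0 <= x <= L -> 0 <= m0 x) ->
  forall t, 0 <= t <= T ->
  price eps L v m t = (2 + eps * cross L v m t) / (2 + eps * eta L m t).
Proof.
  intros he hm0 t ht.
  assert (h0 := eta_nonneg he hm0 t ht).
  pose proof (rs_m sol) as cm.
  assert (0 <= eps * eta L m t) by now apply Rmult_le_pos.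
  destruct (Req_dec (eta L m t) 0) as [e|e].
  2:{ apply price_eq; lra. }
  rewrite price_eq_0 by auto.
  (* without mass the density vanishes, hence so does the integral of v m *)
  assert (z := zero_of_RInt_le_0 (m t) 0 L hL ltac:(intros; cont)
     ltac:(intros; now apply density_nonneg) (Req_le _ _ e)).
  assert (c0 : cross L v m t = 0).
  { apply RInt_eq_0; [lra|]. intros x hx. rewrite z by lra. ring. }
  rewrite e, c0. field.
Qed.

Lemma density_L2_bound g :
  (forall t x, 0 <= t <= T -> 0 <= x <= L -> Rabs (price eps L v m t - v t x) <= g) ->
  forall t, 0 <= t <= T ->
  RInt (fun x => m t x ^ 2) 0 L
  <= exp (2 * g ^ 2 / (8 * sigma ^ 2) * T) * RInt (fun x => m0 x ^ 2) 0 L.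
Proof.
  intros hg t ht.
  pose proof (rs_m sol) as cm.
  set (lam := 2 * g ^ 2 / (8 * sigma ^ 2)).
  assert (hlam : 0 <= lam).
  { apply Rmult_le_pos; [generalize (pow2_ge_0 g); lra|].
    apply Rlt_le, Rinv_0_lt_compat. assert (0 < sigma ^ 2) by (apply pow_lt; auto). lra. }
  assert (E : exp (- lam * t) * RInt (fun y => m t y ^ 2) 0 L <= RInt (fun y => m 0 y ^ 2) 0 L).
  { apply (drift_energy (fun s => s ^ 2) (fun s => 2 * s) (fun _ => 2) 2 g T).
    - intros s. replace (2 * s) with (INR 2 * 1 * s ^ pred 2) by (simpl; ring).
      apply (is_derive_pow (fun y => y)), (is_derive_id (K := R_AbsRing)).
    - intros s. apply is_derive_linear.
    - intros s; cont.
    - ring.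
    - intros; lra.
    - intros; lra.
    - lra.
    - intros s x hs hx. apply hg; lra.
    - lra. }
  rewrite (RInt_ext (fun y => m 0 y ^ 2) (fun x => m0 x ^ 2)) in E.
  2:{ intros x hx. rewrite Rmin_left, Rmax_right in hx by lra.
      now rewrite (rs_m0 sol) by lra. }
  set (I0 := RInt (fun x => m0 x ^ 2) 0 L) in *.
  set (It := RInt (fun y => m t y ^ 2) 0 L) in *.
  assert (hIt : 0 <= It).
  { apply RInt_ge_0_cont; [lra | intros y; cont | intros; apply pow2_ge_0]. }
  apply Rle_trans with (exp (lam * T) * (exp (- lam * t) * It)).
  2:{ apply Rmult_le_compat_l; [apply Rlt_le, exp_pos | auto]. }
  rewrite <- Rmult_assoc, <- exp_plus.
  apply Rle_trans with (1 * It); [lra|]. apply Rmult_le_compat_r; auto.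
  replace (lam * T + - lam * t) with (lam * (T - t)) by ring.
  assert (h1 : 0 <= lam * (T - t)) by (apply Rmult_le_pos; lra).
  generalize (exp_ineq1_le (lam * (T - t))). lra.
Qed.

(** * The value function: uniform slope bound *)

(** The Hamiltonian is a square, so - u is a subsolution. The comparison function
    del exp(k (T - t)) (1 + x) makes the Neumann condition strict. *)
Lemma value_nonneg t0 :
  0 < t0 < T -> (forall x, 0 <= x <= L -> 0 <= uT x) ->
  forall t x, t0 <= t <= T -> 0 <= x <= L -> 0 <= u t x.
Proof.
  intros ht0 huT t x ht hx.
  destruct sol as [cu cv cm cmx cut cmt hux hmx hvx hut hmt hjb fp im iu bu bm bv bf].
  set (k := Rabs r + 1).
  assert (hk : 0 <= k + r) by (unfold k; generalize (Rle_abs (- r)); rewrite Rabs_Ropp; lra).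
  set (E := fun t => exp (k * (T - t))).
  assert (cE : forall t, continuous E t) by (intros q; unfold E; cont).
  assert (dE : forall t, is_derive E t (- k * E t)) by (intros; apply is_derive_exp_backward).
  assert (hE : forall t, 0 < E t) by (intros; apply exp_pos).
  assert (key : forall del, 0 < del -> - u t x - del * (E t * (1 + x)) <= 0).
  { intros del hdel.
    apply (backward_max_principle (fun t x => - u t x - del * (E t * (1 + x)))
      (fun t x => - ut t x - del * (- k * E t * (1 + x)))
      (fun t x => - v t x - del * (E t * 1))
      (fun t x => - vx t x - 0) (1 / 2 * sigma ^ 2) r t0 T L); auto; try lra.
    - generalize (pow2_ge_0 sigma). lra.
    - cont.
    - cont.
    - intros s y hs hy.
      apply (is_derive_minus (fun s => - u s y) (fun s => del * (E s * (1 + y)))).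
      + apply (is_derive_opp (fun s => u s y)). apply hut; lra.
      + apply (is_derive_scal (fun s => E s * (1 + y))).
        apply (is_derive_ext (fun s => (1 + y) * E s)); [intros; eqR; ring|].
        replace (- k * E s * (1 + y)) with ((1 + y) * (- k * E s)) by ring.
        apply (is_derive_scal E), dE.
    - intros s y hs hy.
      apply (is_derive_minus (fun y => - u s y) (fun y => del * (E s * (1 + y)))).
      + apply (is_derive_opp (u s)). apply hux; lra.
      + apply (is_derive_scal (fun y => E s * (1 + y))), (is_derive_scal (fun y => 1 + y)).
        apply (is_derive_ext (fun y => 1 + 1 * y)); [intros; eqR; ring | apply is_derive_affine].
    - intros s y hs hy.
      apply (is_derive_minus (fun y => - v s y) (fun y => del * (E s * 1))).
      + apply (is_derive_opp (v s)). apply hvx; lra.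
      + apply @is_derive_const.
    - intros y hy. rewrite iu by auto. specialize (huT y hy).
      assert (0 <= del * (E T * (1 + y))); [|lra].
      apply Rmult_le_pos; [lra|]. apply Rmult_le_pos; [apply Rlt_le, hE | lra].
    - intros s hs. rewrite bu by lra.
      assert (0 < del * (E s * (1 + 0))); [|lra].
      apply Rmult_lt_0_compat; [lra|]. apply Rmult_lt_0_compat; [apply hE | lra].
    - intros s hs. rewrite bv by lra.
      assert (0 < del * (E s * 1)); [|lra].
      apply Rmult_lt_0_compat; [lra|]. apply Rmult_lt_0_compat; [apply hE | lra].
    - intros s y hs hy _. assert (q := hjb s y ltac:(lra) hy).
      assert (0 <= (k + r) * (del * (E s * (1 + y)))).
      { apply Rmult_le_pos; auto. apply Rmult_le_pos; [lra|].
        apply Rmult_le_pos; [apply Rlt_le, hE | lra]. }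
      generalize (pow2_ge_0 (price eps L v m s - v s y)). lra. }
  apply Rnot_lt_le. intros hneg.
  assert (hW : 0 < E t * (1 + x)) by (apply Rmult_lt_0_compat; [apply hE | lra]).
  assert (hd : 0 < - u t x / 2 / (E t * (1 + x))) by (repeat apply Rdiv_lt_0_compat; lra).
  specialize (key _ hd).
  replace (- u t x / 2 / (E t * (1 + x)) * (E t * (1 + x))) with (- u t x / 2) in key
    by (field; split; [lra | generalize (hE t); lra]).
  lra.
Qed.

(** Comparison with exp(kappa (T - t)) k ln (1 + B x). Its factor in time handles
    the discount rate, and its strict concavity the quadratic Hamiltonian. *)
Lemma value_below_barrier t0 M0 :
  0 < t0 < T -> 0 <= M0 ->
  (forall t, t0 <= t <= T -> Rabs (price eps L v m t) <= 2) ->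
  (forall x, 0 <= x <= L -> uT x <= M0 * x) ->
  let k := 1 / 2 * sigma ^ 2 / exp ((Rabs r + 1) * T) in
  let Q := 2 * exp (2 / k) + M0 * exp (M0 * L / k) in
  forall t x, t0 <= t <= T -> 0 <= x <= L ->
    u t x <= Q * exp ((Rabs r + 1) * (T - t)) * x.
Proof.
  intros ht0 hM0 hP huT k Q t x ht hx.
  destruct sol as [cu cv cm cmx cut cmt hux hmx hvx hut hmt hjb fp im iu bu bm bv bf].
  set (κ := Rabs r + 1) in *.
  assert (hk : 1 <= κ + r) by (unfold κ; generalize (Rle_abs (- r)); rewrite Rabs_Ropp; lra).
  assert (hκ : 0 < κ) by (unfold κ; generalize (Rabs_pos r); lra).
  set (E := fun t => exp (κ * (T - t))).
  assert (cE : forall t, continuous E t) by (intros q; unfold E; cont).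
  assert (dE : forall t, is_derive E t (- κ * E t)) by (intros; apply is_derive_exp_backward).
  assert (hE : forall s, 0 <= s <= T -> 1 <= E s <= exp (κ * T)).
  { intros s hs. unfold E. split.
    - rewrite <- exp_0. apply exp_monotone, Rmult_le_pos; lra.
    - apply exp_monotone, Rmult_le_compat_l; lra. }
  assert (hs2 : 0 < sigma ^ 2) by (apply pow_lt; auto).
  assert (hEm : 0 < exp (κ * T)) by apply exp_pos.
  assert (hk0 : 0 < k) by (unfold k; apply Rdiv_lt_0_compat; lra).
  assert (hQ2 : 2 * exp (2 / k) <= Q).
  { unfold Q. generalize (Rmult_le_pos _ _ hM0 (Rlt_le _ _ (exp_pos (M0 * L / k)))). lra. }
  assert (hQM : M0 * exp (M0 * L / k) <= Q) by (unfold Q; generalize (exp_pos (2 / k)); lra).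
  assert (hQ0 : 0 < Q) by (generalize (exp_pos (2 / k)); lra).
  set (B := Q / k).
  assert (hkB : k * B = Q) by (unfold B; field; lra).
  assert (hB : 0 < B) by (unfold B; apply Rdiv_lt_0_compat; lra).
  clearbody Q B.
  assert (ha : forall y, 0 < 1 + B * Rabs y).
  { intros y. generalize (Rmult_le_pos B (Rabs y) (Rlt_le _ _ hB) (Rabs_pos y)). lra. }
  assert (cln : forall y, continuous (fun y => ln (1 + B * Rabs y)) y).
  { intros y. apply (continuous_comp (fun y => 1 + B * Rabs y) ln); [cont|].
    apply continuity_pt_filterlim. apply derivable_continuous_pt.
    exists (/ (1 + B * Rabs y)). apply derivable_pt_lim_ln, ha. }
  assert (cinv : forall y, continuous (fun y => / (1 + B * Rabs y)) y).
  { intros y. apply cont_inv; [cont | generalize (ha y); lra]. }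
  set (phi := fun y => k * ln (1 + B * Rabs y)).
  set (phi' := fun y => k * B * / (1 + B * Rabs y)).
  assert (cphi : forall y, continuous phi y).
  { intros y. unfold phi. apply cont_mult; [cont | apply cln]. }
  assert (cphi' : forall y, continuous phi' y).
  { intros y. unfold phi'. apply cont_mult; [cont | apply cinv]. }
  assert (lin : forall y : R, is_derive (fun y => 1 + B * y) y B).
  { intros y. apply is_derive_affine. }
  assert (dphi : forall y, 0 < y < L -> is_derive phi y (phi' y)).
  { intros y hy. apply is_derive_ext_loc with (fun y => k * ln (1 + B * y)).
    - generalize (locally_interior 0 L y hy). apply filter_imp.
      intros z hz. unfold phi. rewrite Rabs_pos_eq; lra.
    - unfold phi'. rewrite Rabs_pos_eq by lra.
      replace (k * B * / (1 + B * y)) with (k * (B * / (1 + B * y))) by ring.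
      apply (is_derive_scal (fun y => ln (1 + B * y))).
      apply (is_derive_comp ln (fun y => 1 + B * y)); [|apply lin].
      apply is_derive_Reals, derivable_pt_lim_ln.
      generalize (ha y). rewrite Rabs_pos_eq; lra. }
  assert (dphi' : forall y, 0 < y < L -> is_derive phi' y (- (phi' y ^ 2 / k))).
  { intros y hy. apply is_derive_ext_loc with (fun y => k * B * / (1 + B * y)).
    - generalize (locally_interior 0 L y hy). apply filter_imp.
      intros z hz. unfold phi'. rewrite Rabs_pos_eq; lra.
    - assert (hay := ha y). rewrite Rabs_pos_eq in hay by lra.
      replace (- (phi' y ^ 2 / k)) with (k * B * (- B / (1 + B * y) ^ 2))
        by (unfold phi'; rewrite Rabs_pos_eq by lra; field; lra).
      apply (is_derive_scal (fun y => / (1 + B * y))).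
      apply (is_derive_inv (fun y => 1 + B * y)); [apply lin | lra]. }
  assert (hphi : forall y, 0 <= y -> phi y = k * ln (1 + B * y)).
  { intros y hy. unfold phi. now rewrite Rabs_pos_eq. }
  assert (hphi0 : forall y, 0 <= y <= L -> 0 <= phi y <= Q * y).
  { intros y hy. rewrite hphi by lra. assert (hay := ha y). rewrite Rabs_pos_eq in hay by lra.
    assert (0 <= B * y) by (apply Rmult_le_pos; lra). split.
    - apply Rmult_le_pos; [lra|]. rewrite <- ln_1. apply ln_le; lra.
    - rewrite <- hkB, Rmult_assoc. apply Rmult_le_compat_l; [lra|].
      generalize (ln_le_minus_1 (1 + B * y) hay). lra. }
  assert (key : u t x - E t * phi x <= 0).
  { apply (backward_max_principle (fun t x => u t x - E t * phi x)
      (fun t x => ut t x - (- κ * E t * phi x))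
      (fun t x => v t x - E t * phi' x)
      (fun t x => vx t x - E t * (- (phi' x ^ 2 / k))) (1 / 2 * sigma ^ 2) r t0 T L);
      auto; try lra.
    - cont.
    - cont.
    - intros s y hs hy.
      apply (is_derive_minus (fun s => u s y) (fun s => E s * phi y)).
      + apply hut; lra.
      + apply (is_derive_ext (fun s => phi y * E s)); [intros; eqR; ring|].
        replace (- κ * E s * phi y) with (phi y * (- κ * E s)) by ring.
        apply (is_derive_scal E), dE.
    - intros s y hs hy.
      apply (is_derive_minus (u s) (fun y => E s * phi y)).
      + apply hux; lra.
      + apply (is_derive_scal phi). now apply dphi.
    - intros s y hs hy.
      apply (is_derive_minus (v s) (fun y => E s * phi' y)).
      + apply hvx; lra.
      + apply (is_derive_scal phi'). now apply dphi'.
    - intros y hy. rewrite iu by auto. specialize (huT y hy).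
      unfold E. rewrite Rminus_diag, Rmult_0_r, exp_0, hphi by lra.
      assert (i := log_barrier_above_line k B M0 L y hk0 hM0 hB hy ltac:(lra)). lra.
    - intros s hs. rewrite bu, hphi, Rmult_0_r, Rplus_0_r, ln_1 by lra. lra.
    - intros s hs. rewrite bv by lra.
      assert (0 < E s * phi' L); [|lra].
      apply Rmult_lt_0_compat; [generalize (hE s); lra|].
      unfold phi'. apply Rmult_lt_0_compat; [lra | apply Rinv_0_lt_compat, ha].
    - intros s y hs hy hslope.
      assert (q := hjb s y ltac:(lra) hy).
      assert (ell := log_barrier_elliptic k B y hk0 ltac:(lra) ltac:(lra)).
      rewrite <- hphi in ell by lra.
      assert (e1 : k * B / (1 + B * y) = phi' y)
        by (unfold phi', Rdiv; now rewrite Rabs_pos_eq by lra).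
      rewrite e1 in ell.
      assert (p := hP s ltac:(lra)). apply Rabs_le_between in p.
      assert (hEs := hE s ltac:(lra)). assert (hp0 := hphi0 y ltac:(lra)).
      set (w := phi' y) in *. set (A := price eps L v m s) in *.
      replace (v s y) with (E s * w) in q by lra.
      assert (e2 : 1 / 2 * sigma ^ 2 = k * exp (κ * T)) by (unfold k; field; lra).
      (* the concavity of the barrier absorbs the quadratic Hamiltonian *)
      assert (e3 : 1 / 2 * sigma ^ 2 * (E s * (w ^ 2 / k)) >= (E s * w) ^ 2).
      { rewrite e2. replace (k * exp (κ * T) * (E s * (w ^ 2 / k)))
          with (exp (κ * T) * (E s * w ^ 2)) by (field; lra).
        replace ((E s * w) ^ 2) with (E s * (E s * w ^ 2)) by ring.
        apply Rle_ge, Rmult_le_compat_r; [|lra].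
        apply Rmult_le_pos; [lra | apply pow2_ge_0]. }
      assert (e4 : (A - E s * w) ^ 2 <= 2 * A ^ 2 + 2 * (E s * w) ^ 2).
      { generalize (pow2_ge_0 (A + E s * w)). lra. }
      assert (e5 : A ^ 2 <= 4) by nra.
      assert (e6 : phi y <= (κ + r) * (E s * phi y)).
      { apply Rle_trans with (1 * (1 * phi y)); [lra|].
        apply Rmult_le_compat; [lra | lra | lra |]. apply Rmult_le_compat_r; lra. }
      assert (e7 : w ^ 2 <= (E s * w) ^ 2).
      { rewrite Rpow_mult_distr. apply Rle_trans with (1 * w ^ 2); [lra|].
        apply Rmult_le_compat_r; [apply pow2_ge_0|].
        rewrite <- (pow1 2). apply pow_incr. lra. }
      set (Z := (E s * w) ^ 2) in *. set (Y := (A - E s * w) ^ 2) in *. lra. }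
  apply Rle_trans with (E t * (Q * x)).
  - apply Rle_trans with (E t * phi x); [lra|]. apply Rmult_le_compat_l.
    + generalize (hE t); lra.
    + now apply hphi0.
  - apply Req_le. unfold E. ring.
Qed.

(** The doubling argument for u and for - u; at x = 0 the two one-sided conditions
    are the barrier and u >= 0. *)
Lemma slope_le_on_subinterval t0 M0 :
  0 < t0 < T -> 0 <= M0 ->
  (forall t, t0 <= t <= T -> Rabs (price eps L v m t) <= 2) ->
  (forall x, 0 <= x <= L -> 0 <= uT x) -> uT 0 = 0 ->
  (forall x y, 0 <= y <= x -> x <= L -> Rabs (uT x - uT y) <= M0 * (x - y)) ->
  forall t x, t0 <= t <= T -> 0 <= x <= L -> Rabs (v t x) <= slope_bound T L sigma r M0.
Proof.
  intros ht0 hM0 hP huT0 hu00 hLip t x ht hx.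
  assert (barrier := value_below_barrier t0 M0 ht0 hM0 hP).
  assert (nonneg := value_nonneg t0 ht0 huT0).
  destruct sol as [cu cv cm cmx cut cmt hux hmx hvx hut hmt hjb fp im iu bu bm bv bf].
  unfold slope_bound. set (κ := Rabs r + 1) in *.
  set (k := 1 / 2 * sigma ^ 2 / exp (κ * T)) in *.
  set (Q := 2 * exp (2 / k) + M0 * exp (M0 * L / k)) in *.
  assert (hκ : 0 < κ) by (unfold κ; generalize (Rabs_pos r); lra).
  assert (hκr : 0 <= κ + r) by (unfold κ; generalize (Rle_abs (- r)); rewrite Rabs_Ropp; lra).
  assert (hs2 : 0 < sigma ^ 2) by (apply pow_lt; auto).
  assert (hk0 : 0 < k) by (unfold k; apply Rdiv_lt_0_compat; [lra | apply exp_pos]).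
  assert (hQM : M0 <= Q).
  { unfold Q. assert (1 <= exp (M0 * L / k)).
    { rewrite <- exp_0. apply exp_monotone. apply Rmult_le_pos; [apply Rmult_le_pos; lra|].
      apply Rlt_le, Rinv_0_lt_compat; auto. }
    assert (M0 * 1 <= M0 * exp (M0 * L / k)) by (apply Rmult_le_compat_l; lra).
    generalize (exp_pos (2 / k)). lra. }
  assert (hQ0 : 0 < Q).
  { unfold Q. generalize (exp_pos (2 / k)) (Rmult_le_pos _ _ hM0 (Rlt_le _ _ (exp_pos (M0 * L / k)))). lra. }
  assert (barrier' : forall t x, t0 <= t <= T -> 0 <= x <= L -> u t x <= Q * exp (κ * (T - t)) * x).
  { apply barrier. intros y hy. assert (i := hLip y 0 ltac:(lra) ltac:(lra)).
    rewrite hu00 in i. apply Rabs_le_between in i. lra. }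
  clear barrier. clearbody Q.
  assert (term : forall x y, 0 <= y <= x -> x <= L -> Rabs (u T x - u T y) <= Q * (x - y)).
  { intros z y hy hz. rewrite !iu by lra.
    apply Rle_trans with (M0 * (z - y)); [now apply hLip | apply Rmult_le_compat_r; lra]. }
  assert (up : forall t x y, t0 <= t <= T -> 0 <= y <= x -> x <= L ->
     u t x - u t y <= Q * exp (κ * (T - t)) * (x - y)).
  { apply (doubling_lipschitz u ut v vx (fun t p => 1 / 4 * (price eps L v m t - p) ^ 2)
      (1 / 2 * sigma ^ 2) r κ Q t0 T L); auto; try lra.
    - intros s y hs hy; apply hut; lra.
    - intros s y hs hy; apply hux; lra.
    - intros s y hs hy; apply hvx; lra.
    - intros s y hs hy; apply hjb; lra.
    - intros z y hy hz. assert (i := term z y hy hz). apply Rabs_le_between in i. lra.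
    - intros s y hs hy. rewrite bu by lra. specialize (barrier' s y hs hy). lra.
    - intros s hs. rewrite bv; lra. }
  assert (down : forall t x y, t0 <= t <= T -> 0 <= y <= x -> x <= L ->
     - u t x - - u t y <= Q * exp (κ * (T - t)) * (x - y)).
  { apply (doubling_lipschitz (fun t x => - u t x) (fun t x => - ut t x) (fun t x => - v t x)
      (fun t x => - vx t x) (fun t p => - (1 / 4 * (price eps L v m t - - p) ^ 2))
      (1 / 2 * sigma ^ 2) r κ Q t0 T L); auto; try lra.
    - cont.
    - cont.
    - intros s y hs hy; apply (is_derive_opp (fun s => u s y)), hut; lra.
    - intros s y hs hy; apply (is_derive_opp (u s)), hux; lra.
    - intros s y hs hy; apply (is_derive_opp (v s)), hvx; lra.
    - intros s y hs hy. assert (i := hjb s y ltac:(lra) hy). rewrite Ropp_involutive. lra.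
    - intros z y hy hz. assert (i := term z y hy hz). apply Rabs_le_between in i. lra.
    - intros s y hs hy. rewrite bu by lra. specialize (nonneg s y hs hy).
      assert (0 <= Q * exp (κ * (T - s)) * y); [|lra].
      apply Rmult_le_pos; [|lra]. apply Rmult_le_pos; [lra | apply Rlt_le, exp_pos].
    - intros s hs. rewrite bv; lra. }
  assert (hEt : exp (κ * (T - t)) <= exp (κ * T)) by (apply exp_monotone, Rmult_le_compat_l; lra).
  assert (hQE : Q * exp (κ * (T - t)) <= Q * exp (κ * T)) by (apply Rmult_le_compat_l; lra).
  set (N := Q * exp (κ * (T - t))) in *.
  apply Rle_trans with N; [|exact hQE].
  apply (slope_le_lipschitz_constant (u t) (v t) N L); auto.
  - intros y hy. apply hux; lra.
  - intros y. cont.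
  - intros z y hy hz. apply Rabs_le.
    assert (i := up t z y ht hy hz). assert (i' := down t z y ht hy hz).
    fold N in i, i'. lra.
Qed.

Lemma price_le_2 M t :
  0 <= eps -> (forall x, 0 <= x <= L -> 0 <= m0 x) -> RInt m0 0 L = 1 ->
  0 <= M -> eps * M <= 2 -> 0 <= t <= T ->
  (forall x, 0 <= x <= L -> Rabs (v t x) <= M) -> Rabs (price eps L v m t) <= 2.
Proof.
  intros he hm0 hI hM heM ht hv.
  pose proof (rs_m sol) as cm.
  pose proof (rs_v sol) as cv.
  assert (pos := density_nonneg he hm0).
  assert (e0 := eta_nonneg he hm0 t ht).
  assert (e1 := eta_le_1 he hm0 hI t ht).
  rewrite (price_formula he hm0 t ht).
  assert (hc : - M <= cross L v m t <= M).
  { assert (up : cross L v m t <= RInt (fun x => M * m t x) 0 L).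
    { apply RInt_le_cont; [lra | intros; cont | intros; cont |].
      intros x hx. specialize (hv x ltac:(lra)). apply Rabs_le_between in hv.
      apply Rmult_le_compat_r; [apply pos; lra | lra]. }
    assert (lo : RInt (fun x => - M * m t x) 0 L <= cross L v m t).
    { apply RInt_le_cont; [lra | intros; cont | intros; cont |].
      intros x hx. specialize (hv x ltac:(lra)). apply Rabs_le_between in hv.
      apply Rmult_le_compat_r; [apply pos; lra | lra]. }
    rewrite RInt_scal_cont in up, lo by (intros; cont).
    change (RInt (fun x => m t x) 0 L) with (eta L m t) in up, lo.
    change (RInt (m t) 0 L) with (eta L m t) in up, lo.
    assert (M * eta L m t <= M * 1) by (apply Rmult_le_compat_l; lra). lra. }
  assert (h1 : 0 <= eps * eta L m t) by (apply Rmult_le_pos; lra).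
  assert (h2 : eps * cross L v m t <= eps * M) by (apply Rmult_le_compat_l; lra).
  assert (h3 : eps * - M <= eps * cross L v m t) by (apply Rmult_le_compat_l; lra).
  set (q := 2 + eps * eta L m t) in *.
  assert (hq : 2 <= q) by (unfold q; lra).
  unfold Rdiv. rewrite Rabs_mult, (Rabs_inv q), (Rabs_pos_eq q) by lra.
  assert (h4 : Rabs (2 + eps * cross L v m t) <= 4) by (apply Rabs_le; lra).
  assert (h5 : / q <= / 2) by (apply Rinv_le_contravar; lra).
  assert (h6 : 0 < / q) by (apply Rinv_0_lt_compat; lra).
  apply Rle_trans with (4 * / 2); [|lra].
  apply Rmult_le_compat; [apply Rabs_pos | lra | auto | auto].
Qed.

(** A bound M1 + 1 on [[t0, T]] gives |price| <= 2 there and improves itself to M1.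
    Since v moves by at most 1 in a time step of fixed length, the bound M1 on
    [[t, T]] gives M1 + 1 one step earlier. Starting from the terminal slope this
    reaches every positive time, and t = 0 by continuity. *)
Lemma slope_bounded M0 :
  0 <= eps -> (forall x, 0 <= x <= L -> 0 <= m0 x) -> RInt m0 0 L = 1 ->
  0 <= M0 -> eps * (slope_bound T L sigma r M0 + 1) <= 2 ->
  (forall x, 0 <= x <= L -> 0 <= uT x) -> uT 0 = 0 ->
  (forall x y, 0 <= y <= x -> x <= L -> Rabs (uT x - uT y) <= M0 * (x - y)) ->
  forall t x, 0 <= t <= T -> 0 <= x <= L -> Rabs (v t x) <= slope_bound T L sigma r M0.
Proof.
  intros he hm0 hI hM0 hsmall huT0 hu00 hLip.
  pose proof (rs_v sol) as cv.
  set (M1 := slope_bound T L sigma r M0) in *.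
  assert (hM1 : 0 <= M1).
  { unfold M1, slope_bound. apply Rmult_le_pos; [|apply Rlt_le, exp_pos].
    apply Rplus_le_le_0_compat; apply Rmult_le_pos; try lra; apply Rlt_le, exp_pos. }
  destruct (uniform_2d v 0 T 0 L 1 cv ltac:(lra)) as (d & hd & hu).
  assert (close : forall t s x, 0 <= t <= T -> 0 <= s <= T -> 0 <= x <= L -> Rabs (s - t) < d ->
     Rabs (v t x) <= M1 -> Rabs (v s x) <= M1 + 1).
  { intros t s x ht hs hx hts hb.
    assert (i := hu t x s x ht hx hs hx hts ltac:(rewrite Rminus_diag, Rabs_R0; lra)).
    apply Rabs_le_between in hb. apply Rabs_def2 in i. apply Rabs_le; lra. }
  assert (weak : forall t0, 0 < t0 < T ->
     (forall t x, t0 <= t <= T -> 0 <= x <= L -> Rabs (v t x) <= M1 + 1) ->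
     forall t x, t0 <= t <= T -> 0 <= x <= L -> Rabs (v t x) <= M1).
  { intros t0 ht0 hb. apply slope_le_on_subinterval; auto.
    intros t ht. apply (price_le_2 (M1 + 1)); auto; lra. }
  assert (atT : forall x, 0 <= x <= L -> Rabs (v T x) <= M1).
  { intros x hx. apply Rle_trans with M0; [|now apply slope_bound_ge].
    apply (slope_le_lipschitz_constant (u T) (v T) M0 L); auto.
    - intros y hy. apply (rs_u_x sol); lra.
    - intros y. cont.
    - intros z y hy hz. rewrite !(rs_uT sol) by lra. auto. }
  assert (step : forall n t x, 0 < t <= T -> T - INR n * (d / 2) <= t -> 0 <= x <= L ->
     Rabs (v t x) <= M1 + 1).
  { induction n as [|n IH].
    - intros t x ht htn hx. simpl in htn. replace t with T by lra.
      specialize (atT x hx). lra.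
    - intros t x ht htn hx. rewrite S_INR in htn.
      destruct (Rle_lt_dec (T - INR n * (d / 2)) t) as [h|h]; [now apply IH|].
      assert (hn0 : 0 <= INR n * (d / 2)) by (apply Rmult_le_pos; [apply pos_INR | lra]).
      apply (close (T - INR n * (d / 2))); try lra.
      + rewrite <- Rabs_Ropp, Rabs_pos_eq; lra.
      + destruct (Req_dec (T - INR n * (d / 2)) T) as [e|e].
        * rewrite e. now apply atT.
        * apply (weak (T - INR n * (d / 2))); try lra.
          intros q z hq hz. apply IH; lra. }
  assert (pos : forall t x, 0 < t <= T -> 0 <= x <= L -> Rabs (v t x) <= M1).
  { intros t x ht hx. destruct (Req_dec t T) as [->|hne]; [now apply atT|].
    apply (weak t); try lra. intros q z hq hz.
    destruct (archimed_cor1 (d / 2 / T)) as (n & hn & hn0).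
    { apply Rdiv_lt_0_compat; lra. }
    apply (step n); try lra.
    assert (hnp : 0 < INR n) by (apply lt_0_INR; auto).
    assert (T <= INR n * (d / 2)); [|lra].
    apply Rmult_le_reg_r with (/ INR n * / T).
    { apply Rmult_lt_0_compat; apply Rinv_0_lt_compat; lra. }
    replace (T * (/ INR n * / T)) with (/ INR n) by (field; lra).
    replace (INR n * (d / 2) * (/ INR n * / T)) with (d / 2 / T) by (field; lra).
    lra. }
  intros t x ht hx. destruct (Req_dec t 0) as [->|hne]; [|apply pos; lra].
  apply Rnot_lt_le. intros hbig.
  destruct (near_of_continuous (fun s => Rabs (v s x)) 0 (Rabs (v 0 x) - M1) ltac:(cont) ltac:(lra))
    as [q hq].
  assert (hqp := cond_pos q).
  set (z := Rmin (q / 2) T).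
  assert (hz : 0 < z /\ z <= q / 2 /\ z <= T).
  { unfold z. split; [apply Rmin_glb_lt; lra | split; [apply Rmin_l | apply Rmin_r]]. }
  assert (i := hq z (proj2 (ball_R 0 q z) ltac:(rewrite Rabs_pos_eq; lra))). simpl in i.
  apply Rabs_def2 in i. specialize (pos z x ltac:(lra) hx). lra.
Qed.

End solution.

(** * The coupled energy of two solutions *)

Lemma cauchy_schwarz (f g : R -> R) a b :
  a < b -> (forall x, continuous f x) -> (forall x, continuous g x) ->
  RInt (fun x => f x * g x) a b ^ 2
  <= RInt (fun x => f x ^ 2) a b * RInt (fun x => g x ^ 2) a b.
Proof.
  intros hab cf cg.
  set (F := RInt (fun x => f x ^ 2) a b). set (D := RInt (fun x => g x ^ 2) a b).
  set (C := RInt (fun x => f x * g x) a b).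
  assert (hD : 0 <= D)
    by (apply RInt_ge_0_cont; [lra | intros; cont | intros; apply pow2_ge_0]).
  assert (key : forall l k, 0 <= l ^ 2 * F + 2 * l * k * C + k ^ 2 * D).
  { intros l k.
    assert (h : 0 <= RInt (fun x => l ^ 2 * f x ^ 2 + 2 * l * k * (f x * g x) + k ^ 2 * g x ^ 2) a b).
    { apply RInt_ge_0_cont; [lra | intros; cont |].
      intros x _. replace (l ^ 2 * f x ^ 2 + 2 * l * k * (f x * g x) + k ^ 2 * g x ^ 2)
        with ((l * f x + k * g x) ^ 2) by ring. apply pow2_ge_0. }
    rewrite RInt_plus_cont in h by (intros; cont).
    rewrite RInt_plus_cont in h by (intros; cont).
    rewrite !RInt_scal_cont in h by (intros; cont). exact h. }
  destruct (Req_dec D 0) as [h0|h0].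
  - assert (hz := zero_of_RInt_le_0 (fun x => g x ^ 2) a b hab ltac:(intros; cont)
      ltac:(intros; apply pow2_ge_0) (Req_le _ _ h0)).
    assert (hC : C = 0).
    { apply RInt_eq_0; [lra|]. intros x hx.
      assert (i := hz x ltac:(lra)). simpl in i.
      replace (g x) with 0 by nra. ring. }
    rewrite hC, h0. simpl. lra.
  - assert (k1 := key D (- C)).
    replace (D ^ 2 * F + 2 * D * - C * C + (- C) ^ 2 * D) with (D * (F * D - C ^ 2)) in k1 by ring.
    assert (0 <= F * D - C ^ 2); [|lra].
    apply Rmult_le_reg_l with D; lra.
Qed.

(** Young's inequality for the source terms of |N|^2. The weight th keeps the
    coefficient of N^2 m2^2 small, as that term is later bounded by |mu|^2. *)
Lemma transport_terms s2 g th q1 mu N D wx m2 :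
  0 < s2 -> 0 < th -> Rabs q1 <= g ->
  - s2 * mu ^ 2 - 2 * N * (q1 * mu + 1 / 2 * (D - wx) * m2)
  <= - (s2 / 2) * mu ^ 2 + 2 * g ^ 2 / s2 * N ^ 2 + th * (N ^ 2 * m2 ^ 2)
     + (D ^ 2 + wx ^ 2) / (2 * th).
Proof.
  intros hs hth hq.
  assert (hq2 : q1 ^ 2 <= g ^ 2)
    by (rewrite <- (pow2_abs q1); apply pow_incr; split; [apply Rabs_pos | exact hq]).
  assert (h1 : 2 * q1 ^ 2 / s2 * N ^ 2 <= 2 * g ^ 2 / s2 * N ^ 2).
  { apply Rmult_le_compat_r; [apply pow2_ge_0|]. apply Rmult_le_compat_r; [|lra].
    apply Rlt_le, Rinv_0_lt_compat; auto. }
  assert (h2 : 0 <= s2 / 2 * (mu + 2 * q1 * N / s2) ^ 2)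
    by (apply Rmult_le_pos; [lra | apply pow2_ge_0]).
  replace (s2 / 2 * (mu + 2 * q1 * N / s2) ^ 2)
    with (s2 / 2 * mu ^ 2 + 2 * q1 * N * mu + 2 * q1 ^ 2 / s2 * N ^ 2) in h2 by (field; lra).
  assert (h3 : 0 <= th * (N * m2 + (D - wx) / (2 * th)) ^ 2)
    by (apply Rmult_le_pos; [lra | apply pow2_ge_0]).
  replace (th * (N * m2 + (D - wx) / (2 * th)) ^ 2)
    with (th * (N ^ 2 * m2 ^ 2) + N * m2 * (D - wx) + (D - wx) ^ 2 / (4 * th)) in h3
    by (field; lra).
  assert (h4 : 0 <= (D + wx) ^ 2 / (4 * th)).
  { apply Rmult_le_pos; [apply pow2_ge_0 | apply Rlt_le, Rinv_0_lt_compat; lra]. }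
  replace ((D + wx) ^ 2 / (4 * th)) with ((D ^ 2 + wx ^ 2) / (2 * th) - (D - wx) ^ 2 / (4 * th)) in h4
    by (field; lra).
  lra.
Qed.

(** Young's inequality for the source terms of |w|^2, which must be bounded from
    below because w solves a backward equation. *)
Lemma value_terms s2 g r q1 q2 w D wx :
  0 < s2 -> Rabs q1 <= g -> Rabs q2 <= g ->
  1 / 2 * s2 * wx ^ 2 - D ^ 2
  <= (2 * Rabs r + g ^ 2 + 2 * g ^ 2 / s2) * w ^ 2
     + 2 * r * w ^ 2 - 2 * w * (1 / 2 * (D - wx) * (q1 + q2)) + s2 * wx ^ 2.
Proof.
  intros hs h1 h2.
  set (q := q1 + q2).
  assert (hq : Rabs (q / 2) <= g).
  { apply Rabs_le_between in h1, h2. apply Rabs_le. unfold q. lra. }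
  assert (hq2 : (q / 2) ^ 2 <= g ^ 2)
    by (rewrite <- (pow2_abs (q / 2)); apply pow_incr; split; [apply Rabs_pos | exact hq]).
  assert (h3 : (q / 2) ^ 2 * w ^ 2 <= g ^ 2 * w ^ 2)
    by (apply Rmult_le_compat_r; [apply pow2_ge_0 | lra]).
  assert (h4 : 2 * (q / 2) ^ 2 / s2 * w ^ 2 <= 2 * g ^ 2 / s2 * w ^ 2).
  { apply Rmult_le_compat_r; [apply pow2_ge_0|]. apply Rmult_le_compat_r; [|lra].
    apply Rlt_le, Rinv_0_lt_compat; auto. }
  assert (h5 := pow2_ge_0 (D - q / 2 * w)).
  assert (h6 : 0 <= s2 / 2 * (wx + 2 * (q / 2) * w / s2) ^ 2)
    by (apply Rmult_le_pos; [lra | apply pow2_ge_0]).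
  replace (s2 / 2 * (wx + 2 * (q / 2) * w / s2) ^ 2)
    with (s2 / 2 * wx ^ 2 + 2 * (q / 2) * w * wx + 2 * (q / 2) ^ 2 / s2 * w ^ 2) in h6
    by (field; lra).
  assert (h7 : 0 <= (Rabs r + r) * w ^ 2).
  { apply Rmult_le_pos; [|apply pow2_ge_0].
    generalize (Rle_abs (- r)). rewrite Rabs_Ropp. lra. }
  lra.
Qed.

(** Both denominators are at least 2, so that the difference of the prices is of
    order eps. *)
Lemma price_difference p1 p2 I1 I2 h1 h2 eps :
  0 <= eps -> 0 <= h1 -> 0 <= h2 -> Rabs p2 <= 2 ->
  p1 = (2 + eps * I1) / (2 + eps * h1) -> p2 = (2 + eps * I2) / (2 + eps * h2) ->
  (p1 - p2) ^ 2 <= eps ^ 2 * (1 / 2 * (I1 - I2) ^ 2 + 2 * (h1 - h2) ^ 2).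
Proof.
  intros he hh1 hh2 hp2 e1 e2.
  assert (0 <= eps * h1) by now apply Rmult_le_pos.
  assert (0 <= eps * h2) by now apply Rmult_le_pos.
  set (Q := 2 + eps * h1) in *.
  assert (hQ : 2 <= Q) by (unfold Q; lra).
  assert (e : Q * (p1 - p2) = eps * ((I1 - I2) - p2 * (h1 - h2))).
  { assert (a1 : Q * p1 = 2 + eps * I1) by (rewrite e1; field; lra).
    assert (a2 : (2 + eps * h2) * p2 = 2 + eps * I2) by (rewrite e2; field; lra).
    replace (Q * (p1 - p2)) with (Q * p1 - Q * p2) by ring. rewrite a1. unfold Q.
    replace ((2 + eps * h1) * p2) with ((2 + eps * h2) * p2 + eps * (h1 - h2) * p2) by ring.
    rewrite a2. ring. }
  assert (b1 : 4 * (p1 - p2) ^ 2 <= (Q * (p1 - p2)) ^ 2).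
  { rewrite Rpow_mult_distr. apply Rmult_le_compat_r; [apply pow2_ge_0|].
    replace 4 with (2 ^ 2) by ring. apply pow_incr. lra. }
  rewrite e, Rpow_mult_distr in b1.
  assert (hp : p2 ^ 2 <= 4).
  { replace 4 with (2 ^ 2) by ring. rewrite <- (pow2_abs p2).
    apply pow_incr. split; [apply Rabs_pos | lra]. }
  assert (b2 : ((I1 - I2) - p2 * (h1 - h2)) ^ 2 <= 2 * (I1 - I2) ^ 2 + 8 * (h1 - h2) ^ 2).
  { assert (h3 := pow2_ge_0 ((I1 - I2) + p2 * (h1 - h2))).
    assert (h4 : p2 ^ 2 * (h1 - h2) ^ 2 <= 4 * (h1 - h2) ^ 2)
      by (apply Rmult_le_compat_r; [apply pow2_ge_0 | auto]).
    lra. }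
  assert (b3 := Rmult_le_compat_l (eps ^ 2) _ _ (pow2_ge_0 eps) b2).
  lra.
Qed.

(** A weight exponent that absorbs all multiples of N^2 and w^2 when the slopes are
    bounded by M and the prices by 2. *)
Definition energy_rate (sigma r M : R) : R :=
  2 * Rabs r + ((2 + M) / 2) ^ 2 + 2 * ((2 + M) / 2) ^ 2 / sigma ^ 2.

Section two_solutions.
Context {T L sigma r eps : R} {uT m0 : R -> R}.
Context {u1 ut1 v1 vx1 m1 mt1 mx1 u2 ut2 v2 vx2 m2 mt2 mx2 : R -> R -> R}.
Context (hT : 0 < T) (hL : 0 < L) (hsigma : 0 < sigma).
Context (heps : 0 <= eps).
Context (hm0 : forall x, 0 <= x <= L -> 0 <= m0 x).
Context (sol1 : regular_solution T L sigma r eps uT m0 u1 ut1 v1 vx1 m1 mt1 mx1).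
Context (sol2 : regular_solution T L sigma r eps uT m0 u2 ut2 v2 vx2 m2 mt2 mx2).

Let P1 (t : R) : R := (2 + eps * cross L v1 m1 (clamp T t)) / (2 + eps * eta L m1 (clamp T t)).
Let P2 (t : R) : R := (2 + eps * cross L v2 m2 (clamp T t)) / (2 + eps * eta L m2 (clamp T t)).

Lemma price_clamped u ut v vx m mt mx :
  regular_solution T L sigma r eps uT m0 u ut v vx m mt mx ->
  (forall t, continuous (fun t => (2 + eps * cross L v m (clamp T t))
                                  / (2 + eps * eta L m (clamp T t))) t) /\
  (forall t, 0 <= t <= T -> price eps L v m t
     = (2 + eps * cross L v m (clamp T t)) / (2 + eps * eta L m (clamp T t))).
Proof.
  intros sol. split.
  - intros t. pose proof (cont_cross (L := L) sol) as cc. pose proof (cont_eta (L := L) sol) as ce.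
    pose proof (cont_clamp T) as ct.
    apply cont_mult; [cont|]. apply cont_inv; [cont|].
    assert (h := eta_nonneg hT hL hsigma sol heps hm0 (clamp T t) (clamp_range T t ltac:(lra))).
    assert (0 <= eps * eta L m (clamp T t)) by now apply Rmult_le_pos. lra.
  - intros t ht. rewrite clamp_id by auto. now apply (price_formula hT hL hsigma sol).
Qed.

Let cP1 : forall t, continuous P1 t := proj1 (price_clamped _ _ _ _ _ _ _ sol1).
Let cP2 : forall t, continuous P2 t := proj1 (price_clamped _ _ _ _ _ _ _ sol2).
Let eP1 : forall t, 0 <= t <= T -> price eps L v1 m1 t = P1 t :=
  proj2 (price_clamped _ _ _ _ _ _ _ sol1).
Let eP2 : forall t, 0 <= t <= T -> price eps L v2 m2 t = P2 t :=
  proj2 (price_clamped _ _ _ _ _ _ _ sol2).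

(** N, the mass to the right of x, is written with integrals from 0 so that its
    continuity in (t, x) is immediate. *)
Let mu (t x : R) : R := m1 t x - m2 t x.
Let F (t x : R) : R :=
  flux sigma (P1 t) (v1 t x) (m1 t x) (mx1 t x)
  - flux sigma (P2 t) (v2 t x) (m2 t x) (mx2 t x).
Let Mu (t x : R) : R := RInt (mu t) 0 x.
Let N (t x : R) : R := Mu t L - Mu t x.

Let cmu : cont2 mu.
Proof.
  pose proof (rs_m sol1). pose proof (rs_m sol2). unfold mu; cont.
Qed.

Let cF : cont2 F.
Proof.
  pose proof (rs_m sol1). pose proof (rs_m sol2). pose proof (rs_v sol1). pose proof (rs_v sol2).
  pose proof (rs_mx sol1). pose proof (rs_mx sol2).
  unfold F, flux; cont.
Qed.

Let cMu : cont2 Mu.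
Proof. apply (cont_RInt_param mu 0 cmu). Qed.

(** The flux F of mu vanishes at L, so d/dt N = - F; the integrated form gives the
    time derivative of N at every interior x although m_t is not controlled at L. *)
Lemma tail_mass_is_time_integral t x :
  0 <= t <= T -> 0 < x < L -> N t x = - RInt (fun s => F s x) 0 t.
Proof.
  intros ht hx.
  set (J := fun t => RInt (fun s => F s x) 0 t).
  assert (dJ : forall s, is_derive J s (F s x))
    by (intros s; apply (is_derive_primitive (fun s => F s x)); intros; cont).
  assert (cJ : forall s, continuous J s)
    by (intros s; apply (ex_derive_continuous J); eexists; apply dJ).
  assert (dF : forall s y, 0 < s < T -> 0 < y < L -> is_derive (F s) y (mt1 s y - mt2 s y)).
  { intros s y hs hy.
    apply (is_derive_minus (fun y => flux sigma (P1 s) (v1 s y) (m1 s y) (mx1 s y))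
             (fun y => flux sigma (P2 s) (v2 s y) (m2 s y) (mx2 s y))).
    - rewrite <- eP1 by lra. now apply (rs_fp sol1).
    - rewrite <- eP2 by lra. now apply (rs_fp sol2). }
  assert (FL : forall s, 0 <= s <= T -> F s L = 0).
  { intros s hs. unfold F. rewrite <- eP1, <- eP2 by auto.
    rewrite (rs_fL sol1), (rs_fL sol2) by auto. ring. }
  (* spreading J(t) evenly over [x, L] makes the total flux zero; e = 1 and
     e = -1 give the two inequalities *)
  assert (bal : forall e, RInt (fun y => e * (mu t y + / (L - x) * J t)) x L
                       <= RInt (fun y => e * (mu 0 y + / (L - x) * J 0)) x L).
  { intros e.
    apply (flux_balance_bounded_price (fun t y => e * (mu t y + / (L - x) * J t))
      (fun t y => e * (mt1 t y - mt2 t y + / (L - x) * F t x))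
      (fun t y => e * F t y) (fun _ _ => 0) (fun t _ => e * (/ (L - x) * F t x)) (fun _ _ => 0)
      (fun _ => 0) T x L 0); try lra; try cont.
    - intros s hs. rewrite Rabs_R0; lra.
    - intros s y hs hy. apply (is_derive_scal (fun s => mu s y + / (L - x) * J s)).
      apply (is_derive_plus (fun s => mu s y) (fun s => / (L - x) * J s)).
      + apply (is_derive_minus (fun s => m1 s y) (fun s => m2 s y)).
        * apply (rs_m_t sol1); lra.
        * apply (rs_m_t sol2); lra.
      + apply (is_derive_scal J), dJ.
    - intros s y hs hy.
      apply cont_mult; [cont|]. apply cont_plus; [|cont].
      apply cont_minus; [apply (rs_mt sol1); lra | apply (rs_mt sol2); lra].
    - intros s y hs hy.
      apply (is_derive_ext (fun y => e * F s y)); [intros; eqR; ring|].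
      replace (e * (mt1 s y - mt2 s y + / (L - x) * F s x) - _) with (e * (mt1 s y - mt2 s y))
        by ring.
      apply (is_derive_scal (F s)), dF; lra.
    - intros s hs. rewrite FL by lra.
      rewrite (RInt_ext _ (fun _ => e * (/ (L - x) * F s x))) by (intros; eqR; ring).
      rewrite RInt_constant.
      apply Req_le. field. lra. }
  assert (int : forall e t, RInt (fun y => e * (mu t y + / (L - x) * J t)) x L = e * (N t x + J t)).
  { intros e s. rewrite RInt_scal_cont, RInt_plus_cont by (intros; cont).
    rewrite RInt_constant.
    assert (i := RInt_split (mu s) 0 x L ltac:(intros; cont)).
    fold (Mu s L) (Mu s x) in i. unfold N.
    replace (RInt (mu s) x L) with (Mu s L - Mu s x) by lra.
    eqR. field. lra. }
  assert (N0 : N 0 x = 0).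
  { unfold N, Mu.
    assert (z : forall y, 0 <= y <= L -> RInt (mu 0) 0 y = 0).
    { intros y hy. apply RInt_eq_0; [lra|]. intros q hq. unfold mu.
      rewrite (rs_m0 sol1), (rs_m0 sol2) by lra. ring. }
    rewrite !z by lra. ring. }
  assert (J0 : J 0 = 0) by (unfold J; apply (RInt_point 0 (fun s => F s x))).
  assert (b1 := bal 1). assert (b2 := bal (-1)). rewrite !int, N0, J0 in b1, b2.
  fold (J t). lra.
Qed.

Let W (t : R) : R := RInt (fun x => (u1 t x - u2 t x) ^ 2) 0 L.
Let V (t : R) : R := RInt (fun x => N t x ^ 2) 0 L.
Let X (t : R) : R := RInt (fun x => (v1 t x - v2 t x) ^ 2) 0 L.
Let Y (t : R) : R := RInt (fun x => mu t x ^ 2) 0 L.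

Lemma tail_mass_sq_le t x : 0 <= x <= L -> N t x ^ 2 <= L * Y t.
Proof.
  intros hx.
  assert (hY : forall a b, a <= b -> 0 <= RInt (fun x => mu t x ^ 2) a b)
    by (intros; apply RInt_ge_0_cont; [auto | intros; cont | intros; apply pow2_ge_0]).
  destruct (Req_dec x L) as [->|hne].
  { unfold N. rewrite Rminus_diag. replace (0 ^ 2) with 0 by ring.
    apply Rmult_le_pos; [lra | apply hY; lra]. }
  assert (e : N t x = RInt (fun y => 1 * mu t y) x L).
  { unfold N, Mu. rewrite (RInt_split (mu t) 0 x L) by (intros; cont).
    rewrite RInt_scal_cont by (intros; cont).
    change (RInt (fun y => mu t y) x L) with (RInt (mu t) x L). ring. }
  rewrite e.
  eapply Rle_trans; [apply (cauchy_schwarz (fun _ => 1) (mu t)); [lra | intros; cont | intros; cont]|].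
  rewrite RInt_constant.
  apply Rmult_le_compat; try lra.
  - apply (hY x L); lra.
  - change (RInt (fun x0 => mu t x0 ^ 2) x L <= Y t). unfold Y.
    rewrite (RInt_split (fun x => mu t x ^ 2) 0 x L) by (intros; cont).
    generalize (hY 0 x ltac:(lra)). lra.
Qed.

Context (M C : R).
Context (hC : 0 <= C).
Context (hv1 : forall t x, 0 <= t <= T -> 0 <= x <= L -> Rabs (v1 t x) <= M).
Context (hv2 : forall t x, 0 <= t <= T -> 0 <= x <= L -> Rabs (v2 t x) <= M).
Context (hp1 : forall t, 0 <= t <= T -> Rabs (price eps L v1 m1 t) <= 2).
Context (hp2 : forall t, 0 <= t <= T -> Rabs (price eps L v2 m2 t) <= 2).
Context (hC1 : forall t, 0 <= t <= T -> RInt (fun x => m1 t x ^ 2) 0 L <= C).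
Context (hC2 : forall t, 0 <= t <= T -> RInt (fun x => m2 t x ^ 2) 0 L <= C).

Lemma price_gap t :
  0 <= t <= T ->
  (P1 t - P2 t) ^ 2 <= eps ^ 2 * (C + L * M ^ 2 + 2 * L) * (X t + Y t).
Proof.
  intros ht.
  pose proof (rs_m sol1) as cm1. pose proof (rs_m sol2) as cm2.
  pose proof (rs_v sol1) as cv1. pose proof (rs_v sol2) as cv2.
  assert (hX : 0 <= X t)
    by (apply RInt_ge_0_cont; [lra | intros; cont | intros; apply pow2_ge_0]).
  assert (hY : 0 <= Y t)
    by (apply RInt_ge_0_cont; [lra | intros; cont | intros; apply pow2_ge_0]).
  assert (hh1 := eta_nonneg hT hL hsigma sol1 heps hm0 t ht).
  assert (hh2 := eta_nonneg hT hL hsigma sol2 heps hm0 t ht).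
  assert (gap := price_difference (P1 t) (P2 t) (cross L v1 m1 t) (cross L v2 m2 t)
     (eta L m1 t) (eta L m2 t) eps heps hh1 hh2).
  assert (gap' : (P1 t - P2 t) ^ 2 <= eps ^ 2 *
    (1 / 2 * (cross L v1 m1 t - cross L v2 m2 t) ^ 2 + 2 * (eta L m1 t - eta L m2 t) ^ 2)).
  { apply gap.
    - rewrite <- eP2 by auto. now apply hp2.
    - unfold P1. now rewrite clamp_id.
    - unfold P2. now rewrite clamp_id. }
  assert (he : (eta L m1 t - eta L m2 t) ^ 2 <= L * Y t).
  { unfold eta. rewrite <- RInt_minus_cont by (intros; cont).
    rewrite <- (RInt_ext (fun x => 1 * mu t x)) by (intros; eqR; unfold mu; ring).
    eapply Rle_trans; [apply (cauchy_schwarz (fun _ => 1) (mu t)); [lra | intros; cont | intros; cont]|].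
    rewrite RInt_constant.
    apply Req_le. change (RInt (fun x => mu t x ^ 2) 0 L) with (Y t). ring. }
  set (A1 := RInt (fun x => (v1 t x - v2 t x) * m1 t x) 0 L).
  set (A2 := RInt (fun x => v2 t x * mu t x) 0 L).
  assert (hI : cross L v1 m1 t - cross L v2 m2 t = A1 + A2).
  { unfold cross, A1, A2. rewrite <- RInt_minus_cont, <- RInt_plus_cont by (intros; cont).
    apply RInt_ext. intros x _. eqR. unfold mu. ring. }
  assert (hA1 : A1 ^ 2 <= X t * C).
  { unfold A1. eapply Rle_trans; [apply (cauchy_schwarz (fun x => v1 t x - v2 t x) (m1 t)); [lra | intros; cont | intros; cont]|].
    apply Rmult_le_compat_l; [exact hX | now apply hC1]. }
  assert (hA2 : A2 ^ 2 <= L * M ^ 2 * Y t).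
  { unfold A2. eapply Rle_trans; [apply (cauchy_schwarz (v2 t) (mu t)); [lra | intros; cont | intros; cont]|].
    apply Rmult_le_compat_r; [exact hY|].
    apply Rle_trans with (RInt (fun _ => M ^ 2) 0 L).
    - apply RInt_le_cont; [lra | intros; cont | intros; cont |].
      intros x hx. rewrite <- (pow2_abs (v2 t x)). apply pow_incr.
      split; [apply Rabs_pos | apply hv2; lra].
    - rewrite RInt_constant. lra. }
  eapply Rle_trans; [exact gap'|]. rewrite Rmult_assoc.
  apply Rmult_le_compat_l; [apply pow2_ge_0|]. rewrite hI.
  assert (h2 := pow2_ge_0 (A1 - A2)).
  assert (0 <= C * Y t) by now apply Rmult_le_pos.
  assert (0 <= L * M ^ 2 * X t)
    by (apply Rmult_le_pos; auto; apply Rmult_le_pos; [lra | apply pow2_ge_0]).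
  assert (0 <= L * X t) by (apply Rmult_le_pos; lra).
  lra.
Qed.

Let g : R := (2 + M) / 2.
Let kappa0 : R := energy_rate sigma r M.

(** The fluxes K exp(kappa t) sigma^2 w w_x and - exp(- kappa t) sigma^2 N mu vanish
    at both ends. What remains is at most a multiple of X = |w_x|^2 plus a multiple
    of Y = |mu|^2. K makes the first coefficient negative; the second is then
    negative because eps^2 multiplies every positive term that K brings in. *)
Lemma coupled_energy_nonincreasing (th K kappa : R) :
  let del := eps ^ 2 * L * (C + L * M ^ 2 + 2 * L) in
  0 < th -> th * (L * C) <= sigma ^ 2 / 4 -> K = 8 / (th * sigma ^ 2) ->
  kappa0 <= kappa -> del <= 1 -> del <= sigma ^ 2 / 4 ->
  del * (1 / (2 * th) + K * exp (2 * kappa * T)) <= sigma ^ 2 / 4 ->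
  forall s t, 0 <= s <= t -> t <= T ->
  exp (- kappa * t) * V t - K * (exp (kappa * t) * W t)
  <= exp (- kappa * s) * V s - K * (exp (kappa * s) * W s).
Proof.
  intros del hth hthC hK hkap hd1 hd2 hd3 s t hst ht.
  pose proof (rs_m sol1) as cm1. pose proof (rs_m sol2) as cm2.
  pose proof (rs_v sol1) as cv1. pose proof (rs_v sol2) as cv2.
  pose proof (rs_u sol1) as cu1. pose proof (rs_u sol2) as cu2.
  assert (hs2 : 0 < sigma ^ 2) by (apply pow_lt; auto).
  assert (hg2 : 0 <= 2 * g ^ 2 / sigma ^ 2).
  { apply Rmult_le_pos; [generalize (pow2_ge_0 g); lra | apply Rlt_le, Rinv_0_lt_compat; auto]. }
  assert (hk0 : 2 * g ^ 2 / sigma ^ 2 <= kappa0)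
    by (change kappa0 with (2 * Rabs r + g ^ 2 + 2 * g ^ 2 / sigma ^ 2); generalize (Rabs_pos r) (pow2_ge_0 g); lra).
  assert (hkpos : 0 <= kappa) by lra.
  assert (hK0 : 0 < K)
    by (rewrite hK; apply Rdiv_lt_0_compat; [lra | now apply Rmult_lt_0_compat]).
  set (w := fun t x => u1 t x - u2 t x).
  set (wx := fun t x => v1 t x - v2 t x).
  set (q1 := fun t x => 1 / 2 * (P1 t - v1 t x)).
  set (q2 := fun t x => 1 / 2 * (P2 t - v2 t x)).
  assert (cw : cont2 w) by (unfold w; cont). assert (cwx : cont2 wx) by (unfold wx; cont).
  assert (cq1 : cont2 q1) by (unfold q1; cont). assert (cq2 : cont2 q2) by (unfold q2; cont).
  assert (cN : cont2 N) by (unfold N; cont).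
  set (em := fun t => exp (- kappa * t)). set (ep := fun t => exp (kappa * t)).
  assert (cem : forall t, continuous em t) by (intros; unfold em; cont).
  assert (cep : forall t, continuous ep t) by (intros; unfold ep; cont).
  assert (dem : forall t, is_derive em t (- kappa * em t)) by (intros; apply is_derive_exp_linear).
  assert (dep : forall t, is_derive ep t (kappa * ep t)) by (intros; apply is_derive_exp_linear).
  assert (int : forall t, RInt (fun x => em t * N t x ^ 2 - K * (ep t * w t x ^ 2)) 0 L
     = em t * V t - K * (ep t * W t)).
  { intros q. rewrite RInt_minus_cont, !RInt_scal_cont by (intros; cont). reflexivity. }
  fold (em t) (em s) (ep t) (ep s). rewrite <- !int.
  assert (dN_t : forall t x, 0 < t < T -> 0 < x < L -> is_derive (fun t => N t x) t (- F t x)).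
  { intros q x hq hx.
    apply is_derive_ext_loc with (fun q => - RInt (fun s => F s x) 0 q).
    - generalize (locally_interior 0 T q hq). apply filter_imp. intros z hz. symmetry.
      apply tail_mass_is_time_integral; lra.
    - apply (is_derive_opp (fun q => RInt (fun s => F s x) 0 q)).
      apply (is_derive_primitive (fun s => F s x)). intros; cont. }
  assert (dN_x : forall t x, is_derive (N t) x (- mu t x)).
  { intros q x. unfold N. replace (- mu q x) with (0 - mu q x) by ring.
    apply (is_derive_minus (fun _ => Mu q L) (Mu q)); [apply @is_derive_const|].
    apply (is_derive_primitive (mu q)). intros; cont. }
  apply (flux_balance_bounded_price (fun t x => em t * N t x ^ 2 - K * (ep t * w t x ^ 2))
    (fun t x => (- kappa * em t * N t x ^ 2 + em t * (2 * N t x * - F t x))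
       - K * (kappa * ep t * w t x ^ 2 + ep t * (2 * w t x * (ut1 t x - ut2 t x))))
    (fun t x => K * (ep t * (sigma ^ 2 * (w t x * wx t x))) - em t * (sigma ^ 2 * (N t x * mu t x)))
    (fun _ _ => 0)
    (fun t x => em t * (- kappa * N t x ^ 2 - sigma ^ 2 * mu t x ^ 2
                        - 2 * N t x * (q1 t x * m1 t x - q2 t x * m2 t x))
       - K * (ep t * (kappa * w t x ^ 2 + 2 * r * w t x ^ 2
                      - 2 * w t x * (q1 t x ^ 2 - q2 t x ^ 2) + sigma ^ 2 * wx t x ^ 2)))
    (fun _ _ => 0) (fun _ => 0) T 0 L 0); try lra; try cont.
  - intros; rewrite Rabs_R0; lra.
  - assert (sq : forall (f : R -> R) z l, is_derive f z l -> is_derive (fun z => f z ^ 2) z (2 * f z * l)).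
    { intros f z l hf. replace (2 * f z * l) with (INR 2 * l * f z ^ pred 2) by (simpl; ring).
      now apply (is_derive_pow f). }
    intros q x hq hx.
    apply (is_derive_minus (fun t => em t * N t x ^ 2) (fun t => K * (ep t * w t x ^ 2))).
    + apply (Derive.is_derive_mult em (fun t => N t x ^ 2)); [apply dem|].
      apply (sq (fun t => N t x)). now apply dN_t.
    + apply (is_derive_scal (fun t => ep t * w t x ^ 2)).
      apply (Derive.is_derive_mult ep (fun t => w t x ^ 2)); [apply dep|].
      apply (sq (fun t => w t x)).
      apply (is_derive_minus (fun t => u1 t x) (fun t => u2 t x)).
      * now apply (rs_u_t sol1).
      * now apply (rs_u_t sol2).
  - intros q x hq hx. apply cont_minus; [cont|].
    apply cont_mult; [cont|]. apply cont_plus; [cont|]. apply cont_mult; [cont|].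
    apply cont_mult; [cont|]. apply cont_minus; [now apply (rs_ut sol1) | now apply (rs_ut sol2)].
  - intros q x hq hx.
    apply (is_derive_ext (fun x => K * (ep q * (sigma ^ 2 * (w q x * wx q x)))
                                   - em q * (sigma ^ 2 * (N q x * mu q x)))).
    { intros y. eqR. ring. }
    assert (E1 := rs_hjb sol1 q x hq hx). assert (E2 := rs_hjb sol2 q x hq hx).
    rewrite eP1 in E1 by lra. rewrite eP2 in E2 by lra.
    set (rhs := K * (ep q * (sigma ^ 2 * (wx q x * wx q x + w q x * (vx1 q x - vx2 q x))))
        - em q * (sigma ^ 2 * (- mu q x * mu q x + N q x * (mx1 q x - mx2 q x)))).
    assert (eR : forall z, z = rhs -> is_derive (fun x => K * (ep q * (sigma ^ 2 * (w q x * wx q x)))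
                                   - em q * (sigma ^ 2 * (N q x * mu q x))) x z).
    { intros z ->. unfold rhs.
      apply (is_derive_minus (fun x => K * (ep q * (sigma ^ 2 * (w q x * wx q x))))
               (fun x => em q * (sigma ^ 2 * (N q x * mu q x)))).
      - apply (is_derive_scal (fun x => ep q * (sigma ^ 2 * (w q x * wx q x)))).
        apply (is_derive_scal (fun x => sigma ^ 2 * (w q x * wx q x))).
        apply (is_derive_scal (fun x => w q x * wx q x)).
        apply (Derive.is_derive_mult (w q) (wx q)).
        + apply (is_derive_minus (u1 q) (u2 q)); [apply (rs_u_x sol1); lra | apply (rs_u_x sol2); lra].
        + apply (is_derive_minus (v1 q) (v2 q)); [now apply (rs_v_x sol1) | now apply (rs_v_x sol2)].
      - apply (is_derive_scal (fun x => sigma ^ 2 * (N q x * mu q x))).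
        apply (is_derive_scal (fun x => N q x * mu q x)).
        apply (Derive.is_derive_mult (N q) (mu q)); [apply dN_x|].
        apply (is_derive_minus (m1 q) (m2 q)); [apply (rs_m_x sol1); lra | apply (rs_m_x sol2); lra]. }
    apply eR. unfold rhs, F, flux.
    replace (ut1 q x - ut2 q x) with (r * w q x - (q1 q x ^ 2 - q2 q x ^ 2)
       - 1 / 2 * sigma ^ 2 * (vx1 q x - vx2 q x)).
    2:{ unfold q1, q2, w. lra. }
    unfold q1, q2. field.
  - intros q hq.
    assert (hq' : 0 <= q <= T) by lra.
    set (D := P1 q - P2 q).
    assert (hem : 0 < em q) by apply exp_pos. assert (hep : 0 < ep q) by apply exp_pos.
    assert (hem1 : em q <= 1).
    { unfold em. rewrite <- exp_0. apply exp_monotone.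
      assert (0 <= kappa * q) by (apply Rmult_le_pos; lra). lra. }
    assert (hep1 : 1 <= ep q).
    { unfold ep. rewrite <- exp_0. apply exp_monotone, Rmult_le_pos; lra. }
    assert (hemp : ep q <= em q * exp (2 * kappa * T)).
    { unfold em, ep. rewrite <- exp_plus. apply exp_monotone.
      assert (kappa * q <= kappa * T) by (apply Rmult_le_compat_l; lra). lra. }
    assert (w0 : w q 0 = 0) by (unfold w; rewrite (rs_u0 sol1), (rs_u0 sol2) by lra; ring).
    assert (wL : wx q L = 0) by (unfold wx; rewrite (rs_vL sol1), (rs_vL sol2) by lra; ring).
    assert (mu0 : mu q 0 = 0) by (unfold mu; rewrite (rs_ml sol1), (rs_ml sol2) by lra; ring).
    assert (NL : N q L = 0) by (unfold N; ring).
    rewrite w0, wL, mu0, NL.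
    assert (hX : 0 <= X q)
      by (apply RInt_ge_0_cont; [lra | intros; cont | intros; apply pow2_ge_0]).
    assert (hY : 0 <= Y q)
      by (apply RInt_ge_0_cont; [lra | intros; cont | intros; apply pow2_ge_0]).
    assert (gap : L * D ^ 2 <= del * (X q + Y q)).
    { unfold D, del. rewrite (Rmult_comm (eps ^ 2) L), 2!Rmult_assoc.
      apply Rmult_le_compat_l; [lra|]. rewrite <- Rmult_assoc. now apply price_gap. }
    assert (bound : RInt (fun x => em q * (- kappa * N q x ^ 2 - sigma ^ 2 * mu q x ^ 2
                        - 2 * N q x * (q1 q x * m1 q x - q2 q x * m2 q x))
       - K * (ep q * (kappa * w q x ^ 2 + 2 * r * w q x ^ 2
                      - 2 * w q x * (q1 q x ^ 2 - q2 q x ^ 2) + sigma ^ 2 * wx q x ^ 2))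
       + 0 * 0) 0 L <=
       RInt (fun x => em q * (- (sigma ^ 2 / 2) * mu q x ^ 2
                + th * (L * Y q) * m2 q x ^ 2 + / (2 * th) * D ^ 2 + / (2 * th) * wx q x ^ 2)
          - K * ep q * (1 / 2 * sigma ^ 2 * wx q x ^ 2 - D ^ 2)) 0 L).
    { apply RInt_le_cont; [lra | intros; cont | intros; cont |].
      intros x hx.
      assert (hv1' := hv1 q x hq' ltac:(lra)). assert (hv2' := hv2 q x hq' ltac:(lra)).
      assert (hP1 := hp1 q hq'). assert (hP2 := hp2 q hq').
      rewrite eP1 in hP1 by auto. rewrite eP2 in hP2 by auto.
      apply Rabs_le_between in hv1', hv2', hP1, hP2.
      assert (hq1 : Rabs (q1 q x) <= g) by (apply Rabs_le; unfold q1, g; lra).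
      assert (hq2 : Rabs (q2 q x) <= g) by (apply Rabs_le; unfold q2, g; lra).
      assert (A := transport_terms (sigma ^ 2) g th (q1 q x) (mu q x) (N q x) D (wx q x) (m2 q x)
                     hs2 hth hq1).
      assert (B := value_terms (sigma ^ 2) g r (q1 q x) (q2 q x) (w q x) D (wx q x) hs2 hq1 hq2).
      change (2 * Rabs r + g ^ 2 + 2 * g ^ 2 / sigma ^ 2) with kappa0 in B.
      assert (eA : q1 q x * m1 q x - q2 q x * m2 q x
                   = q1 q x * mu q x + 1 / 2 * (D - wx q x) * m2 q x)
        by (unfold q1, q2, mu, D, wx; field).
      assert (eB : q1 q x ^ 2 - q2 q x ^ 2 = 1 / 2 * (D - wx q x) * (q1 q x + q2 q x))
        by (unfold q1, q2, D, wx; field).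
      rewrite eA, eB.
      assert (N2 := tail_mass_sq_le q x ltac:(lra)).
      assert (N2' : th * (N q x ^ 2 * m2 q x ^ 2) <= th * (L * Y q) * m2 q x ^ 2).
      { rewrite Rmult_assoc. apply Rmult_le_compat_l; [lra|].
        apply Rmult_le_compat_r; [apply pow2_ge_0 | exact N2]. }
      assert (kN : (2 * g ^ 2 / sigma ^ 2) * N q x ^ 2 <= kappa * N q x ^ 2)
        by (apply Rmult_le_compat_r; [apply pow2_ge_0 | lra]).
      assert (kw : kappa0 * w q x ^ 2 <= kappa * w q x ^ 2)
        by (apply Rmult_le_compat_r; [apply pow2_ge_0 | lra]).
      replace ((D ^ 2 + wx q x ^ 2) / (2 * th))
        with (/ (2 * th) * D ^ 2 + / (2 * th) * wx q x ^ 2) in A by (field; lra).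
      assert (A' := Rmult_le_compat_l (em q) _ _ (Rlt_le _ _ hem)
         (Rle_trans _ _ _ ltac:(apply Rplus_le_compat_l with (r := - kappa * N q x ^ 2); exact A)
            (Rle_refl _))).
      assert (hKep : 0 <= K * ep q) by (apply Rmult_le_pos; lra).
      assert (B' := Rmult_le_compat_l (K * ep q) _ _ hKep B).
      assert (kN' := Rmult_le_compat_l (em q) _ _ (Rlt_le _ _ hem) kN).
      assert (N2'' := Rmult_le_compat_l (em q) _ _ (Rlt_le _ _ hem) N2').
      assert (kw' := Rmult_le_compat_l (K * ep q) _ _ hKep kw).
      lra. }
    assert (value : RInt (fun x => em q * (- (sigma ^ 2 / 2) * mu q x ^ 2
                + th * (L * Y q) * m2 q x ^ 2 + / (2 * th) * D ^ 2 + / (2 * th) * wx q x ^ 2)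
          - K * ep q * (1 / 2 * sigma ^ 2 * wx q x ^ 2 - D ^ 2)) 0 L
       = em q * (- (sigma ^ 2 / 2) * Y q + th * (L * Y q) * RInt (fun x => m2 q x ^ 2) 0 L
            + / (2 * th) * (L * D ^ 2) + / (2 * th) * X q)
         - K * ep q * (1 / 2 * sigma ^ 2 * X q - L * D ^ 2)).
    { assert (cst : forall c, RInt (fun _ : R => c) 0 L = L * c).
      { intros k. rewrite RInt_constant. eqR; ring. }
      rewrite RInt_minus_cont by (intros; cont).
      rewrite (RInt_scal_cont _ (em q)) by (intros; cont).
      rewrite (RInt_scal_cont _ (K * ep q)) by (intros; cont).
      rewrite RInt_minus_cont by (intros; cont).
      rewrite !RInt_plus_cont by (intros; cont).
      rewrite !RInt_scal_cont by (intros; cont). rewrite !cst.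
      fold (Y q). change (RInt (fun x => wx q x ^ 2) 0 L) with (X q). eqR; ring. }
    rewrite value in bound.
    assert (m2L : th * (L * Y q) * RInt (fun x => m2 q x ^ 2) 0 L <= sigma ^ 2 / 4 * Y q).
    { apply Rle_trans with (th * (L * Y q) * C).
      - apply Rmult_le_compat_l; [|now apply hC2].
        apply Rmult_le_pos; [lra | apply Rmult_le_pos; lra].
      - replace (th * (L * Y q) * C) with (th * (L * C) * Y q) by ring.
        apply Rmult_le_compat_r; auto. }
    assert (hith : 0 < / (2 * th)) by (apply Rinv_0_lt_compat; lra).
    set (Z := L * D ^ 2) in *.
    assert (c1 : em q * (- (sigma ^ 2 / 2) * Y q + th * (L * Y q) * RInt (fun x => m2 q x ^ 2) 0 L
            + / (2 * th) * Z + / (2 * th) * X q)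
       <= em q * (- (sigma ^ 2 / 4) * Y q + / (2 * th) * (del * (X q + Y q)) + / (2 * th) * X q)).
    { apply Rmult_le_compat_l; [lra|].
      assert (/ (2 * th) * Z <= / (2 * th) * (del * (X q + Y q)))
        by (apply Rmult_le_compat_l; lra). lra. }
    assert (hKep : 0 <= K * ep q) by (apply Rmult_le_pos; lra).
    assert (c2 : K * ep q * (1 / 2 * sigma ^ 2 * X q - del * (X q + Y q))
                 <= K * ep q * (1 / 2 * sigma ^ 2 * X q - Z)) by (apply Rmult_le_compat_l; lra).
    assert (hdel : 0 <= del).
    { unfold del. apply Rmult_le_pos; [apply Rmult_le_pos; [apply pow2_ge_0 | lra]|].
      assert (0 <= L * M ^ 2) by (apply Rmult_le_pos; [lra | apply pow2_ge_0]). lra. }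
    (* K = 8 / (th sigma^2) gives 2 / th against the 1 / th of the first term *)
    assert (cX : em q * (/ (2 * th) * (del + 1)) - K * ep q * (1 / 2 * sigma ^ 2 - del) <= 0).
    { assert (i1 : em q * (/ (2 * th) * (del + 1)) <= 1 * (/ (2 * th) * 2)).
      { apply Rmult_le_compat; [lra | apply Rmult_le_pos; lra | auto | apply Rmult_le_compat_l; lra]. }
      assert (i2 : K * 1 * (sigma ^ 2 / 4) <= K * ep q * (1 / 2 * sigma ^ 2 - del)).
      { apply Rmult_le_compat; [lra | lra | apply Rmult_le_compat_l; lra | lra]. }
      assert (i3 : K * 1 * (sigma ^ 2 / 4) = 2 / th) by (rewrite hK; field; lra).
      assert (i4 : 1 * (/ (2 * th) * 2) = 1 / th) by (field; lra).
      assert (0 < 1 / th) by (apply Rdiv_lt_0_compat; lra).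
      assert (2 / th = 1 / th + 1 / th) by (field; lra). lra. }
    (* ep and em differ by at most the factor exp(2 kappa T) *)
    assert (cY : em q * (- (sigma ^ 2 / 4) + / (2 * th) * del) + K * ep q * del <= 0).
    { assert (i1 : K * ep q * del <= K * (em q * exp (2 * kappa * T)) * del).
      { apply Rmult_le_compat_r; auto. apply Rmult_le_compat_l; lra. }
      assert (i2 : em q * (- (sigma ^ 2 / 4) + del * (1 / (2 * th) + K * exp (2 * kappa * T))) <= em q * 0)
        by (apply Rmult_le_compat_l; lra).
      replace (1 / (2 * th)) with (/ (2 * th)) in i2 by (field; lra). lra. }
    assert (cX' := Rmult_le_compat_r (X q) _ _ hX cX).
    assert (cY' := Rmult_le_compat_r (Y q) _ _ hY cY).
    lra.
Qed.

Lemma solutions_agree (th K : R) :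
  let del := eps ^ 2 * L * (C + L * M ^ 2 + 2 * L) in
  0 < th -> th * (L * C) <= sigma ^ 2 / 4 -> K = 8 / (th * sigma ^ 2) ->
  del <= 1 -> del <= sigma ^ 2 / 4 ->
  del * (1 / (2 * th) + K * exp (2 * (energy_rate sigma r M + 1) * T)) <= sigma ^ 2 / 4 ->
  forall t x, 0 <= t <= T -> 0 <= x <= L -> u1 t x = u2 t x /\ m1 t x = m2 t x.
Proof.
  intros del hth hthC hK hd1 hd2 hd3.
  fold kappa0 in hd3.
  pose proof (rs_m sol1) as cm1. pose proof (rs_m sol2) as cm2.
  pose proof (rs_u sol1) as cu1. pose proof (rs_u sol2) as cu2.
  assert (cN : cont2 N) by (unfold N; cont).
  assert (hs2 : 0 < sigma ^ 2) by (apply pow_lt; auto).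
  assert (hK0 : 0 < K)
    by (rewrite hK; apply Rdiv_lt_0_compat; [lra | now apply Rmult_lt_0_compat]).
  assert (hdel : 0 <= del).
  { unfold del. apply Rmult_le_pos; [apply Rmult_le_pos; [apply pow2_ge_0 | lra]|].
    assert (0 <= L * M ^ 2) by (apply Rmult_le_pos; [lra | apply pow2_ge_0]). lra. }
  assert (hW : forall t, 0 <= W t)
    by (intros; apply RInt_ge_0_cont; [lra | intros; cont | intros; apply pow2_ge_0]).
  assert (hV : forall t, 0 <= V t)
    by (intros; apply RInt_ge_0_cont; [lra | intros; cont | intros; apply pow2_ge_0]).
  assert (zero : forall h : R -> R, (forall x, 0 <= x <= L -> h x = 0) -> RInt (fun x => h x ^ 2) 0 L = 0).
  { intros h hh. apply RInt_eq_0; [lra|]. intros x hx. rewrite hh by lra. ring. }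
  assert (WT : W T = 0).
  { apply zero. intros x hx. rewrite (rs_uT sol1), (rs_uT sol2) by auto. ring. }
  assert (V0 : V 0 = 0).
  { apply zero. intros x hx.
    assert (z : forall y, 0 <= y <= L -> Mu 0 y = 0).
    { intros y hy. apply RInt_eq_0; [lra|]. intros q hq. unfold mu.
      rewrite (rs_m0 sol1), (rs_m0 sol2) by lra. ring. }
    unfold N. rewrite !z by lra. ring. }
  (* the energy is nonincreasing, nonpositive initially and nonnegative finally *)
  assert (E : forall kappa, kappa0 <= kappa <= kappa0 + 1 -> forall t, 0 <= t <= T ->
    exp (- kappa * t) * V t = K * (exp (kappa * t) * W t)).
  { intros kappa hk t ht.
    assert (hd3' : del * (1 / (2 * th) + K * exp (2 * kappa * T)) <= sigma ^ 2 / 4).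
    { apply Rle_trans with (2 := hd3). apply Rmult_le_compat_l; auto.
      apply Rplus_le_compat_l, Rmult_le_compat_l; [lra|].
      apply exp_monotone, Rmult_le_compat_r; lra. }
    assert (mono := coupled_energy_nonincreasing th K kappa hth hthC hK (proj1 hk) hd1 hd2 hd3').
    assert (i1 := mono 0 t ltac:(lra) ltac:(lra)). assert (i2 := mono t T ltac:(lra) ltac:(lra)).
    rewrite V0 in i1. rewrite WT in i2.
    assert (0 <= K * (exp (kappa * 0) * W 0)).
    { apply Rmult_le_pos; [lra|]. apply Rmult_le_pos; [apply Rlt_le, exp_pos | apply hW]. }
    assert (0 <= exp (- kappa * T) * V T)
      by (apply Rmult_le_pos; [apply Rlt_le, exp_pos | apply hV]).
    lra. }
  (* kappa0 and kappa0 + 1 would prescribe two different ratios of V and W *)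
  assert (both : forall t, 0 <= t <= T -> V t = 0 /\ W t = 0).
  { intros t ht. destruct (Req_dec t 0) as [->|hne].
    - split; [exact V0|]. assert (e := E kappa0 ltac:(lra) 0 ht).
      rewrite V0, !Rmult_0_r, exp_0 in e. apply Rmult_eq_reg_l with K; lra.
    - assert (e1 := E kappa0 ltac:(lra) t ht). assert (e2 := E (kappa0 + 1) ltac:(lra) t ht).
      assert (s1 : exp (- (kappa0 + 1) * t) = exp (- kappa0 * t) * exp (- t))
        by (rewrite <- exp_plus; f_equal; ring).
      assert (s2 : exp ((kappa0 + 1) * t) = exp (kappa0 * t) * exp t)
        by (rewrite <- exp_plus; f_equal; ring).
      rewrite s1, s2 in e2.
      assert (e3 : K * (exp (kappa0 * t) * W t) * (exp t - exp (- t)) = 0).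
      { replace (K * (exp (kappa0 * t) * W t) * (exp t - exp (- t)))
          with (K * (exp (kappa0 * t) * exp t * W t) - K * (exp (kappa0 * t) * W t) * exp (- t))
          by ring.
        rewrite <- e2, <- e1. ring. }
      assert (hinc : exp (- t) < exp t) by (apply exp_increasing; lra).
      assert (hexp := exp_pos (kappa0 * t)). assert (hexm := exp_pos (- kappa0 * t)).
      assert (W0 : W t = 0).
      { destruct (Rmult_integral _ _ e3) as [e|e]; [|lra].
        destruct (Rmult_integral _ _ e) as [e'|e']; [lra|].
        destruct (Rmult_integral _ _ e'); lra. }
      split; auto. rewrite W0, !Rmult_0_r in e1.
      destruct (Rmult_integral _ _ e1); lra. }
  intros t x ht hx. destruct (both t ht) as [vt wt]. split.
  - assert (z := zero_of_RInt_le_0 (fun x => (u1 t x - u2 t x) ^ 2) 0 L hL ltac:(intros; cont)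
      ltac:(intros; apply pow2_ge_0) (Req_le _ _ wt) x hx).
    simpl in z. nra.
  - assert (z := zero_of_RInt_le_0 (fun x => N t x ^ 2) 0 L hL ltac:(intros; cont)
      ltac:(intros; apply pow2_ge_0) (Req_le _ _ vt)).
    assert (hmu : Rabs (mu t x) <= 0).
    { apply (slope_le_lipschitz_constant (Mu t) (mu t) 0 L); auto.
      - intros y hy. apply (is_derive_primitive (mu t)). intros; cont.
      - intros y; cont.
      - intros y1 y2 h1 h2. assert (z1 := z y1 ltac:(lra)). assert (z2 := z y2 ltac:(lra)).
        simpl in z1, z2. assert (n1 : N t y1 = 0) by nra. assert (n2 : N t y2 = 0) by nra.
        unfold N in n1, n2. replace (Mu t y1 - Mu t y2) with 0 by lra.
        rewrite Rabs_R0. lra. }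
    apply Rabs_le_between in hmu. unfold mu in hmu. lra.
Qed.

End two_solutions.

(** The threshold depends on T, L, sigma, r and the two bounds only. It is chosen
    with th (L C) <= sigma^2 / 4, so that N^2 m2^2 takes a part of the diffusion
    of N. *)
Lemma small_coupling_uniqueness T L sigma r M C :
  0 < T -> 0 < L -> 0 < sigma -> 0 <= M -> 0 <= C ->
  exists D, 0 < D /\ forall eps, 0 <= eps <= D ->
  forall uT m0 u1 ut1 v1 vx1 m1 mt1 mx1 u2 ut2 v2 vx2 m2 mt2 mx2,
  (forall x, 0 <= x <= L -> 0 <= m0 x) ->
  regular_solution T L sigma r eps uT m0 u1 ut1 v1 vx1 m1 mt1 mx1 ->
  regular_solution T L sigma r eps uT m0 u2 ut2 v2 vx2 m2 mt2 mx2 ->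
  (forall t x, 0 <= t <= T -> 0 <= x <= L -> Rabs (v1 t x) <= M /\ Rabs (v2 t x) <= M) ->
  (forall t, 0 <= t <= T ->
     Rabs (price eps L v1 m1 t) <= 2 /\ Rabs (price eps L v2 m2 t) <= 2) ->
  (forall t, 0 <= t <= T ->
     RInt (fun x => m1 t x ^ 2) 0 L <= C /\ RInt (fun x => m2 t x ^ 2) 0 L <= C) ->
  forall t x, 0 <= t <= T -> 0 <= x <= L -> u1 t x = u2 t x /\ m1 t x = m2 t x.
Proof.
  intros hT hL hsigma hM hC.
  assert (hs2 : 0 < sigma ^ 2) by (apply pow_lt; auto).
  assert (hLC : 0 <= L * C) by (apply Rmult_le_pos; lra).
  assert (hLM : 0 <= L * M ^ 2) by (apply Rmult_le_pos; [lra | apply pow2_ge_0]).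
  set (th := sigma ^ 2 / 4 / (L * C + 1)).
  assert (hth : 0 < th) by (unfold th; apply Rdiv_lt_0_compat; lra).
  set (K := 8 / (th * sigma ^ 2)).
  assert (hK : 0 < K) by (unfold K; apply Rdiv_lt_0_compat; [lra | now apply Rmult_lt_0_compat]).
  set (Q := 1 / (2 * th) + K * exp (2 * (energy_rate sigma r M + 1) * T)).
  assert (hQ : 0 < Q).
  { unfold Q. apply Rplus_lt_0_compat; [apply Rdiv_lt_0_compat; lra|].
    apply Rmult_lt_0_compat; [lra | apply exp_pos]. }
  set (A := L * (C + L * M ^ 2 + 2 * L)).
  assert (hA : 0 < A) by (unfold A; apply Rmult_lt_0_compat; lra).
  set (D0 := Rmin (Rmin 1 (sigma ^ 2 / 4)) (sigma ^ 2 / 4 / Q)).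
  assert (hD0 : 0 < D0).
  { unfold D0. repeat apply Rmin_glb_lt; try lra. apply Rdiv_lt_0_compat; lra. }
  exists (Rmin 1 (D0 / A)). split.
  { apply Rmin_glb_lt; [lra | now apply Rdiv_lt_0_compat]. }
  intros eps heps uT m0 u1 ut1 v1 vx1 m1 mt1 mx1 u2 ut2 v2 vx2 m2 mt2 mx2 hm0 s1 s2 hv hp hC'.
  assert (e1 : eps <= 1) by (apply Rle_trans with (2 := Rmin_l 1 (D0 / A)); lra).
  assert (e2 : eps <= D0 / A) by (apply Rle_trans with (2 := Rmin_r 1 (D0 / A)); lra).
  assert (hdel : eps ^ 2 * L * (C + L * M ^ 2 + 2 * L) <= D0).
  { replace (eps ^ 2 * L * (C + L * M ^ 2 + 2 * L)) with (eps * (eps * A)) by (unfold A; ring).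
    apply Rle_trans with (1 * (D0 / A * A)); [|apply Req_le; field; lra].
    apply Rmult_le_compat; try lra.
    - apply Rmult_le_pos; lra.
    - apply Rmult_le_compat_r; lra. }
  assert (d12 : D0 <= Rmin 1 (sigma ^ 2 / 4)) by apply Rmin_l.
  assert (d1 : D0 <= 1) by (apply Rle_trans with (1 := d12), Rmin_l).
  assert (d2 : D0 <= sigma ^ 2 / 4) by (apply Rle_trans with (1 := d12), Rmin_r).
  assert (d3 : D0 <= sigma ^ 2 / 4 / Q) by apply Rmin_r.
  apply (solutions_agree hT hL hsigma (proj1 heps) hm0 s1 s2 M C hC
    (fun t x ht hx => proj1 (hv t x ht hx)) (fun t x ht hx => proj2 (hv t x ht hx))
    (fun t ht => proj1 (hp t ht)) (fun t ht => proj2 (hp t ht))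
    (fun t ht => proj1 (hC' t ht)) (fun t ht => proj2 (hC' t ht)) th K hth).
  - apply Rle_trans with (th * (L * C + 1)); [apply Rmult_le_compat_l; lra|].
    apply Req_le. unfold th. field. lra.
  - reflexivity.
  - lra.
  - lra.
  - apply Rle_trans with (sigma ^ 2 / 4 / Q * Q).
    + apply Rmult_le_compat_r; lra.
    + apply Req_le. field. lra.
Qed.

(** * From the data to the threshold *)

(** Relative differentiability at the end points gives continuity up to them. *)
Lemma continuous_clamped L (f f' : R -> R) :
  0 < L -> derivative_on L f f' -> forall x, continuous (fun y => f (clamp L y)) x.
Proof.
  intros hL hf x. apply continuous_of_near. intros e he.
  assert (hx := clamp_range L x (Rlt_le _ _ hL)).
  destruct (cont_deriv f f' (space L) (clamp L x) (hf _ hx) e he) as (al & hal & H).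
  destruct (near_of_continuous (clamp L) x al (cont_clamp L x) hal) as [d hd].
  exists d. intros y hy. specialize (hd y hy). specialize (H (clamp L y)).
  destruct (Req_dec (clamp L x) (clamp L y)) as [E|E].
  - rewrite E, Rminus_diag, Rabs_R0. exact he.
  - apply H. split; [split; [exact (clamp_range L y (Rlt_le _ _ hL)) | exact E] | exact hd].
Qed.

Lemma lipschitz_of_derivative_on L (f f' f'' : R -> R) :
  0 < L -> derivative_on L f f' -> derivative_on L f' f'' ->
  exists M0, 0 <= M0 /\
    forall x y, 0 <= y <= x -> x <= L -> Rabs (f x - f y) <= M0 * (x - y).
Proof.
  intros hL hf hf'.
  assert (cf := continuous_clamped L f f' hL hf).
  assert (cf' := continuous_clamped L f' f'' hL hf').
  destruct (bounded_2d (fun _ x => f' (clamp L x)) 0 1 0 L) as (M0 & hM0 & hb); [lra | lra | |].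
  { intros t x. apply (cont_comp (fun y => f' (clamp L y)) snd); [cont | exact cf']. }
  exists M0. split; [exact hM0|]. intros x y hy hx.
  destruct (Req_dec x y) as [->|hne].
  { rewrite !Rminus_diag, Rabs_R0. lra. }
  destruct (MVT_open (fun y => f (clamp L y)) (fun y => f' (clamp L y)) y x) as (z & hz & e).
  - lra.
  - intros z hz. rewrite (clamp_id L z) by lra.
    apply is_derive_ext_loc with f.
    + generalize (locally_interior 0 L z ltac:(lra)). apply filter_imp.
      intros q hq. rewrite clamp_id by lra. reflexivity.
    + apply is_derive_on_interior with L; [exact hf | lra].
  - intros z _. apply cf.
  - rewrite !clamp_id in e by lra. rewrite e, Rabs_mult, (Rabs_pos_eq (x - y)) by lra.
    apply Rmult_le_compat_r; [lra|]. specialize (hb 0 z ltac:(lra) ltac:(lra)).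
    rewrite clamp_id in hb by lra. exact hb.
Qed.

Theorem theorem4p1 (T L sigma r : R) (uT m0 : R -> R)
    (hT : 0 < T) (hL : 0 < L) (hsigma : 0 < sigma)
    (hdata : standing_data L uT m0) :
  exists eps0 : R, 0 < eps0 /\
    forall eps : R, 0 <= eps <= eps0 ->
    forall u1 m1 u2 m2 : R -> R -> R,
      classical_solution T L sigma r eps uT m0 u1 m1 ->
      classical_solution T L sigma r eps uT m0 u2 m2 ->
      forall t x : R, 0 <= t <= T -> 0 <= x <= L ->
        u1 t x = u2 t x /\ m1 t x = m2 t x.
Proof.
  destruct hdata as (gam & uT' & m0' & _ & (uT'' & duT & duT' & _) & _ & (uT0 & _) & _
    & (m0pos & m0mass) & uTpos).
  destruct (lipschitz_of_derivative_on L uT uT' uT'' hL duT duT') as (M0 & hM0 & lip).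
  set (M := slope_bound T L sigma r M0).
  assert (hM : 0 <= M) by (apply Rle_trans with M0; [auto | now apply slope_bound_ge]).
  set (C := Rmax 0 (exp (2 * (2 + M) ^ 2 / (8 * sigma ^ 2) * T) * RInt (fun x => m0 x ^ 2) 0 L)).
  destruct (small_coupling_uniqueness T L sigma r M C hT hL hsigma hM (Rmax_l _ _))
    as (D & hD & uniq).
  exists (Rmin D (2 / (M + 1))). split.
  { apply Rmin_glb_lt; [auto | apply Rdiv_lt_0_compat; lra]. }
  intros eps heps u1 m1 u2 m2 c1 c2 t x ht hx.
  assert (e1 : eps <= D) by (apply Rle_trans with (2 := Rmin_l D (2 / (M + 1))); lra).
  assert (e2 : eps <= 2 / (M + 1)) by (apply Rle_trans with (2 := Rmin_r D (2 / (M + 1))); lra).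
  assert (e3 : eps * (M + 1) <= 2).
  { apply Rle_trans with (2 / (M + 1) * (M + 1)); [apply Rmult_le_compat_r; lra|].
    apply Req_le. field. lra. }
  assert (e4 : eps * M <= 2) by (apply Rle_trans with (2 := e3), Rmult_le_compat_l; lra).
  destruct (classical_solution_regular _ _ _ _ _ _ _ _ _ hT hL c1)
    as (U1 & ut1 & v1 & vx1 & N1 & mt1 & mx1 & s1 & q1).
  destruct (classical_solution_regular _ _ _ _ _ _ _ _ _ hT hL c2)
    as (U2 & ut2 & v2 & vx2 & N2 & mt2 & mx2 & s2 & q2).
  destruct (q1 t x ht hx) as [-> ->]. destruct (q2 t x ht hx) as [-> ->].
  assert (est : forall u ut v vx m mt mx,
    regular_solution T L sigma r eps uT m0 u ut v vx m mt mx ->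
    (forall t x, 0 <= t <= T -> 0 <= x <= L -> Rabs (v t x) <= M) /\
    (forall t, 0 <= t <= T -> Rabs (price eps L v m t) <= 2) /\
    (forall t, 0 <= t <= T -> RInt (fun x => m t x ^ 2) 0 L <= C)).
  { intros u ut v vx m mt mx s.
    assert (hv : forall t x, 0 <= t <= T -> 0 <= x <= L -> Rabs (v t x) <= M).
    { apply (slope_bounded hT hL hsigma s M0); auto; try lra.
      intros y hy. apply (uTpos y hy). }
    assert (hp : forall t, 0 <= t <= T -> Rabs (price eps L v m t) <= 2).
    { intros q hq. apply (price_le_2 hT hL hsigma s M); auto; lra. }
    split; [exact hv|]. split; [exact hp|].
    intros q hq. eapply Rle_trans; [|apply Rmax_r].
    apply (density_L2_bound hT hL hsigma s); auto.
    intros z y hz hy. unfold Rminus. eapply Rle_trans; [apply Rabs_triang|].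
    rewrite Rabs_Ropp. apply Rplus_le_compat; auto. }
  destruct (est _ _ _ _ _ _ _ s1) as (a1 & b1 & d1).
  destruct (est _ _ _ _ _ _ _ s2) as (a2 & b2 & d2).
  apply (uniq eps ltac:(lra) uT m0 U1 ut1 v1 vx1 N1 mt1 mx1 U2 ut2 v2 vx2 N2 mt2 mx2); auto.
Qed.
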